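(* Assume condition (ND) holds. Then there are constants $0<c\le C<+\infty$ such that for $\mu_0$-a.s. $x$: $$c\le\limsup_{h\to0}\frac{\Delta_1F(x,x+h)}{\left(\log_2(1/|h|)\,\log\log\log_2(1/|h|)\right)^{1/2}}\le C,$$ $$-C\le\liminf_{h\to0}\frac{\Delta_1F(x,x+h)}{\left(\log_2(1/|h|)\,\log\log\log_2(1/|h|)\right)^{1/2}}\le-c .$$
   Context: Setting. Let $E\subset\mathbb{R}^3$ be the set of $(b,u,v)$ with $0<b<1$, $b-1<u<\frac1b-1$, $-b<v<\frac{b}{1-b}$, and such that $(1+v)(1-b(1+u))^2<1-b$ or $(b+v)^2<b(1+u)(1+v)^2$. Fix an open interval $I\ni 0$ and a smooth ($C^\infty$) curve $t\mapsto(b_1(t),c_0(t),c_1(t))\in E$, $t\in I$; write $b_1,c_0,c_1$ for the values at $t=0$. For $A=\begin{pmatrix}a&b\\c&d\end{pmatrix}$ put $\Phi(A;z)=\frac{az+b}{cz+d}$, and let $$A_0(t)=\begin{pmatrix}b_1(t)(1+c_0(t))&0\\c_0(t)&1\end{pmatrix},\quad A_1(t)=\begin{pmatrix}1-b_1(t)+c_1(t)&b_1(t)\\c_1(t)&1\end{pmatrix}.$$ For $t\in I$, $F(t,\cdot)$ is the unique continuous $f:[0,1]\to[0,1]$ with $f(x)=\Phi(A_0(t);f(2x))$ for $0\le x\le\frac12$ and $f(x)=\Phi(A_1(t);f(2x-1))$ for $\frac12\le x\le1$; it is strictly increasing with $F(t,0)=0$, $F(t,1)=1$, and $\mu_t$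 is the probability measure on $[0,1]$ with distribution function $F(t,\cdot)$. Write $F(x)=F(0,x)$, $f_1(x)=\partial_tF(0,x)$ (exists, continuous in $x$), $\Delta_1F(x,y)=\frac{f_1(x)-f_1(y)}{F(x)-F(y)}$ for $x\ne y$. Condition (ND). Put $G_0(t,y)=b_1(t)(1+c_0(t))y+c_0(t)$, $G_1(t,y)=\frac{(1-b_1(t)+c_1(t))y+c_1(t)}{b_1(t)y+1}$, $\alpha=\min\{0,\frac{c_0}{1-b_1(1+c_0)},\frac{c_1}{b_1}\}$, $\beta=\max\{0,\frac{c_0}{1-b_1(1+c_0)},\frac{c_1}{b_1}\}$. The dual curve is $(\widetilde b_1,\widetilde c_0,\widetilde c_1)(t)=\left(1-b_1(t),-\frac{c_1(t)}{1+c_1(t)},-\frac{c_0(t)}{1+c_0(t)}\right)$, and $\widetilde G_i,\widetilde\alpha,\widetilde\beta$ are defined from it by the same formulas. Let $\delta_i=\min_{y\in[\alpha,\beta]}\frac{\partial_tG_i(0,y)}{1-\partial_yG_i(0,y)}$, $\widetilde\delta_i=\max_{y\in[\widetilde\alpha,\widetilde\beta]}\frac{\partial_t\widetilde G_i(0,y)}{1-\partial_y\widetilde G_i(0,y)}$, $i=0,1$ ($\delta_1$ is considered defined only if $\partial_yG_1(0,\cdot)<1$ on $[\alpha,\beta]$, $\widetilde\delta_1$ only if $\partial_y\widetilde G_1(0,\cdot)<1$ on $[\widetilde\alpha,\widetilde\beta]$; at least one is defined). (ND) means: either $\delta_1$ is defined and $b_1'(0)(\alpha+1)+b_1(1-b_1)\min\{0,\delta_0,\delta_1\}>0$,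 or $\widetilde\delta_1$ is defined and $\widetilde b_1'(0)(\widetilde\alpha+1)+\widetilde b_1(0)(1-\widetilde b_1(0))\max\{0,\widetilde\delta_0,\widetilde\delta_1\}<0$. *)

(* Defs.v *)
From HB Require Import structures.
From mathcomp Require Import all_boot all_order all_algebra.
From mathcomp Require Import all_classical all_reals all_analysis.

Set Implicit Arguments.
Unset Strict Implicit.
Unset Printing Implicit Defensive.

Import Order.TTheory GRing.Theory Num.Theory.
Import numFieldNormedType.Exports.

Local Open Scope classical_set_scope.
Local Open Scope ring_scope.

Definition in_E {R : realType} (b u v : R) : Prop :=
  [/\ 0 < b < 1, b - 1 < u < b^-1 - 1, - b < v < b / (1 - b)
    & (1 + v) * (1 - b * (1 + u)) ^+ 2 < 1 - b \/
      (b + v) ^+ 2 < b * (1 + u) * (1 + v) ^+ 2].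

Definition open_interval {R : realType} (I : set R) : Prop :=
  open I /\ is_interval I.

(* Only the values of [f] on the open set [I] matter, since derivatives are
   local. *)
Definition smooth_on {R : realType} (I : set R) (f : R -> R) : Prop :=
  forall (n : nat) (t : R), I t -> derivable (derive1n n f) t 1.

Definition mx22 {R : realType} (a b c d : R) : 'M[R]_2 :=
  \matrix_(i < 2, j < 2)
    if i == 0 then (if j == 0 then a else b) else (if j == 0 then c else d).

Definition Phi {R : realType} (A : 'M[R]_2) (z : R) : R :=
  (A 0 0 * z + A 0 1) / (A 1 0 * z + A 1 1).

Definition A0 {R : realType} (b1 c0 : R -> R) (t : R) : 'M[R]_2 :=
  mx22 (b1 t * (1 + c0 t)) 0 (c0 t) 1.

Definition A1 {R : realType} (b1 c1 : R -> R) (t : R) : 'M[R]_2 :=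
  mx22 (1 - b1 t + c1 t) (b1 t) (c1 t) 1.

(* The functional equations determine [f] on [0, 1]; its values elsewhere are
   unconstrained. *)
Definition deRham_solution {R : realType} (M0 M1 : 'M[R]_2) (f : R -> R) :
    Prop :=
  [/\ {within `[0, 1], continuous f},
      forall x, 0 <= x <= 1 -> 0 <= f x <= 1,
      forall x, 0 <= x <= 2^-1 -> f x = Phi M0 (f (2 * x))
    & forall x, 2^-1 <= x <= 1 -> f x = Phi M1 (f (2 * x - 1))].

(* Since [f 1 = 1] for the functions used here, the case [x = 1] says that
   [mu] is concentrated on [0, 1]. *)
Definition has_df01 {R : realType} (mu : probability (measurableTypeR R) R)
    (f : R -> R) : Prop :=
  forall x : R, 0 <= x <= 1 -> mu `[0, x]%classic = (f x)%:E.

(* [derive1] is total; for the families [F] considered here the derivative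
   exists at every [x] in [0, 1]. *)
Definition f1 {R : realType} (F : R -> R -> R) (x : R) : R :=
  derive1 (F ^~ x) 0.

Definition Delta1 {R : realType} (F : R -> R -> R) (x y : R) : R :=
  (f1 F x - f1 F y) / (F 0 x - F 0 y).

Definition log2 {R : realType} (x : R) : R := ln x / ln 2.

Definition lil_scale {R : realType} (h : R) : R :=
  Num.sqrt (log2 (1 / `|h|) * ln (ln (log2 (1 / `|h|)))).

Definition G0 {R : realType} (b1 c0 : R -> R) (t y : R) : R :=
  b1 t * (1 + c0 t) * y + c0 t.

Definition G1 {R : realType} (b1 c1 : R -> R) (t y : R) : R :=
  ((1 - b1 t + c1 t) * y + c1 t) / (b1 t * y + 1).

Definition alpha {R : realType} (b1 c0 c1 : R -> R) : R :=
  Num.min 0 (Num.min (c0 0 / (1 - b1 0 * (1 + c0 0))) (c1 0 / b1 0)).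

Definition beta {R : realType} (b1 c0 c1 : R -> R) : R :=
  Num.max 0 (Num.max (c0 0 / (1 - b1 0 * (1 + c0 0))) (c1 0 / b1 0)).

Definition dual_b1 {R : realType} (b1 : R -> R) (t : R) : R :=
  1 - b1 t.

Definition dual_c0 {R : realType} (c1 : R -> R) (t : R) : R :=
  - (c1 t / (1 + c1 t)).

Definition dual_c1 {R : realType} (c0 : R -> R) (t : R) : R :=
  - (c0 t / (1 + c0 t)).

(* Attained minima and maxima, so that no default value is involved. *)
Definition is_min_on {R : realType} (S : set R) (g : R -> R) (m : R) : Prop :=
  (exists2 y, S y & g y = m) /\ (forall y, S y -> m <= g y).

Definition is_max_on {R : realType} (S : set R) (g : R -> R) (m : R) : Prop :=
  (exists2 y, S y & g y = m) /\ (forall y, S y -> g y <= m).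

Definition delta_fun {R : realType} (G : R -> R -> R) (y : R) : R :=
  derive1 (G ^~ y) 0 / (1 - derive1 (G 0) y).

Definition ND_lower {R : realType} (b1 c0 c1 : R -> R) : Prop :=
  let J := `[alpha b1 c0 c1, beta b1 c0 c1]%classic in
  (forall y, J y -> derive1 (G1 b1 c1 0) y < 1) /\
  exists d0 d1 : R,
    [/\ is_min_on J (delta_fun (G0 b1 c0)) d0,
        is_min_on J (delta_fun (G1 b1 c1)) d1
      & 0 < derive1 b1 0 * (alpha b1 c0 c1 + 1)
            + b1 0 * (1 - b1 0) * Num.min 0 (Num.min d0 d1)].

(* To be applied to the dual curve. *)
Definition ND_upper {R : realType} (b1 c0 c1 : R -> R) : Prop :=
  let J := `[alpha b1 c0 c1, beta b1 c0 c1]%classic in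
  (forall y, J y -> derive1 (G1 b1 c1 0) y < 1) /\
  exists d0 d1 : R,
    [/\ is_max_on J (delta_fun (G0 b1 c0)) d0,
        is_max_on J (delta_fun (G1 b1 c1)) d1
      & derive1 b1 0 * (alpha b1 c0 c1 + 1)
            + b1 0 * (1 - b1 0) * Num.max 0 (Num.max d0 d1) < 0].

Definition ND {R : realType} (b1 c0 c1 : R -> R) : Prop :=
  ND_lower b1 c0 c1 \/
  ND_upper (dual_b1 b1) (dual_c0 c1) (dual_c1 c0).

(* Main.v *)
(* For a binary word w let m_t(w) be the mu_t-mass of its dyadic cell, and let
   D(w) be the derivative of log m_t(w) at t = 0.  The conditional distribution
   function in the cell of w is F(t, .) followed by a Moebius map depending on a
   single state y, and y is moved by G_0 or G_1 when a digit is appended.  Hence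
   D is a mu_0-martingale with bounded increments along the digits of x.  (ND)
   says that the t-derivative of the log-odds of the next digit, which is
   proportional to b_1' (1 + y) + b_1 (1 - b_1) y', has a constant sign: in its
   first form it keeps y' above min(0, delta_0, delta_1), and its second form is
   the same condition after the reflection x -> 1 - x.  So the conditional
   variance of D is bounded below, and two-sided exponential moment bounds with
   the Borel-Cantelli lemma give a law of the iterated logarithm for D with
   non-sharp constants.  As f_1 is almost Lipschitz with respect to F (with a
   logarithmic loss) and runs of equal digits among the first n have length
   O(log n), the quotient Delta_1 F(x, x + h) for |h| ~ 2^-n differs from D at
   the n-th cell of x by o(sqrt n), and the law passes to it. *)

Require Import Defs.
From HB Require Import structures.
From mathcomp Require Import all_boot all_order all_algebra.
From mathcomp Require Import all_classical all_reals all_analysis.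
From mathcomp Require Import measurable_realfun ring lra zify.

Import Order.TTheory GRing.Theory Num.Theory.
Import numFieldNormedType.Exports.

Local Open Scope classical_set_scope.
Local Open Scope ring_scope.

Set Implicit Arguments.
Unset Strict Implicit.
Unset Printing Implicit Defensive.

(** Every estimate must be uniform in the binary word. For all small [t] and all words the states
    stay in one compact subset of [(-1, +oo)], because at [t = 0] the maps [G_i] of the curve or of
    its dual still contract slightly beyond [[alpha, beta]]; a perturbed orbit therefore drifts by
    only [O(t)]. The existence of the [t]-derivative is itself obtained from the recursion for
    conditional distribution functions. Times are grouped at powers of 2, so that [ln (ln n)]
    becomes comparable to [ln k]. With tilting parameter of order [sqrt (ln k / 2 ^ k)], exponential
    bounds turn into powers of [k.+1]: exponent 2 gives summable probabilities for the upper half,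
    exponent at most 1 a divergent series for the lower half. There, bounds conditional on an
    arbitrary prefix replace independence. The point [x + h] with [|h| ~ 2^-n] often leaves the
    [n]-th cell of [x]. The comparison with the martingale therefore takes place in a cell shorter
    by a run length [l], which still contains [x + h], and costs [O(l)]. *)

Lemma expR_ge_quad {R : realType} (x : R) : -1 <= x -> 1 + x + x ^+ 2 / 4 <= expR x.
Proof.
move=> x1; have -> : expR x = expR (x / 2) * expR (x / 2).
  by rewrite -expRD; congr expR; field.
have h := expR_ge1Dx (x / 2).
by nra.
Qed.

(** Inverting [1 - x / 2 <= expR (- (x / 2))] bounds [expR x] by the inverse of [(1 - x / 2) ^+ 2];
    the coefficient 2 is large enough to dominate this on all of [[-1, 1]]. *)
Lemma expR_le_quad {R : realType} (x : R) : `|x| <= 1 -> expR x <= 1 + x + 2 * x ^+ 2.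
Proof.
rewrite ler_norml => /andP[x1 x2].
have h := expR_ge1Dx (- (x / 2)).
have e : expR x * (expR (- (x / 2)) * expR (- (x / 2))) = 1.
  by rewrite -!expRD (_ : x + _ = 0) ?expR0 //; field.
set a := expR (- (x / 2)) in h e *.
have h2 : (1 - x / 2) ^+ 2 <= a * a by rewrite expr2; apply: ler_pM; try lra.
have p := expR_gt0 x.
have h3 : expR x * (1 - x / 2) ^+ 2 <= 1 by rewrite -[leRHS]e ler_wpM2l // ltW.
have h4 : 1 <= (1 + x + 2 * x ^+ 2) * (1 - x / 2) ^+ 2.
  have -> : (1 + x + 2 * x ^+ 2) * (1 - x / 2) ^+ 2 =
    1 + x ^+ 2 * (1 - x) * (5 / 4 - x / 2) by field.
  by rewrite lerDl; apply: mulr_ge0; [apply: mulr_ge0; rewrite ?sqr_ge0 ?subr_ge0|lra].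
rewrite -(ler_pM2r (x := (1 - x / 2) ^+ 2)); first exact: le_trans h3 h4.
by nra.
Qed.

(** * Bounded martingales on the binary tree *)

Section Tree.
Context {R : realType}.
Variable pb : seq bool -> bool -> R.

(** Conditional expectation given the prefix [w], when the digit after [w] has law [pb w]. It is a
    finite sum, so the whole martingale theory below is free of measure theory. *)
Fixpoint Ex (n : nat) (phi : seq bool -> R) (w : seq bool) : R :=
  if n is n'.+1 then
    pb w false * Ex n' phi (rcons w false) + pb w true * Ex n' phi (rcons w true)
  else phi w.

Hypothesis pb_ge0 : forall w i, 0 <= pb w i.
Hypothesis pb_sum : forall w, pb w false + pb w true = 1.

Lemma Ex_le n phi psi w :
  (forall v, size v = n -> phi (w ++ v) <= psi (w ++ v)) ->
  Ex n phi w <= Ex n psi w.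
Proof.
elim: n w => [|n IH] w h /=; first by have := h [::] erefl; rewrite cats0.
by apply: lerD; rewrite ler_wpM2l //; apply: IH => v sv;
  rewrite cat_rcons; apply: h; rewrite /= sv.
Qed.

Lemma Ex_ext n phi psi w :
  (forall v, size v = n -> phi (w ++ v) = psi (w ++ v)) ->
  Ex n phi w = Ex n psi w.
Proof. by move=> h; apply/le_anti; rewrite !Ex_le// => v /h ->. Qed.

Lemma Ex_cst n c w : Ex n (fun=> c) w = c.
Proof. by elim: n w => //= n IH w; rewrite !IH -mulrDl pb_sum mul1r. Qed.

Lemma ExD n phi psi w : Ex n (phi \+ psi) w = Ex n phi w + Ex n psi w.
Proof. by elim: n w => //= n IH w; rewrite !IH; ring. Qed.

Lemma ExZ n c phi w : Ex n (c \*o phi) w = c * Ex n phi w.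
Proof. by elim: n w => //= n IH w; rewrite !IH; ring. Qed.

Lemma Ex_add m n phi w : Ex (m + n) phi w = Ex m (Ex n phi) w.
Proof. by elim: m w => //= m IH w; rewrite !IH. Qed.

Definition Pr n (A : pred (seq bool)) w := Ex n (fun v => (A v)%:R) w.

Lemma Pr_ge0 n A w : 0 <= Pr n A w.
Proof. by rewrite -(Ex_cst n 0 w); apply: Ex_le => v _; exact: ler0n. Qed.

Lemma Pr_le1 n A w : Pr n A w <= 1.
Proof. by rewrite -(Ex_cst n 1 w); apply: Ex_le => v _; rewrite lern1 leq_b1. Qed.

Lemma Pr_compl n A w : Pr n (predC A) w = 1 - Pr n A w.
Proof.
apply/eqP; rewrite eq_sym subr_eq -(Ex_cst n 1 w) -ExD; apply/eqP.
by apply: Ex_ext => v _ /=; case: (A _) => /=; lra.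
Qed.

Lemma Pr_le n (A A' : pred (seq bool)) w :
  (forall v, size v = n -> A (w ++ v) -> A' (w ++ v)) -> Pr n A w <= Pr n A' w.
Proof.
move=> h; apply: Ex_le => v sv; rewrite ler_nat.
by case: (A _) (h v sv) => // ->.
Qed.

(* [N] gives the times at which the successive events are observed. *)
Lemma Pr_all_bad (N : nat -> nat) (G : nat -> pred (seq bool)) (q : nat -> R)
    (K : nat) :
  {homo N : a b / (a <= b)%N >-> (a <= b)%N} ->
  (forall k w v, (N k.+1 <= size w)%N -> G k (w ++ v) = G k w) ->
  (forall k w, (K <= k)%N -> size w = N k ->
    q k <= Pr (N k.+1 - N k) (G k) w) ->
  (forall k, q k <= 1) ->
  forall m k w, (K <= k)%N -> size w = N k ->
  Pr (N (k + m)%N - N k) (fun v => all (fun j => ~~ G j v) (iota k m)) w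
    <= \prod_(k <= j < k + m) (1 - q j).
Proof.
move=> Nh Gp Gq q1; elim=> [|m IH] k w Kk sw.
  by rewrite addn0 subnn big_geq //= /Pr /=.
have le1 : (N k <= N k.+1)%N by apply: Nh.
have le2 : (N k.+1 <= N (k + m.+1))%N by apply: Nh; rewrite -addn1 leq_add2l.
have -> : (N (k + m.+1) - N k = (N k.+1 - N k) + (N (k + m.+1) - N k.+1))%N.
  by move: (Nh _ _ (leqnSn k)) le2; clear; lia.
rewrite /Pr Ex_add [X in _ <= X]big_ltn ?addnS ?ltnS ?leq_addr // -addSn.
set P := (\prod_(_ <= _ < _) _); have P0 : 0 <= P.
  by apply: prodr_ge0 => i _; rewrite subr_ge0.
(* Conditioning on the first block: whether [G k] holds is decided at time [N k.+1], and if it fails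
   the induction hypothesis bounds the remaining blocks by [P]. *)
apply: (le_trans (y := Ex (N k.+1 - N k) (P \*o (fun v => (~~ G k v)%:R)) w)); last first.
  rewrite ExZ mulrC ler_wpM2r //.
  by rewrite -/(Pr _ (fun v => ~~ G k v) w) (Pr_compl _ (G k)) lerB // Gq.
apply: Ex_le => v sv.
have sz : size (w ++ v) = N k.+1 by rewrite size_cat sw sv subnKC.
rewrite -[leRHS]/(P * (~~ G k (w ++ v))%:R); case Gv : (G k (w ++ v)).
  rewrite /= mulr0 -(Ex_cst (N (k.+1 + m) - N k.+1) 0 (w ++ v)) Ex_le // => u su.
  by rewrite Gp ?sz // Gv /=.
rewrite /= mulr1.
apply: le_trans (IH k.+1 (w ++ v) _ sz); last exact: leqW.
apply: Ex_le => u su; rewrite ler_nat Gp ?sz // Gv /=.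
by [].
Qed.

Section Mart.
Variables (D : seq bool -> R) (B s : R).
Hypothesis D_mart : forall w,
  pb w false * (D (rcons w false) - D w) + pb w true * (D (rcons w true) - D w) = 0.
Hypothesis D_bnd : forall w i, `|D (rcons w i) - D w| <= B.

(** The martingale identity cancels the linear term of [expR_le_quad]; the quadratic term is
    absorbed by [1 + z <= expR z]. *)
Lemma step_mgf_le w (l : R) : `|l| * B <= 1 ->
  pb w false * expR (l * (D (rcons w false) - D w)) +
  pb w true * expR (l * (D (rcons w true) - D w)) <= expR (2 * (B * l) ^+ 2).
Proof.
move=> lB.
have B0 : 0 <= B by apply: le_trans (D_bnd w false).
have key i : expR (l * (D (rcons w i) - D w)) <=
    1 + l * (D (rcons w i) - D w) + 2 * (B * l) ^+ 2.
  have h1 : `|l * (D (rcons w i) - D w)| <= 1.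
    by rewrite normrM (le_trans _ lB) // ler_wpM2l.
  apply: (le_trans (expR_le_quad h1)); rewrite lerD2l ler_wpM2l //.
  rewrite -(real_normK (num_real (l * _))) -(real_normK (num_real (B * l))).
  by rewrite ler_sqr ?nnegrE // !normrM [leRHS]mulrC ler_wpM2l // (ger0_norm B0).
apply: le_trans (expR_ge1Dx _).
have h := D_mart w; have hs := pb_sum w.
have k1 := ler_wpM2l (pb_ge0 w false) (key false).
have k2 := ler_wpM2l (pb_ge0 w true) (key true).
set E := 2 * (B * l) ^+ 2 in k1 k2 *.
apply: le_trans (lerD k1 k2) _.
rewrite le_eqVlt; apply/orP; left; apply/eqP.
set a := D (rcons w false) - D w in h *; set b := D (rcons w true) - D w in h *.
have -> : pb w false * (1 + l * a + E) + pb w true * (1 + l * b + E) =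
  (pb w false + pb w true) * (1 + E) + l * (pb w false * a + pb w true * b) by ring.
by rewrite h hs mulr0 addr0 mul1r.
Qed.

Lemma step_mgf_ge w (l : R) : `|l| * B <= 1 -> 0 <= s -> s <= B ^+ 2 ->
  s <= pb w false * (D (rcons w false) - D w) ^+ 2 +
       pb w true * (D (rcons w true) - D w) ^+ 2 ->
  expR (s * l ^+ 2 / 8) <= pb w false * expR (l * (D (rcons w false) - D w)) +
  pb w true * expR (l * (D (rcons w true) - D w)).
Proof.
move=> lB s0 sB sV.
have B0 : 0 <= B by apply: le_trans (D_bnd w false).
have key i : 1 + l * (D (rcons w i) - D w) + (l * (D (rcons w i) - D w)) ^+ 2 / 4
    <= expR (l * (D (rcons w i) - D w)).
  apply: expR_ge_quad.
  have h1 : `|l * (D (rcons w i) - D w)| <= 1.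
    by rewrite normrM (le_trans _ lB) // ler_wpM2l.
  by move: h1; rewrite ler_norml => /andP[].
(* With [z = s * l ^+ 2 <= 1] one has [expR (z / 8) <= 1 + z / 4]: the loss from 4 to 8 pays for
   returning to an exponential. The assumption [s <= B ^+ 2] serves to get [z <= 1]. *)
have sl : s * l ^+ 2 <= 1.
  rewrite -real_normK ?num_real //.
  have : (`|l| * B) ^+ 2 <= 1 by rewrite exprn_ile1 ?mulr_ge0.
  rewrite exprMn; apply: le_trans; rewrite mulrC ler_wpM2l ?sqr_ge0 //.
have sl0 : 0 <= s * l ^+ 2 by rewrite mulr_ge0 ?sqr_ge0.
have h8 : `|s * l ^+ 2 / 8| <= 1 by rewrite ger0_norm; lra.
apply: (le_trans (expR_le_quad h8)).
apply: (le_trans (y := 1 + s * l ^+ 2 / 4)).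
  by move: sl sl0; set z := s * _ => ? ?; nra.
have h := D_mart w; have hs := pb_sum w.
have k1 := ler_wpM2l (pb_ge0 w false) (key false).
have k2 := ler_wpM2l (pb_ge0 w true) (key true).
apply: le_trans (lerD k1 k2).
have h3 := ler_wpM2l (sqr_ge0 l) sV.
set a := D (rcons w false) - D w in h h3 *.
set b := D (rcons w true) - D w in h h3 *.
have -> : pb w false * (1 + l * a + (l * a) ^+ 2 / 4) +
    pb w true * (1 + l * b + (l * b) ^+ 2 / 4) =
    1 + l ^+ 2 * (pb w false * a ^+ 2 + pb w true * b ^+ 2) / 4.
  transitivity ((pb w false + pb w true) + l * (pb w false * a + pb w true * b) +
    l ^+ 2 * (pb w false * a ^+ 2 + pb w true * b ^+ 2) / 4); first by field.
  by rewrite h hs mulr0 addr0.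
by lra.
Qed.

Lemma mgf_le n w (l : R) : `|l| * B <= 1 ->
  Ex n (fun v => expR (l * D v)) w <= expR (l * D w + 2 * (B * l) ^+ 2 * n%:R).
Proof.
move=> lB; elim: n w => [|n IH] w /=; first by rewrite mulr0 addr0.
have key i : expR (l * D (rcons w i) + 2 * (B * l) ^+ 2 * n%:R) =
    expR (l * D w + 2 * (B * l) ^+ 2 * n%:R) * expR (l * (D (rcons w i) - D w)).
  by rewrite -expRD; congr expR; ring.
have k1 := ler_wpM2l (pb_ge0 w false) (IH (rcons w false)).
have k2 := ler_wpM2l (pb_ge0 w true) (IH (rcons w true)).
apply: (le_trans (lerD k1 k2)); rewrite !key.
have -> : l * D w + 2 * (B * l) ^+ 2 * n.+1%:R =
  (l * D w + 2 * (B * l) ^+ 2 * n%:R) + 2 * (B * l) ^+ 2.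
  by rewrite -natr1; ring.
rewrite [leRHS]expRD (mulrCA (pb w false)) (mulrCA (pb w true)) -mulrDr ler_wpM2l ?expR_ge0 //.
exact: step_mgf_le.
Qed.

Lemma mgf_ge n w (l : R) : `|l| * B <= 1 -> 0 <= s -> s <= B ^+ 2 ->
  (forall w, s <= pb w false * (D (rcons w false) - D w) ^+ 2 +
       pb w true * (D (rcons w true) - D w) ^+ 2) ->
  expR (l * D w + s * l ^+ 2 / 8 * n%:R) <= Ex n (fun v => expR (l * D v)) w.
Proof.
move=> lB s0 sB sV; elim: n w => [|n IH] w /=; first by rewrite mulr0 addr0.
have key i : expR (l * D (rcons w i) + s * l ^+ 2 / 8 * n%:R) =
    expR (l * D w + s * l ^+ 2 / 8 * n%:R) * expR (l * (D (rcons w i) - D w)).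
  by rewrite -expRD; congr expR; ring.
have k1 := ler_wpM2l (pb_ge0 w false) (IH (rcons w false)).
have k2 := ler_wpM2l (pb_ge0 w true) (IH (rcons w true)).
apply: (le_trans _ (lerD k1 k2)); rewrite !key.
have -> : l * D w + s * l ^+ 2 / 8 * n.+1%:R =
  (l * D w + s * l ^+ 2 / 8 * n%:R) + s * l ^+ 2 / 8.
  by rewrite -natr1; ring.
rewrite [leLHS]expRD (mulrCA (pb w false)) (mulrCA (pb w true)) -mulrDr ler_wpM2l ?expR_ge0 //.
exact: step_mgf_ge.
Qed.

(** The index [m] is the length of the conditioning word, so that only prefixes from that time on
    are inspected. *)
Definition reaches (a : R) (m : nat) : pred (seq bool) :=
  fun v => has (fun j => a <= D (take j v)) (iota m (size v - m).+1).

(** Doob's maximal inequality for the exponential supermartingale, by induction on the horizon: once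
    [a] is reached the right-hand side is at least 1, and before that each step is paid for by
    [step_mgf_le]. *)
Lemma max_ineq n w (a l : R) : 0 <= l -> l * B <= 1 ->
  Pr n (reaches a (size w)) w <=
    expR (l * (D w - a) + 2 * (B * l) ^+ 2 * n%:R).
Proof.
move=> l0 lB.
have nB : `|l| * B <= 1 by rewrite ger0_norm.
elim: n w => [|n IH] w.
  rewrite /Pr /= /reaches subnn /= take_size orbF mulr0 addr0.
  case: (lerP a (D w)) => h /=; last exact: expR_ge0.
  by rewrite -[leLHS]expR0 ler_expR mulr_ge0 // subr_ge0.
have [aD|Da] := lerP a (D w).
  apply: (le_trans (Pr_le1 _ _ _)); rewrite -[leLHS]expR0 ler_expR.
  apply: addr_ge0; first by rewrite mulr_ge0 // subr_ge0.
  by rewrite mulr_ge0 // mulr_ge0 // sqr_ge0.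
have -> : Pr n.+1 (reaches a (size w)) w =
    pb w false * Pr n (reaches a (size (rcons w false))) (rcons w false) +
    pb w true * Pr n (reaches a (size (rcons w true))) (rcons w true).
  rewrite /Pr /=; congr (_ * _ + _ * _); apply: Ex_ext => v sv; congr (nat_of_bool _)%:R;
  rewrite /reaches !size_cat !size_rcons addKn addSn -addnS addKn /= cat_rcons;
  by rewrite take_size_cat // leNgt Da.
have key i : expR (l * (D (rcons w i) - a) + 2 * (B * l) ^+ 2 * n%:R) =
    expR (l * (D w - a) + 2 * (B * l) ^+ 2 * n%:R) * expR (l * (D (rcons w i) - D w)).
  by rewrite -expRD; congr expR; ring.
have k1 := ler_wpM2l (pb_ge0 w false) (IH (rcons w false)).
have k2 := ler_wpM2l (pb_ge0 w true) (IH (rcons w true)).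
apply: (le_trans (lerD k1 k2)); rewrite !key.
have -> : l * (D w - a) + 2 * (B * l) ^+ 2 * n.+1%:R =
  (l * (D w - a) + 2 * (B * l) ^+ 2 * n%:R) + 2 * (B * l) ^+ 2.
  by rewrite -natr1; ring.
rewrite [leRHS]expRD (mulrCA (pb w false)) (mulrCA (pb w true)) -mulrDr ler_wpM2l ?expR_ge0 //.
exact: step_mgf_le.
Qed.

(* A second-moment argument under the tilted weight [expR (l * D)], in the form
   [X <= expR x + r * X ^+ 2 / 2 + 1_(X > expR x) / (2 * r)]. *)
Lemma large_dev_ge n w (l : R) : 0 < l -> 2 * l * B <= 1 -> 0 <= s -> s <= B ^+ 2 ->
  (forall w, s <= pb w false * (D (rcons w false) - D w) ^+ 2 +
       pb w true * (D (rcons w true) - D w) ^+ 2) ->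
  16 <= s * l ^+ 2 * n%:R ->
  expR (- (8 * (B * l) ^+ 2 * n%:R)) / 4 <=
    Pr n (fun v => s * l * n%:R / 16 <= D v - D w) w.
Proof.
move=> l0 lB s0 sB sV big.
have B0 : 0 <= B by apply: le_trans (D_bnd w false).
have lB0 : 0 <= l * B by rewrite mulr_ge0 // ltW.
have nB : `|l| * B <= 1 by rewrite gtr0_norm //; lra.
have nB2 : `|2 * l| * B <= 1 by rewrite gtr0_norm //; lra.
set x := s * l * n%:R / 16.
set q := s * l ^+ 2 / 8 * n%:R.
have lx : l * x = q / 2 by rewrite /x /q; field.
have q2 : 2 <= q by rewrite /q; lra.
set K := 8 * (B * l) ^+ 2 * n%:R.
pose X v := expR (l * D v - l * D w).
have EX : expR q <= Ex n X w.
  have := mgf_ge n w nB s0 sB sV.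
  rewrite addrC expRD -ler_pdivlMr ?expR_gt0 // => h; apply: (le_trans h).
  rewrite -expRN mulrC -ExZ; apply: Ex_le => v _ /=.
  by rewrite -expRD /X addrC.
have EX2 : Ex n (fun v => X v ^+ 2) w <= expR K.
  have h := mgf_le n w nB2.
  rewrite -(ler_pM2l (expR_gt0 (- (2 * l * D w)))) -expRD in h.
  have e : - (2 * l * D w) + (2 * l * D w + 2 * (B * (2 * l)) ^+ 2 * n%:R) = K.
    by rewrite /K; ring.
  rewrite e in h; apply: le_trans h; rewrite -ExZ; apply: Ex_le => v _ /=.
  by rewrite /X expr2 -!expRD ler_expR; lra.
set P := Pr _ _ _.
(* This [r] makes the second-moment term at most [expR q / 4]. As [l * x = q / 2] and [2 <= q], the
   constant term is at most [expR q / 2], so a quarter of [expR q] is left for the probability. *)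
pose r := expR (q - K) / 2.
have r0 : 0 < r by rewrite /r divr_gt0 ?expR_gt0.
have main : Ex n X w <= expR (l * x) + r / 2 * Ex n (fun v => X v ^+ 2) w
     + (2 * r)^-1 * P.
  rewrite -[X in X + _ + _](Ex_cst n _ w) -!ExZ -!ExD; apply: Ex_le => v _ /=.
  have X0 : 0 < X (w ++ v) by rewrite /X expR_gt0.
  case: (lerP x (D (w ++ v) - D w)) => h /=.
    rewrite mulr1.
    have -> : (2 * r)^-1 = r^-1 / 2 by field; rewrite gt_eqF.
    have e0 : 0 <= expR (l * x) by rewrite expR_ge0.
    have : 0 <= r * (X (w ++ v) - r^-1) ^+ 2 by rewrite mulr_ge0 ?sqr_ge0 // ltW.
    have -> : r * (X (w ++ v) - r^-1) ^+ 2 = r * X (w ++ v) ^+ 2 - 2 * X (w ++ v) + r^-1.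
      by field; rewrite gt_eqF.
    by lra.
  rewrite mulr0 addr0.
  have : X (w ++ v) <= expR (l * x).
    by rewrite /X ler_expR -mulrBr ler_wpM2l // ltW.
  have : 0 <= r / 2 * X (w ++ v) ^+ 2 by rewrite mulr_ge0 ?sqr_ge0 // divr_ge0 // ltW.
  by lra.
have h1 : expR (l * x) <= expR q / 2.
  rewrite lx ler_pdivlMr // {2}(_ : q = q / 2 + q / 2); last by field.
  rewrite expRD ler_wpM2l ?expR_ge0 //.
  by apply: le_trans (expR_ge1Dx _); lra.
have h2 : r / 2 * Ex n (fun v => X v ^+ 2) w <= expR q / 4.
  apply: (le_trans (ler_wpM2l _ EX2)); first by rewrite divr_ge0 // ltW.
  rewrite /r expRD expRN; have := expR_gt0 K; set e := expR K => e0.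
  by rewrite le_eqVlt; apply/orP; left; apply/eqP; field; rewrite gt_eqF.
have h3 : expR q / 4 <= (2 * r)^-1 * P by lra.
rewrite [leRHS]mulrC ler_pdivlMr ?mulr_gt0 ?expR_gt0 // in h3.
apply: le_trans h3.
have -> : expR q / 4 * (2 * r) = expR (q + q - K) / 4.
  by rewrite /r -addrA (expRD q (q - K)); field.
rewrite ler_pM2r ?invr_gt0 // ler_expR; lra.
Qed.

End Mart.
End Tree.

(** * Binary digits *)

Section Digits.
Context {R : realType}.

(* Right-closed dyadic cells, so that a distribution function gives their mass
   without any continuity argument. *)
Definition digit (x : R) : bool := 2^-1 < x.
Definition shift (x : R) : R := if digit x then 2 * x - 1 else 2 * x.

Fixpoint word (n : nat) (x : R) : seq bool :=
  if n is n'.+1 then digit x :: word n' (shift x) else [::].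

Lemma size_word n x : size (word n x) = n.
Proof. by elim: n x => //= n IH x; rewrite IH. Qed.

Lemma word_add m n x : word (m + n) x = word m x ++ word n (iter m shift x).
Proof. by elim: m x => //= m IH x; rewrite IH -iterS iterSr. Qed.

Lemma wordS n x : word n.+1 x = rcons (word n x) (digit (iter n shift x)).
Proof. by rewrite -addn1 word_add cats1. Qed.

Lemma take_word m n x : (m <= n)%N -> take m (word n x) = word m x.
Proof.
by move=> mn; rewrite -(subnKC mn) word_add take_size_cat // size_word.
Qed.

Lemma shift_itv (x : R) : 0 < x <= 1 -> 0 < shift x <= 1.
Proof.
by rewrite /shift /digit => /andP[x0 x1]; case: (ltP 2^-1 x) => h; apply/andP; split; lra.
Qed.

Lemma iter_shift_itv n (x : R) : 0 < x <= 1 -> 0 < iter n shift x <= 1.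
Proof. by move=> h; elim: n => //= n; exact: shift_itv. Qed.

Lemma half_exp_le1 l : 2^-1 ^+ l <= 1 :> R.
Proof. by rewrite exprn_ile1 //; lra. Qed.

(** Such an [x] is not in the last cell of length [l]. Together with [word_not_false] this keeps a
    displacement of size at most [2^-1 ^+ l] inside [[0, 1]]. *)
Lemma word_not_true l (x : R) : 0 < x <= 1 -> ~~ all (pred1 true) (word l x) ->
  x + 2^-1 ^+ l <= 1.
Proof.
elim: l x => //= l IH x x01; have := shift_itv x01; rewrite /shift /digit exprS.
have l1 := half_exp_le1 l.
case: (ltP 2^-1 x) => h s01 /=; last by move=> _; lra.
by move=> /(IH _ s01); lra.
Qed.

Lemma word_not_false l (x : R) : 0 < x <= 1 -> ~~ all (pred1 false) (word l x) ->
  2^-1 ^+ l <= x.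
Proof.
elim: l x => //= l IH x x01; have := shift_itv x01; rewrite /shift /digit exprS.
have l1 := half_exp_le1 l.
case: (ltP 2^-1 x) => h s01 /=; first by move=> _; lra.
by move=> /(IH _ s01); lra.
Qed.

Lemma measurable_word n (P : pred (seq bool)) :
  measurable [set x : measurableTypeR R | P (word n x)].
Proof.
have mgt : measurable [set x : measurableTypeR R | digit x].
  rewrite (_ : [set x | _] = `]2^-1, +oo[%classic); first exact: measurable_itv.
  by apply/seteqP; split => x /=; rewrite in_itv /= andbT.
elim: n P => [|n IH] P /=.
  rewrite (_ : [set x | _] = if P [::] then setT else set0).
    by case: ifP => _; [exact: measurableT|exact: measurable0].
  by apply/seteqP; split => x /=; case: (P [::]).
have mS : measurable_fun setT (shift : measurableTypeR R -> measurableTypeR R).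
  apply: measurable_fun_ifT.
  - apply: (measurable_fun_bool true); rewrite setTI.
    by rewrite (_ : _ @^-1` _ = [set x | digit x]).
  - apply: measurable_funB => //.
    by apply: measurable_funM.
rewrite (_ : [set x | _] =
  ([set x | digit x] `&` (shift @^-1` [set x | P (true :: word n x)])) `|`
  (~` [set x | digit x] `&` (shift @^-1` [set x | P (false :: word n x)]))).
  have mP b : measurable (shift @^-1` [set x | P (b :: word n x)] : set (measurableTypeR R)).
    by rewrite -[X in measurable X]setTI; apply: mS => //; exact: (IH (fun v => P (b :: v))).
  by apply: measurableU; apply: measurableI => //; try exact: mP; exact: measurableC.
apply/seteqP; split => x /=; first by case: (digit x) => Px; [left|right].
by case => -[] /=; case: (digit x).
Qed.

Definition event n (P : pred (seq bool)) : set (measurableTypeR R) :=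
  [set x : R | 0 < x <= 1 /\ P (word n x)].

Lemma measurable_event n (P : pred (seq bool)) : measurable (event n P).
Proof.
rewrite (_ : event n P = `]0, 1]%classic `&` [set x | P (word n x)]).
  by apply: measurableI; [exact: measurable_itv|exact: measurable_word].
by apply/seteqP; split => x /=; rewrite in_itv /=.
Qed.

End Digits.

(** * Borel-Cantelli lemmas, transferred from the digit tree to the measure *)

Section Link.
Context {R : realType}.
Variable mu : probability (measurableTypeR R) R.
Variable (pb : seq bool -> bool -> R) (q : seq bool -> R).
Hypothesis pb_ge0 : forall w i, 0 <= pb w i.
Hypothesis pb_sum : forall w, pb w false + pb w true = 1.
Hypothesis q0 : q [::] = 1.
Hypothesis qS : forall w i, q (rcons w i) = q w * pb w i.
Hypothesis mu_cell : forall w,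
  mu [set x : R | 0 < x <= 1 /\ word (size w) x = w] = (q w)%:E.
Hypothesis mu_out : mu [set x : R | ~~ (0 < x <= 1)] = 0%E.

Lemma mu_word n (P : pred (seq bool)) :
  (mu (event n P) <= (Pr pb n P [::])%:E)%E.
Proof.
pose ev m w : set (measurableTypeR R) := event (size w + m) (fun v => (take (size w) v == w) && P v).
(* Induction on [n] needs the statement localized to the cell of [w]. Subadditivity over its two
   subcells is enough, as null sets and Borel-Cantelli only ask for upper bounds. *)
suff H w : (mu (ev n w) <= (q w * Pr pb n P w)%:E)%E.
  have := H [::]; rewrite q0 mul1r /=; apply: le_trans.
  rewrite le_eqVlt; apply/orP; left; apply/eqP; congr (mu _).
  by apply/seteqP; split => x; rewrite /ev /event /= take0 eqxx.
elim: n w => [|n IH] w.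
  rewrite /ev addn0 /Pr /=; case Pw: (P w); last first.
    rewrite mulr0 (_ : event _ _ = set0) ?measure0 //.
    apply/seteqP; split => x //= -[_ /andP[/eqP]].
    by rewrite take_oversize ?size_word // => ->; rewrite Pw.
  rewrite mulr1 -mu_cell; apply: le_measure; rewrite ?inE.
  - exact: measurable_event.
  - rewrite (_ : [set x | _] = event (size w) (pred1 w)); first exact: measurable_event.
    by apply/seteqP; split => x /= -[x01 /eqP].
  - by move=> x /= [-> /andP[/eqP]]; rewrite take_oversize ?size_word.
apply: (le_trans (y := (mu (ev n (rcons w false)) + mu (ev n (rcons w true)))%E)); last first.
  by apply: (le_trans (leeD (IH _) (IH _))); rewrite -EFinD lee_fin !qS /Pr /=; lra.
apply: le_trans (measureU2 _ _ _); try exact: measurable_event.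
apply: le_measure; rewrite ?inE; first exact: measurable_event.
  by apply: measurableU; exact: measurable_event.
move=> x /= [x01 /andP[]]; rewrite take_word ?leq_addr // => /eqP wx Px.
case dx : (digit (iter (size w) shift x)); [right|left]; split => //;
  rewrite !size_rcons addSn -addnS take_word ?addnS ?ltnS ?leq_addr //;
  by rewrite wordS wx dx eqxx -addnS.
Qed.

Lemma ae_imp (P Q : R -> Prop) : (forall x, P x -> Q x) ->
  {ae mu, forall x : R, P x} -> {ae mu, forall x : R, Q x}.
Proof. by move=> PQ; apply: negligibleS; apply: subsetC => x; exact: PQ. Qed.

Lemma ae_and (P Q : R -> Prop) :
  {ae mu, forall x : R, P x} -> {ae mu, forall x : R, Q x} ->
  {ae mu, forall x : R, P x /\ Q x}.
Proof. by move=> hP hQ; apply: negligibleS (negligibleU hP hQ); rewrite -setCI. Qed.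

(** The set [A] may fail to be measurable; it is enclosed in the intersection of the events obtained
    for [e = 1 / k.+1]. *)
Lemma ae_of_null (A : set R) :
  (forall e : R, 0 < e -> exists n (P : pred (seq bool)),
    A `<=` event n P /\ Pr pb n P [::] <= e) ->
  mu.-negligible A.
Proof.
move=> h.
have /choice[f hf] : forall k : nat, exists p : nat * pred (seq bool),
    A `<=` event p.1 p.2 /\ Pr pb p.1 p.2 [::] <= (k.+1%:R)^-1.
  move=> k; have k0 : 0 < (k.+1%:R)^-1 :> R by rewrite invr_gt0.
  by have [n [P nP]] := h _ k0; exists (n, P).
pose n_ k := (f k).1; pose P_ k := (f k).2.
have hP k : A `<=` event (n_ k) (P_ k) /\ Pr pb (n_ k) (P_ k) [::] <= (k.+1%:R)^-1.
  exact: hf.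
exists (\bigcap_k event (n_ k) (P_ k)); split.
- by apply: bigcap_measurable => // k _; exact: measurable_event.
- apply/eqP; rewrite eq_le measure_ge0 andbT; apply/lee_addgt0Pr => e e0.
  rewrite add0e.
  have [k ke] : exists k, (k.+1%:R)^-1 < e.
    exists (Num.truncn e^-1); rewrite invf_plt ?posrE //.
    by have := truncnS_gt e^-1.
  apply: (le_trans (y := mu (event (n_ k) (P_ k)))).
    apply: le_measure; rewrite ?inE; last exact: bigcap_inf.
    - by apply: bigcap_measurable => // j _; exact: measurable_event.
    - exact: measurable_event.
  apply: (le_trans (mu_word _ _)); rewrite lee_fin.
  by apply: le_trans (ltW ke); case: (hP k).
- by move=> x Ax k _; case: (hP k) => /(_ x Ax).
Qed.

Lemma ae_in01 : {ae mu, forall x : R, 0 < x <= 1}.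
Proof.
apply/negligibleP; last by rewrite -mu_out; congr (mu _); apply/seteqP; split => x /= /negP.
rewrite (_ : ~` _ = ~` `]0, 1]%classic); first by apply: measurableC; exact: measurable_itv.
by apply/seteqP; split => x /=; rewrite in_itv /=.
Qed.

Lemma borel_cantelli_word (n_ : nat -> nat) (P_ : nat -> pred (seq bool)) (K : nat) :
  (forall k, (K <= k)%N -> Pr pb (n_ k) (P_ k) [::] <= (k.+1%:R ^+ 2)^-1) ->
  {ae mu, forall x : R, 0 < x <= 1 -> exists K', forall k, (K' <= k)%N ->
     ~~ P_ k (word (n_ k) x)}.
Proof.
move=> hP.
pose A := ~` [set x : R | 0 < x <= 1 -> exists K', forall k, (K' <= k)%N ->
     ~~ P_ k (word (n_ k) x)].
pose F k := (event (n_ (k + K)%N) (P_ (k + K)%N) : set (measurableTypeR R)).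
exists (lim_sup_set (F : (set (measurableTypeR R))^nat)); split.
- apply: bigcap_measurable => // k _; apply: bigcup_measurable => j _; exact: measurable_event.
- apply: lim_sup_set_cvg0; first by move=> k; exact: measurable_event.
  apply: (@le_lt_trans _ _ 2%:E); last exact: ltry.
  apply: lime_le; first by apply: is_cvg_nneseries => *; exact: measure_ge0.
  apply: nearW => n.
  (* Inverse squares are dominated by the telescoping terms [2 / k.+1 - 2 / k.+2], so every partial
     sum is at most 2. *)
  apply: (@le_trans _ _ (\sum_(0 <= k < n) (2 / k.+1%:R - 2 / k.+2%:R)%:E)%E).
    apply: lee_sum => k _; apply: (le_trans (mu_word _ _)); rewrite lee_fin.
    apply: (le_trans (hP _ (leq_addl _ _))).
    have -> : 2 / k.+1%:R - 2 / k.+2%:R = (k.+1%:R * k.+2%:R / 2)^-1 :> R.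
      have key (a : R) : a != 0 -> a + 1 != 0 -> 2 / a - 2 / (a + 1) = (a * (a + 1) / 2)^-1.
        by move=> k0 k1; field; rewrite k0 k1.
      by rewrite -(natr1 k.+1) key // ?natr1 pnatr_eq0.
    rewrite lef_pV2 ?posrE ?divr_gt0 ?mulr_gt0 ?exprn_gt0 //.
    have h1 : k.+1%:R <= (k + K).+1%:R :> R by rewrite ler_nat ltnS leq_addr.
    have h2 : 1 <= k.+1%:R :> R by rewrite ler1n.
    rewrite -(natr1 k.+1); set a := k.+1%:R in h1 h2 *; set b := (k + K).+1%:R in h1 *.
    by nra.
  rewrite sumEFin lee_fin (telescope_sumr_eq (fun k => - (2 / k.+1%:R))) //.
    by rewrite opprK divr1 addrC lerBlDr lerDl divr_ge0.
  by move=> k _; rewrite opprK addrC.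
- move=> x /= /not_implyP[x01 nx] k _.
  apply: contrapT => nb; apply: nx; exists (k + K)%N => j kj.
  apply/negP => Pj; apply: nb; exists (j - K)%N => /=.
    by rewrite leq_subRL; [rewrite addnC|apply: leq_trans kj; exact: leq_addl].
  by rewrite /F subnK //; apply: leq_trans kj; exact: leq_addl.
Qed.

(** A conditional second Borel-Cantelli lemma. The probability of failing at all of the times from
    [K2] to [K2 + m] is at most the product of the [1 - 1 / k.+1], which telescopes to
    [K2 / (K2 + m)]; [m] is chosen to make this at most [e]. *)
Lemma infinitely_often_word (N : nat -> nat) (G : nat -> pred (seq bool)) (K : nat) :
  {homo N : a b / (a <= b)%N >-> (a <= b)%N} ->
  (forall k w v, (N k.+1 <= size w)%N -> G k (w ++ v) = G k w) ->
  (forall k w, (K <= k)%N -> size w = N k ->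
    (k.+1%:R)^-1 <= Pr pb (N k.+1 - N k) (G k) w) ->
  {ae mu, forall x : R, 0 < x <= 1 -> forall K', exists2 k, (K' <= k)%N &
     G k (word (N k.+1) x)}.
Proof.
move=> Nh Gp Gq.
have H K' : mu.-negligible [set x : R | 0 < x <= 1 /\
    forall k, (K' <= k)%N -> ~~ G k (word (N k.+1) x)].
  apply: ae_of_null => e e0.
  pose K2 := (K + K').+1.
  pose m := Num.truncn (K2%:R / e).
  exists (N (K2 + m)%N), (fun v => all (fun j => ~~ G j v) (iota K2 m)); split.
    move=> x /= [x01 nG]; split => //; apply/allP => j; rewrite mem_iota => /andP[j1 j2].
    have -> : word (N (K2 + m)%N) x = word (N j.+1) x ++
        word (N (K2 + m)%N - N j.+1) (iter (N j.+1) shift x).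
      by rewrite -word_add subnKC // Nh.
    rewrite Gp ?size_word //; apply: nG; apply: leq_trans j1.
    by rewrite /K2; lia.
  have le1 : (N K2 <= N (K2 + m))%N by rewrite Nh // leq_addr.
  rewrite -(subnKC le1) /Pr Ex_add.
  apply: (@le_trans _ _ (Ex pb (N K2) (fun=> K2%:R / (K2 + m)%:R) [::])).
    apply: Ex_le => // w sw.
    have Kq k w' : (K2 <= k)%N -> size w' = N k ->
      (k.+1%:R)^-1 <= Pr pb (N k.+1 - N k) (G k) w'.
      by move=> Kk; apply: Gq; apply: leq_trans Kk; rewrite /K2; lia.
    have q1 k : (k.+1%:R)^-1 <= 1 :> R by rewrite invf_le1 // ler1n.
    have := Pr_all_bad pb_ge0 pb_sum (q := fun k => (k.+1%:R)^-1) Nh Gp Kq q1 m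
      (leqnn _) sw.
    move/le_trans; apply.
    have [->|m0] := eqVneq m 0%N.
      by rewrite addn0 big_geq // divff // pnatr_eq0.
    rewrite (telescope_prodr_eq (fun k => k%:R)) //.
    - by rewrite -ltn_psubLR ?subnn // lt0n.
    - by move=> k /andP[]; case: k => // k _ _; rewrite unitfE pnatr_eq0.
    - move=> k _; rewrite -[X in X - _](@divff _ k.+1%:R) ?pnatr_eq0 //.
      by rewrite -natr1; field; rewrite natr1 pnatr_eq0.
  rewrite Ex_cst // ler_pdivrMr // mulrC -ler_pdivrMr //.
  have := truncnS_gt (K2%:R / e); rewrite -/m => h; apply: (le_trans (ltW h)).
  by rewrite ler_nat /K2; lia.
have /negligibleS : mu.-negligible (\bigcup_K' [set x : R | 0 < x <= 1 /\
    forall k, (K' <= k)%N -> ~~ G k (word (N k.+1) x)]) by exact: negligible_bigcup.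
apply => x /= /not_implyP[x01 /existsNP[K' hK]]; exists K' => //=; split => // k kK.
by apply/negP => Gk; apply: hK; exists k.
Qed.

End Link.
Lemma leq_sqr_exp2 k : (4 <= k)%N -> (k ^ 2 <= 2 ^ k)%N.
Proof.
elim: k => // k IH; rewrite leq_eqVlt => /predU1P[<-//|].
rewrite ltnS => k4; have := IH k4; rewrite [(2 ^ k.+1)%N]expnS => h.
by nia.
Qed.

(** * The law of the iterated logarithm *)

Section LogLog.
Context {R : realType}.

Lemma ln2_ge : 2^-1 <= ln 2 :> R.
Proof.
rewrite -[leLHS]expRK ler_ln ?posrE ?expR_gt0 //.
apply: (le_trans (expR_le_quad _)); first by rewrite ger0_norm; lra.
by rewrite expr2; lra.
Qed.

Lemma ln2_le : ln 2 <= 1 :> R.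
Proof. by apply: (@le_ln1Dx R 1); lra. Qed.

Lemma ln_nat_ge0 n : 0 <= ln (n.+1%:R) :> R.
Proof. by rewrite ln_ge0 // ler1n. Qed.

Lemma ln_natS_le n : ln (n.+1%:R) <= n%:R :> R.
Proof. by rewrite -natr1 addrC le_ln1Dx // (lt_le_trans (ltrN10 _)). Qed.

Lemma ln_exp2 n : ln ((2 ^ n)%N%:R) = n%:R * ln 2 :> R.
Proof. by rewrite natrX lnXn // mulr_natl. Qed.

Lemma ln_unbounded (M : R) : exists K, forall k, (K <= k)%N -> M <= ln k.+1%:R.
Proof.
exists (Num.truncn (expR M)) => k Kk.
rewrite -[leLHS]expRK ler_ln ?posrE ?expR_gt0 //.
by apply: (le_trans (ltW (truncnS_gt (expR M)))); rewrite ler_nat.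
Qed.

(** The value of [lil_scale] at [h = 2^-1 ^+ n]; see [lil_scale_exp]. *)
Definition psi (n : nat) : R := Num.sqrt (n%:R * ln (ln n%:R)).

End LogLog.

Section LIL.
Context {R : realType}.
Variable mu : probability (measurableTypeR R) R.
Variable (pb : seq bool -> bool -> R) (q : seq bool -> R).
Hypothesis pb_ge0 : forall w i, 0 <= pb w i.
Hypothesis pb_sum : forall w, pb w false + pb w true = 1.
Hypothesis q0 : q [::] = 1.
Hypothesis qS : forall w i, q (rcons w i) = q w * pb w i.
Hypothesis mu_cell : forall w,
  mu [set x : R | 0 < x <= 1 /\ word (size w) x = w] = (q w)%:E.
Variables (B s : R).
Hypotheses (B0 : 0 < B) (s0 : 0 < s) (sB : s <= B ^+ 2).

Section OneSided.
Variable D : seq bool -> R.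
Hypothesis D0 : D [::] = 0.
Hypothesis D_mart : forall w,
  pb w false * (D (rcons w false) - D w) + pb w true * (D (rcons w true) - D w) = 0.
Hypothesis D_bnd : forall w i, `|D (rcons w i) - D w| <= B.
Hypothesis D_var : forall w, s <= pb w false * (D (rcons w false) - D w) ^+ 2 +
       pb w true * (D (rcons w true) - D w) ^+ 2.

(** The maximal inequality up to time [2 ^ k] with [l = sqrt (ln k.+1 / 2 ^ k)]. The constant
    [2 * B ^+ 2 + 2] makes the exponent exactly [- 2 * ln k.+1], hence a summable bound. Taking [k]
    above 4 and [B ^+ 2] ensures [l * B <= 1], through [k ^ 2 <= 2 ^ k]. *)
Lemma upper_blocks :
  {ae mu, forall x : R, 0 < x <= 1 -> exists K, forall k n, (K <= k)%N -> (n <= 2 ^ k)%N ->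
    D (word n x) <= (2 * B ^+ 2 + 2) * Num.sqrt ((2 ^ k)%N%:R * ln (k.+1%:R))}.
Proof.
pose a k := (2 * B ^+ 2 + 2) * Num.sqrt ((2 ^ k)%N%:R * ln (k.+1%:R)) : R.
apply: ae_imp (borel_cantelli_word q0 qS mu_cell
  (n_ := fun k => (2 ^ k)%N) (P_ := fun k => reaches D (a k) 0)
  (K := maxn 4 (Num.truncn (B ^+ 2)).+1) _); last first.
  move=> k; rewrite geq_max => /andP[k4 kB].
  set N : R := (2 ^ k)%N%:R; set L : R := ln k.+1%:R.
  have N0 : 0 < N by rewrite ltr0n expn_gt0.
  have L0 : 0 <= L by exact: ln_nat_ge0.
  pose l := Num.sqrt (L / N).
  have l0 : 0 <= l by exact: sqrtr_ge0.
  have l2 : l ^+ 2 = L / N by rewrite sqr_sqrtr // divr_ge0 // ltW.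
  have lB : l * B <= 1.
    rewrite -(@ler_pXn2r _ 2) ?nnegrE ?mulr_ge0 // ?(ltW B0) // expr1n exprMn l2.
    rewrite mulrAC ler_pdivrMr // mul1r.
    have h1 : L <= k%:R by exact: ln_natS_le.
    have h2 : B ^+ 2 <= k%:R.
      by apply: (le_trans (ltW (truncnS_gt _))); rewrite ler_nat.
    have h3 : (k ^ 2)%N%:R <= N by rewrite ler_nat; exact: leq_sqr_exp2.
    apply: le_trans h3; rewrite natrX expr2 ler_pM // ?sqr_ge0 //.
  have h := max_ineq pb_ge0 pb_sum D_mart D_bnd (2 ^ k)%N [::] (a k) l0 lB.
  apply: (le_trans h) => {h}.
  rewrite D0 sub0r exprMn l2 -/N.
  have la : l * a k = (2 * B ^+ 2 + 2) * L.
    rewrite /a -/N -/L mulrCA -sqrtrM ?divr_ge0 ?(ltW N0) //.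
    have -> : L / N * (N * L) = L ^+ 2 by field; rewrite gt_eqF.
    by rewrite sqrtr_sqr ger0_norm.
  have -> : l * - a k + 2 * (B ^+ 2 * (L / N)) * N = - (2 * L).
    by rewrite mulrN la; field; rewrite gt_eqF.
  rewrite expRN lef_pV2 ?posrE ?expR_gt0 ?exprn_gt0 //.
  by rewrite expRM_natl lnK // posrE.
move=> x H x01; have [K HK] := H x01; exists K => k n Kk nk.
have := HK k Kk; rewrite /reaches size_word subn0 => /hasPn/(_ n).
rewrite mem_iota /= add0n ltnS nk take_word // -ltNge => /(_ isT) /ltW.
exact.
Qed.

(** With [l = sqrt (L / n) / (4 * B)] the exponent in [large_dev_ge] is [L / 2], so the probability
    is at least [1 / (4 * sqrt k.+1)]; this exceeds [1 / k.+1] for [16 <= k]. The threshold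
    [s * l * n / 16] becomes the stated multiple of [sqrt (n * L)]. *)
Lemma lower_blocks : exists K, forall k n w, (K <= k)%N -> (2 ^ k <= n)%N ->
  (k.+1%:R)^-1 <= Pr pb n (fun v => s / (64 * B) * Num.sqrt (n%:R * ln (k.+1%:R)) <= D v - D w) w.
Proof.
have [K HK] := ln_unbounded ((16 * B) ^+ 2 / s).
exists (maxn 16 K) => k n w; rewrite geq_max => /andP[k16 Kk] kn.
set L : R := ln k.+1%:R; set N : R := n%:R.
have N0 : 0 < N by rewrite ltr0n (leq_trans _ kn) // expn_gt0.
have L0 : 0 <= L by exact: ln_nat_ge0.
have LK : (16 * B) ^+ 2 / s <= L by exact: HK.
have B2 : 0 < B ^+ 2 by rewrite exprn_gt0.
have Lgt : 0 < L by apply: lt_le_trans LK; rewrite divr_gt0 // exprn_gt0 // mulr_gt0.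
pose l : R := Num.sqrt (L / N) / (4 * B).
have l0 : 0 < l by rewrite divr_gt0 ?mulr_gt0 // sqrtr_gt0 divr_gt0.
have l2 : l ^+ 2 = L / N / (16 * B ^+ 2).
  rewrite expr_div_n sqr_sqrtr ?divr_ge0 // ?ltW // exprMn.
  by congr (_ / (_ * _)); rewrite -natrX.
have Bl2 : (B * l) ^+ 2 = L / N / 16.
  by rewrite exprMn l2; field; rewrite !gt_eqF.
have c1 : 2 * l * B <= 1.
  have lB0 : 0 <= 2 * l * B by rewrite mulr_ge0 ?(ltW B0) // mulr_ge0 // ltW.
  rewrite -(@ler_pXn2r _ 2) ?nnegrE //.
  rewrite -mulrA exprMn [l * B]mulrC Bl2 expr1n.
  have : L / N <= 1.
    rewrite ler_pdivrMr // mul1r (le_trans (ln_natS_le _)) // ler_nat.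
    by apply: leq_trans kn; rewrite ltnW // ltn_expl.
  by rewrite expr2; lra.
have c2 : 16 <= s * l ^+ 2 * n%:R.
  rewrite l2 -/N.
  have -> : s * (L / N / (16 * B ^+ 2)) * N = s * L / (16 * B ^+ 2).
    by field; rewrite !gt_eqF.
  rewrite ler_pdivlMr ?mulr_gt0 //.
  by move: LK; rewrite ler_pdivrMr // exprMn [16 ^+ 2]expr2 => LK; lra.
have := large_dev_ge pb_ge0 pb_sum D_mart D_bnd w l0 c1 (ltW s0) sB D_var c2.
have -> : s * l * n%:R / 16 = s / (64 * B) * Num.sqrt (N * L).
  have -> : Num.sqrt (N * L) = N * Num.sqrt (L / N).
    rewrite -{2}[N](ger0_norm (ltW N0)) -sqrtr_sqr -sqrtrM ?sqr_ge0 //.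
    by congr Num.sqrt; field; rewrite gt_eqF.
  by rewrite /l -/N; field; rewrite gt_eqF.
apply: le_trans.
have -> : 8 * (B * l) ^+ 2 * n%:R = 2^-1 * L.
  by rewrite Bl2 -/N; field; rewrite gt_eqF.
set e := expR _.
have e2 : e * e = (k.+1%:R)^-1.
  have -> : (k.+1%:R)^-1 = expR (- L) by rewrite expRN lnK ?posrE.
  by rewrite /e -expRD; congr expR; field.
have e0 : 0 < e by exact: expR_gt0.
have k4 : (k.+1%:R)^-1 <= 4^-1 ^+ 2 :> R.
  by rewrite exprVn lef_pV2 ?posrE ?exprn_gt0 // -natrX ler_nat ltnW.
have e4 : e <= 4^-1.
  by rewrite -(@ler_pXn2r _ 2) ?nnegrE ?(ltW e0) // expr2 e2.
by rewrite -e2 ler_pdivlMr //; nra.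
Qed.

End OneSided.

Section TwoSided.
Variable D : seq bool -> R.
Hypothesis D0 : D [::] = 0.
Hypothesis D_mart : forall w,
  pb w false * (D (rcons w false) - D w) + pb w true * (D (rcons w true) - D w) = 0.
Hypothesis D_bnd : forall w i, `|D (rcons w i) - D w| <= B.
Hypothesis D_var : forall w, s <= pb w false * (D (rcons w false) - D w) ^+ 2 +
       pb w true * (D (rcons w true) - D w) ^+ 2.

Let Cu : R := 2 * B ^+ 2 + 2.

Let Cu0 : 0 < Cu.
Proof. by rewrite /Cu ltr_wpDl // mulr_ge0 // sqr_ge0. Qed.

Lemma abs_blocks :
  {ae mu, forall x : R, 0 < x <= 1 -> exists K, forall k n, (K <= k)%N -> (n <= 2 ^ k)%N ->
    `|D (word n x)| <= Cu * Num.sqrt ((2 ^ k)%N%:R * ln (k.+1%:R))}.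
Proof.
have U := upper_blocks D0 D_mart D_bnd.
have V : {ae mu, forall x : R, 0 < x <= 1 -> exists K, forall k n, (K <= k)%N -> (n <= 2 ^ k)%N ->
    - D (word n x) <= Cu * Num.sqrt ((2 ^ k)%N%:R * ln (k.+1%:R))}.
  apply: (@upper_blocks (fun w => - D w)).
  - by rewrite D0 oppr0.
  - by move=> w; rewrite -[RHS]oppr0 -(D_mart w); ring.
  - by move=> w i; rewrite -opprD normrN.
apply: ae_imp (ae_and U V) => x [Ux Vx] x01.
have [K1 h1] := Ux x01; have [K2 h2] := Vx x01.
exists (maxn K1 K2) => k n; rewrite geq_max => /andP[k1 k2] nk.
by rewrite ler_norml lerNl h1 // h2.
Qed.

(** For [2 ^ k.-1 <= n < 2 ^ k] both [2 ^ k <= 2 * n] and [ln k.+1 <= 2 * ln (ln n)] hold, the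
    latter from [k.+1 <= ln n ^+ 2]. The two factors 2 under the root give the extra factor 2. *)
Lemma lil_upper :
  {ae mu, forall x : R, 0 < x <= 1 -> exists n0, forall n, (n0 <= n)%N ->
    `|D (word n x)| <= 2 * Cu * psi n}.
Proof.
apply: ae_imp abs_blocks => x H x01; have [K HK] := H x01.
exists (2 ^ (maxn K 7))%N => n nK.
have n0 : (0 < n)%N by apply: leq_trans nK; rewrite expn_gt0.
pose k := (trunc_log 2 n).+1.
have /andP[kn nk] : (2 ^ k.-1 <= n < 2 ^ k)%N by exact: trunc_log_bounds.
clearbody k.
have kK : (maxn K 7 < k)%N.
  by rewrite -(ltn_exp2l (m := 2)) // (leq_ltn_trans nK).
move: kK; rewrite gtn_max => /andP[kK k7].
apply: (le_trans (HK k n (ltnW kK) (ltnW nk))).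
rewrite (mulrC 2) -mulrA ler_pM2l // /psi.
rewrite -(ger0_norm (x := 2)) // -sqrtr_sqr -sqrtrM ?sqr_ge0 //.
apply: ler_wsqrtr.
have h1 : (2 ^ k)%N%:R <= 2 * n%:R :> R.
  rewrite -natrM ler_nat -(prednK (n := k)) ?expnS ?leq_mul2l //.
  exact: leq_trans k7.
have h2 : k.-1%:R / 2 <= ln n%:R :> R.
  apply: (@le_trans _ _ (ln (2 ^ k.-1)%N%:R)).
    by rewrite ln_exp2 ler_wpM2l // ln2_ge.
  by rewrite ler_ln ?posrE ?ltr0n ?expn_gt0 // ler_nat.
have h3 : ln k.+1%:R <= 2 * ln (ln n%:R) :> R.
  rewrite mulr_natl -lnXn; last by apply: lt_le_trans h2; rewrite divr_gt0 // ltr0n; move: k7; clear; lia.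
  have l0 : 0 <= ln n%:R :> R by apply: le_trans h2; rewrite divr_ge0.
  have h4 : k.+1%:R <= ln n%:R ^+ 2 :> R.
    apply: (@le_trans _ _ ((k.-1%:R / 2) ^+ 2)).
      move: k7; clear; case: k => // k' /=; rewrite ltnS => k'7.
      rewrite expr_div_n ler_pdivlMr ?exprn_gt0 // -!natrX -natrM ler_nat.
      by nia.
    by rewrite ler_sqr ?nnegrE // divr_ge0.
  rewrite ler_ln ?posrE //.
  by apply: lt_le_trans h4.
have h5 := ln_nat_ge0 k (R := R).
have -> : 2 ^+ 2 * (n%:R * ln (ln n%:R)) = (2 * n%:R) * (2 * ln (ln n%:R)) :> R by ring.
by rewrite ler_pM.
Qed.

Lemma lil_lower : exists c : R, 0 < c /\
  {ae mu, forall x : R, 0 < x <= 1 -> forall n0, exists2 n, (n0 <= n)%N &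
    c * psi n <= D (word n x)}.
Proof.
have [K HK] := lower_blocks D_mart D_bnd D_var.
set c1 := s / (64 * B) in HK.
have c10 : 0 < c1 by rewrite divr_gt0 // mulr_gt0.
(* Blocks grow by the ratio [2 ^ a], with [a = b.+1], so that a block is at least [M] times as long
   as its whole past. A good increment is then at least [(2 * Cu + 1) * X], while [abs_blocks] lets
   the past cancel at most [2 * Cu * X] of it. *)
pose M := ((2 * Cu + 1) / c1) ^+ 2.
pose b := Num.truncn M.
have bM : M <= (2 ^ b)%N%:R.
  apply: (le_trans (ltW (truncnS_gt M))); rewrite -/b ler_nat; exact: ltn_expl.
pose a := b.+1.
pose N k := (2 ^ (a * k))%N.
pose n_ k := (N k.+1 - N k)%N.
have Nh : {homo N : i j / (i <= j)%N >-> (i <= j)%N}.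
  by move=> i j ij; rewrite /N leq_exp2l // leq_mul2l ij orbT.
have Nn k : (N k * 2 ^ b <= n_ k)%N.
  rewrite /n_ /N mulnS expnD /a expnS.
  have : (0 < 2 ^ b)%N by rewrite expn_gt0.
  by move: (2 ^ b)%N (2 ^ _)%N => u v; nia.
have n2 k : (2 ^ k <= n_ k)%N.
  apply: leq_trans (Nn k); rewrite -[leqLHS]muln1; apply: leq_mul; last by rewrite expn_gt0.
  by rewrite leq_exp2l // leq_pmull.
pose G k : pred (seq bool) := fun v => c1 * Num.sqrt ((n_ k)%:R * ln (k.+1%:R)) <=
  D (take (N k.+1) v) - D (take (N k) v).
have IO := infinitely_often_word pb_ge0 pb_sum q0 qS mu_cell (G := G) (K := K) Nh _ _.
(* What remains after the cancellation is [X], and [psi (N k.+1) <= sqrt (2 ^ a.+1) * X]: a factor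
   [2 ^ a] comes from the length and a factor 2 from [ln (a * k.+1) <= 2 * ln k.+1]. *)
exists (Num.sqrt (2 ^ a.+1)%N%:R)^-1; split.
  by rewrite invr_gt0 sqrtr_gt0 ltr0n expn_gt0.
apply: ae_imp (ae_and abs_blocks (IO _ _)) => {IO}; last first.
- move=> k w Kk sw; apply: (le_trans (HK k (n_ k) w Kk (n2 k))).
  apply: Pr_le => // v sv; rewrite /G.
  rewrite [take (N k.+1) _]take_oversize; last first.
    by rewrite size_cat sw sv /n_ subnKC // Nh.
  by rewrite take_size_cat.
- move=> k w v kw; rewrite /G !takel_cat //.
  by apply: leq_trans kw; exact: Nh.
move=> x [Ux IOx] x01 n0.
have [K2 U] := Ux x01.
have [k kK Gx] := IOx x01 (maxn n0 (maxn a K2)).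
move: kK; rewrite !geq_max => /andP[kn /andP[ka kK2]].
exists (N k.+1).
  apply: (leq_trans kn); rewrite /N; apply: ltnW; apply: (leq_trans (ltn_expl k (ltnSn 1))).
  by rewrite leq_exp2l // mulnS (leq_trans _ (leq_addl _ _)) // leq_pmull.
rewrite /G !take_word // ?Nh // in Gx.
have := U (a * k)%N (N k) _ (leqnn _); rewrite -/(N k) => {}U.
have {}U := U (leq_trans kK2 (leq_pmull _ (ltn0Sn _))).
set L : R := ln k.+1%:R in Gx *.
have L0 : 0 <= L by exact: ln_nat_ge0.
pose X := Num.sqrt ((N k)%:R * L) : R.
have X0 : 0 <= X by exact: sqrtr_ge0.
have sq_le : (a * k.+1 <= k.+1 ^ 2)%N.
  by rewrite -mulnn leq_mul2r /= (leq_trans ka).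
have e1 : Num.sqrt ((N k)%:R * ln (a * k).+1%:R) <= 2 * X.
  rewrite -(ger0_norm (x := 2)) // -sqrtr_sqr -sqrtrM ?sqr_ge0 //.
  apply: ler_wsqrtr; rewrite mulrCA ler_wpM2l //.
  have : ln (a * k).+1%:R <= ln ((k.+1 ^ 2)%N%:R) :> R.
    rewrite ler_ln ?posrE // ?ltr0n ?expn_gt0 // ler_nat.
    by apply: leq_trans sq_le; rewrite mulnS -addn1 addnC leq_add2r.
  rewrite natrX lnXn // -/L => h; apply: (le_trans h).
  by rewrite -mulr_natl expr2; lra.
have e2 : (2 * Cu + 1) * X <= c1 * Num.sqrt ((n_ k)%:R * L).
  rewrite -ler_pdivrMl // mulrA [_^-1 * _]mulrC.
  have M0 : 0 <= (2 * Cu + 1) / c1 by rewrite divr_ge0 ?(ltW c10) // addr_ge0 // mulr_ge0 // ltW.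
  rewrite -[X in X * _](ger0_norm M0) -sqrtr_sqr -sqrtrM ?sqr_ge0 //.
  apply: ler_wsqrtr; rewrite mulrA ler_wpM2r //.
  apply: (@le_trans _ _ ((2 ^ b)%N%:R * (N k)%:R)); first by rewrite ler_wpM2r.
  by rewrite -natrM ler_nat mulnC.
have e3 : psi (N k.+1) <= Num.sqrt (2 ^ a.+1)%N%:R * X.
  rewrite /psi -sqrtrM //; apply: ler_wsqrtr.
  have -> : (2 ^ a.+1)%N%:R * ((N k)%:R * L) = (N k.+1)%:R * (2 * L).
    by rewrite /N mulnS expnD [(2 ^ a.+1)%N]expnS !natrM; ring.
  rewrite ler_wpM2l // ln_exp2.
  have l20 : 0 < ln 2 :> R by apply: lt_le_trans ln2_ge.
  rewrite /L (mulr_natl _ 2) -lnXn // -natrX ler_ln ?posrE ?mulr_gt0 ?ltr0n ?expn_gt0 //.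
  apply: (@le_trans _ _ (a * k.+1)%:R); last by rewrite ler_nat.
  by rewrite ler_piMr // ln2_le.
rewrite mulrC ler_pdivrMr ?sqrtr_gt0 ?ltr0n ?expn_gt0 //.
apply: (le_trans e3); rewrite mulrC ler_wpM2r ?sqrtr_ge0 //.
have U1 : - D (word (N k) x) <= Cu * (2 * X).
  apply: (le_trans _ (ler_wpM2l (ltW Cu0) e1)); apply: le_trans U.
  by rewrite -normrN ler_norm.
by lra.
Qed.

End TwoSided.
End LIL.

(** * Derivatives of real functions *)

Section Derive.
Context {R : realType}.
Implicit Types (f g : R -> R) (a l m : R).

Lemma dnbhs0P (P : R -> Prop) :
  (\forall t \near 0^', P t) <-> exists2 d : R, 0 < d & forall t, 0 < `|t| < d -> P t.
Proof.
split.
  move=> /nbhs_ballP[d /= d0 dP]; exists d => // t /andP[t0 td].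
  by apply: dP; rewrite /ball /= ?sub0r ?normrN // -normr_gt0.
case=> d d0 dP; apply/nbhs_ballP; exists d => //= t.
by rewrite /ball /= sub0r normrN => td t0; apply: dP; rewrite normr_gt0 t0.
Qed.

(** Differentiability as a non-strict first-order expansion, valid at [t = 0] too, so that estimates
    combine without dividing by the increment. *)
Lemma is_derive1P f a l : is_derive a 1 f l <->
  forall e, 0 < e -> exists2 d, 0 < d &
    forall t, `|t| < d -> `|f (a + t) - f a - l * t| <= e * `|t|.
Proof.
have key t : t != 0 ->
    `|l - t^-1 * (f (a + t) - f a)| = `|f (a + t) - f a - l * t| / `|t|.
  move=> t0; rewrite -normfV -normrM -normrN; congr `|_|.
  by field.
have eq_quot : (fun h => h^-1 *: (f (h *: 1 + a) - f a)) =
    (fun h => h^-1 * (f (a + h) - f a)) :> (R -> R).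
  by apply/funext => h; rewrite /GRing.scale /= mulr1 (addrC h a).
have cvgP : (h^-1 * (f (a + h) - f a) @[h --> 0^'] --> l) <->
  forall e, 0 < e -> exists2 d, 0 < d &
    forall t, `|t| < d -> `|f (a + t) - f a - l * t| <= e * `|t|.
  split.
    move=> /cvgrPdist_le H e e0; have /dnbhs0P[d d0 dP] := H e e0.
    exists d => // t td; have [->|t0] := eqVneq t 0.
      by rewrite addr0 mulr0 subrr subr0 normr0 mulr0.
    have := dP t; rewrite normr_gt0 t0 td => /(_ isT).
    by rewrite key // ler_pdivrMr // normr_gt0.
  move=> H; apply/cvgrPdist_le => e e0; apply/dnbhs0P.
  have [d d0 dP] := H e e0; exists d => // t /andP[t0 td].
  by rewrite key -?normr_gt0 // ler_pdivrMr // dP.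
split.
  case=> df dl; apply/cvgP; move: df dl.
  by rewrite /derivable /derive eq_quot => df <-.
move/cvgP => H; split.
  by rewrite /derivable eq_quot; apply/cvg_ex; exists l.
by rewrite /derive eq_quot; apply/cvg_lim.
Qed.

Lemma is_derive1_unique f a l m : is_derive a 1 f l -> is_derive a 1 f m -> l = m.
Proof. by move=> [_ <-] [_ <-]. Qed.

Lemma is_derive1_near f g a l d : 0 < d ->
  (forall t, `|t| < d -> f (a + t) = g (a + t)) -> is_derive a 1 f l -> is_derive a 1 g l.
Proof.
move=> d0 fg /is_derive1P H; apply/is_derive1P => e e0; have [d' d'0 dP] := H e e0.
exists (Num.min d d'); first by rewrite lt_min d0.
move=> t; rewrite lt_min => /andP[td td']; rewrite -fg //.
have := fg 0; rewrite normr0 addr0 => <- //; exact: dP.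
Qed.

Lemma is_derive1_lip f a l d L : 0 < d ->
  (forall t, `|t| < d -> `|f (a + t) - f a| <= L * `|t|) -> is_derive a 1 f l ->
  `|l| <= L.
Proof.
move=> d0 fL /is_derive1P H; apply/ler_addgt0Pr => e e0; have [d' d'0 dP] := H e e0.
pose t := Num.min d d' / 2.
have m0 : 0 < Num.min d d' by rewrite lt_min d0.
have t0 : 0 < t by rewrite divr_gt0.
have tm : `|t| < Num.min d d' by rewrite gtr0_norm // /t; lra.
move: tm; rewrite lt_min => /andP[td td'].
have h1 := fL t td; have h2 := dP t td'.
have tn : 0 < `|t| by rewrite normr_gt0 gt_eqF.
rewrite -(ler_pM2r tn) -normrM mulrDl.
have -> : l * t = (f (a + t) - f a) - (f (a + t) - f a - l * t) by ring.
by apply: (le_trans (ler_normB _ _)); apply: lerD.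
Qed.

Lemma derive1_lip f a l : is_derive a 1 f l ->
  exists2 d, 0 < d & forall t, `|t| < d -> `|f (a + t) - f a| <= (`|l| + 1) * `|t|.
Proof.
move=> /is_derive1P /(_ 1 ltr01)[d d0 dP]; exists d => // t td.
have -> : f (a + t) - f a = (f (a + t) - f a - l * t) + l * t by ring.
rewrite mulrDl addrC; apply: (le_trans (ler_normD _ _)).
by apply: lerD; rewrite ?normrM // dP.
Qed.

Lemma is_derive1_cst c a : is_derive a 1 (fun=> c : R) 0.
Proof. by apply/is_derive1P => e e0; exists 1 => // t _; rewrite subrr mul0r subr0 normr0 mulr_ge0 // ltW. Qed.

Lemma is_derive1_id a : is_derive a 1 (fun t : R => t) 1.
Proof.
apply/is_derive1P => e e0; exists 1 => // t _.
by rewrite mul1r (addrC a) addrK subrr normr0 mulr_ge0 // ltW.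
Qed.

Lemma is_derive1D f g a l m : is_derive a 1 f l -> is_derive a 1 g m ->
  is_derive a 1 (fun t => f t + g t) (l + m).
Proof. by move=> hf hg; exact: is_deriveD. Qed.

Lemma is_derive1B f g a l m : is_derive a 1 f l -> is_derive a 1 g m ->
  is_derive a 1 (fun t => f t - g t) (l - m).
Proof. by move=> hf hg; exact: is_deriveB. Qed.

Lemma is_derive1M f g a l m : is_derive a 1 f l -> is_derive a 1 g m ->
  is_derive a 1 (fun t => f t * g t) (l * g a + f a * m).
Proof.
move=> hf hg; have := is_deriveM hf hg.
by rewrite /GRing.scale /= addrC [g a * l]mulrC.
Qed.

Lemma is_derive1V f a l : f a != 0 -> is_derive a 1 f l ->
  is_derive a 1 (fun t => (f t)^-1) (- l / f a ^+ 2).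
Proof.
move=> fa hf; have := is_deriveV fa hf; rewrite /GRing.scale /=.
by rewrite mulNr mulrC mulNr.
Qed.

Lemma is_derive1_div f g a l m : g a != 0 -> is_derive a 1 f l -> is_derive a 1 g m ->
  is_derive a 1 (fun t => f t / g t) ((l * g a - f a * m) / g a ^+ 2).
Proof.
move=> ga hf hg; have := is_derive1M hf (is_derive1V ga hg).
by have -> : l / g a + f a * (- m / g a ^+ 2) = (l * g a - f a * m) / g a ^+ 2 by field.
Qed.

Lemma is_derive1_eq f a l m : l = m -> is_derive a 1 f l -> is_derive a 1 f m.
Proof. by move=> ->. Qed.

Lemma derive1_is f a l : is_derive a 1 f l -> derive1 f a = l.
Proof. by move=> h; rewrite derive1E; exact: derive_val. Qed.

Lemma is_derive1_of f a : derivable f a 1 -> is_derive a 1 f (derive1 f a).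
Proof. by move=> h; rewrite derive1E; exact: derivableP. Qed.

(* If the difference quotient is within [e] of that of a differentiable function
   for every [e], it is Cauchy. *)
Lemma derivable_approx f a :
  (forall e, 0 < e -> exists g l, is_derive a 1 g l /\
     exists2 d, 0 < d & forall t, `|t| < d -> `|(f (a + t) - f a) - (g (a + t) - g a)| <= e * `|t|) ->
  exists l, is_derive a 1 f l.
Proof.
move=> H.
pose Q h := h^-1 * (f (a + h) - f a).
suff /cvg_ex[l Ql] : cvg (Q h @[h --> 0^']).
  exists l; apply/is_derive1P => e e0.
  move/cvgrPdist_le: Ql => /(_ e e0) /dnbhs0P[d d0 dP].
  exists d => // t td; have [->|t0] := eqVneq t 0.
    by rewrite addr0 mulr0 subrr subr0 normr0 mulr0.
  have := dP t; rewrite normr_gt0 t0 td => /(_ isT).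
  rewrite distrC /Q; rewrite -(ler_pM2r (x := `|t|)) ?normr_gt0 // -normrM.
  by congr (`|_| <= _); field.
apply/cauchy_cvgP; apply/cauchyP => e e0.
have e4 : 0 < e / 4 by rewrite divr_gt0.
have [g [l [/is_derive1P gl [d d0 dP]]]] := H _ e4.
have [d' d'0 dP'] := gl _ e4.
exists l; apply/dnbhs0P; exists (Num.min d d'); first by rewrite lt_min d0.
move=> t /andP[t0]; rewrite lt_min => /andP[td td'].
have t1 : t != 0 by rewrite -normr_gt0.
rewrite /ball /= -(ltr_pM2r t0) -normrM.
have -> : (l - Q t) * t = - ((f (a + t) - f a) - (g (a + t) - g a)) - (g (a + t) - g a - l * t).
  by rewrite /Q; field.
apply: (le_lt_trans (ler_normB _ _)); rewrite normrN.
apply: (le_lt_trans (lerD (dP t td) (dP' t td'))).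
by rewrite -mulrDl ltr_pM2r //; lra.
Qed.

Lemma exists_expr_lt (r e : R) : 0 <= r < 1 -> 0 < e -> exists n, r ^+ n < e.
Proof.
move=> /andP[r0 r1] e0.
have /cvgrPdist_lt/(_ e e0) [n _ nP] := @cvg_expr R r (ltac:(by rewrite ger0_norm)).
by exists n; have := nP n (leqnn n); rewrite sub0r normrN ger0_norm // exprn_ge0.
Qed.

End Derive.

(** * Runs of equal digits *)

Section Runs.
Context {R : realType}.

(** When [rho ^+ a <= 1 / 4], a run of this length has probability at most [n.+1 ^ -2]; see
    [run_len_prob]. *)
Definition run_len a n := (a * (trunc_log 2 n.+1).+1)%N.

Lemma run_len_mono a : {homo run_len a : i j / (i <= j)%N >-> (i <= j)%N}.
Proof.
by move=> i j ij; rewrite /run_len leq_mul2l ltnS leq_trunc_log ?orbT // ltnS.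
Qed.

Lemma cube_le_exp2 k : (10 <= k)%N -> (k ^ 3 <= 2 ^ k)%N.
Proof.
elim: k => // k IH; rewrite leq_eqVlt => /predU1P[<-//|].
rewrite ltnS => k4; have := IH k4; rewrite [(2 ^ k.+1)%N]expnS => h.
by nia.
Qed.

Lemma run_len_small a C : exists N, forall n, (N <= n)%N ->
  (C * run_len a n.+1 ^ 2 <= n)%N.
Proof.
(* With [T] the binary logarithm of [n.+2], the square of the run length is at most
   [4 * a ^ 2 * T ^ 2], while [T ^ 3 <= 2 ^ T <= n.+2] once [10 <= T]. The summand 10 also leaves
   the slack that replaces [n.+2] by [n]. *)
pose K := (4 * C * a ^ 2 + 10)%N.
exists (2 ^ K)%N => n Kn; rewrite /run_len.
have /andP[lo _] : (2 ^ trunc_log 2 n.+2 <= n.+2 < 2 ^ (trunc_log 2 n.+2).+1)%N.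
  exact: trunc_log_bounds.
have KT : (K <= trunc_log 2 n.+2)%N.
  by rewrite -(trunc_expnK K (ltnSn 1)) leq_trunc_log // (leq_trans Kn) // -addn2 leq_addr.
set T := trunc_log 2 n.+2 in lo KT *.
have T10 : (10 <= T)%N by apply: leq_trans KT; rewrite /K leq_addl.
have h1 := leq_trans (cube_le_exp2 T10) lo.
have h2 : (4 * C * a ^ 2 * T ^ 2 + 10 * T ^ 2 <= T ^ 3)%N.
  by rewrite -mulnDl expnS leq_mul2r KT orbT.
have h3 : (T.+1 ^ 2 <= 4 * T ^ 2)%N by move: T10; clear; nia.
have h4 : (C * (a * T.+1) ^ 2 <= 4 * C * a ^ 2 * T ^ 2)%N.
  rewrite expnMn mulnA; apply: (leq_trans (leq_mul (leqnn (C * a ^ 2)%N) h3)).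
  by rewrite (_ : C * a ^ 2 * (4 * T ^ 2) = 4 * C * a ^ 2 * T ^ 2)%N //; ring.
have h5 : (100 <= T ^ 2)%N by move: T10; clear; nia.
by move: h1 h2 h4 h5; clear; lia.
Qed.

Lemma run_len_prob (rho : R) a n : 0 <= rho -> rho ^+ a <= 4^-1 ->
  rho ^+ run_len a n <= (n.+1%:R ^+ 2)^-1.
Proof.
move=> r0 ra; rewrite /run_len; set T := trunc_log 2 n.+1.
have hT : (n.+1 <= 2 ^ T.+1)%N by apply: ltnW; rewrite trunc_log_ltn.
rewrite exprM; apply: (@le_trans _ _ (4^-1 ^+ T.+1)).
  by apply: lerXn2r; rewrite ?nnegrE ?exprn_ge0.
rewrite exprVn lef_pV2 ?posrE ?exprn_gt0 // -!natrX ler_nat.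
by rewrite (_ : 4 = 2 ^ 2)%N // -expnM mulnC expnM leq_exp2r.
Qed.

Variable mu : probability (measurableTypeR R) R.
Variable (pb : seq bool -> bool -> R) (q : seq bool -> R) (rho : R).
Hypothesis pb_ge0 : forall w i, 0 <= pb w i.
Hypothesis pb_sum : forall w, pb w false + pb w true = 1.
Hypothesis q0 : q [::] = 1.
Hypothesis qS : forall w i, q (rcons w i) = q w * pb w i.
Hypothesis mu_cell : forall w,
  mu [set x : R | 0 < x <= 1 /\ word (size w) x = w] = (q w)%:E.
Hypothesis pb_le : forall w i, pb w i <= rho.
Hypothesis rho_lt1 : rho < 1.

Let rho_ge0 : 0 <= rho. Proof. exact: le_trans (pb_ge0 [::] true) (pb_le _ _). Qed.

Lemma run_prob b l w m : (m <= size w)%N ->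
  Pr pb l (fun v => all (pred1 b) (drop m v)) w <= rho ^+ l.
Proof.
elim: l w => [|l IH] w mw; first by rewrite expr0; exact: Pr_le1.
have mw1 i : (m <= size (rcons w i))%N by rewrite size_rcons leqW.
have z i : i != b -> Pr pb l (fun v => all (pred1 b) (drop m v)) (rcons w i) = 0.
  move=> ib; rewrite -(Ex_cst pb_sum l 0 (rcons w i)); apply: Ex_ext => // v _.
  rewrite drop_cat size_rcons ltnS mw /= -cats1 drop_cat ltn_neqAle mw andbT.
  by case: eqP => [->|_]; rewrite /= ?subnn ?all_cat /= (negPf ib) ?andbF.
rewrite {1}/Pr /= -/(Pr pb l _ (rcons w false)) -/(Pr pb l _ (rcons w true)) exprS.
have s i : pb w i * Pr pb l (fun v => all (pred1 b) (drop m v)) (rcons w i) <= rho * rho ^+ l.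
  by apply: ler_pM => //; [exact: Pr_ge0|exact: IH].
case: b z s {IH} => z s; first by rewrite (z false) // mulr0 add0r.
by rewrite (z true) // mulr0 addr0.
Qed.

(** Used at two places near position [n]: a run ending the [n]-th cell would let [x + h] escape a
    much larger cell, and a run after it would make the mass between [x] and [x + h] too small. *)
Lemma runs_ae : exists a, {ae mu, forall x : R, 0 < x <= 1 ->
  exists N, forall m l, (N <= m)%N -> (run_len a m <= l)%N ->
    forall b, ~~ all (pred1 b) (word l (iter m shift x))}.
Proof.
have [a ra] : exists a, rho ^+ a < 4^-1 by apply: exists_expr_lt => //; rewrite rho_ge0.
exists a.
have main b : {ae mu, forall x : R, 0 < x <= 1 -> exists K', forall k, (K' <= k)%N ->
    ~~ all (pred1 b) (drop k (word (k + run_len a k)%N x))}.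
  apply: (borel_cantelli_word q0 qS mu_cell (n_ := fun k => (k + run_len a k)%N)
    (P_ := fun k v => all (pred1 b) (drop k v)) (K := 0%N)) => k _.
  apply: (le_trans _ (run_len_prob k rho_ge0 (ltW ra))).
  rewrite /Pr Ex_add -[leRHS](Ex_cst pb_sum k _ [::]); apply: Ex_le => // w sw.
  by apply: run_prob; rewrite sw.
apply: ae_imp (ae_and (main true) (main false)).
move=> x [Hx Hx'] x01; have [K1 h1] := Hx x01; have [K2 h2] := Hx' x01.
  exists (maxn K1 K2) => m l; rewrite geq_max => /andP[m1 m2] ml b.
  have : ~~ all (pred1 b) (word (run_len a m) (iter m shift x)).
    have dr : drop m (word (m + run_len a m) x) = word (run_len a m) (iter m shift x).
      by rewrite word_add drop_size_cat // size_word.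
    by case: b; rewrite -dr; [exact: h1|exact: h2].
  by apply: contra; rewrite -(subnKC ml) word_add all_cat => /andP[].
Qed.

End Runs.

(** * Comparison of [lil_scale] with its values at dyadic points *)

Section Scale.
Context {R : realType}.

Lemma lnln_ge1 n : (2 ^ 8 <= n)%N -> 1 <= ln (ln n%:R) :> R.
Proof.
move=> hn; have e4 : expR 1 <= 4 :> R.
  by apply: (le_trans (expR_le_quad _)); rewrite ?normr1 //; rewrite expr1n; lra.
rewrite -[leLHS]expRK.
have l4 : 4 <= ln n%:R :> R.
  apply: (@le_trans _ _ (ln (2 ^ 8)%N%:R)).
    by rewrite ln_exp2; have := @ln2_ge R; lra.
  by rewrite ler_ln ?posrE ?ltr0n ?ler_nat //; apply: leq_trans hn.
by rewrite ler_ln ?posrE ?expR_gt0 //; [exact: le_trans l4|exact: lt_le_trans l4].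
Qed.

Lemma sqrt_le_psi n : (2 ^ 8 <= n)%N -> Num.sqrt n%:R <= psi n :> R.
Proof.
by move=> hn; rewrite /psi ler_wsqrtr // ler_peMr //; exact: lnln_ge1.
Qed.

Lemma run_len_psi a N0 (K d : R) : 0 <= K -> 0 < d -> exists N, forall n, (N <= n)%N ->
  (run_len a n.+1 + N0 <= n)%N /\ K * (run_len a n.+1)%:R <= d * psi n.
Proof.
(* The run length [l] satisfies [C * l ^ 2 <= n]. Since [(K / d) ^+ 2 <= C] this gives
   [K * l <= d * sqrt n], and [2 <= C] gives [l + N0 <= n] as soon as [2 * N0 <= n]. *)
move=> K0 d0; pose C := (Num.truncn ((K / d) ^+ 2)).+2.
have [N HN] := run_len_small a C.
exists (maxn N (maxn (2 ^ 8) (2 * N0))) => n; rewrite !geq_max => /andP[/HN h1 /andP[h8 h2]].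
set l := run_len a n.+1 in h1 *.
split.
  have : (2 * l ^ 2 <= n)%N by apply: leq_trans h1; rewrite leq_mul2r orbC.
  by move: h2; clear; nia.
apply: (@le_trans _ _ (d * Num.sqrt n%:R)); last by rewrite ler_wpM2l ?sqrt_le_psi // ltW.
rewrite -ler_pdivrMl // mulrA (mulrC d^-1).
have Kd : 0 <= K / d by rewrite divr_ge0 // ltW.
have e0 : 0 <= K / d * l%:R by rewrite mulr_ge0.
rewrite -(ger0_norm e0) -sqrtr_sqr ler_wsqrtr // exprMn.
apply: (@le_trans _ _ (C * l ^ 2)%N%:R); last by rewrite ler_nat.
rewrite natrM natrX ler_wpM2r ?sqr_ge0 //.
by apply: (le_trans (ltW (truncnS_gt _))); rewrite ler_nat.
Qed.

Lemma log2_exp n : log2 (1 / `|2^-1 ^+ n|) = n%:R :> R.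
Proof.
have l20 : 0 < ln 2 :> R by apply: lt_le_trans ln2_ge.
have p2 : 0 < 2^-1 ^+ n :> R by rewrite exprn_gt0.
by rewrite (gtr0_norm p2) /log2 exprVn div1r invrK -natrX ln_exp2 mulfK // gt_eqF.
Qed.

Lemma lil_scale_exp n : lil_scale (2^-1 ^+ n) = psi n :> R.
Proof. by rewrite /lil_scale log2_exp. Qed.

Lemma dyadic_scale N (h : R) : h != 0 -> `|h| < 2^-1 ^+ N ->
  exists n, [/\ (N <= n)%N, 2^-1 ^+ n.+1 < `|h|, `|h| <= 2^-1 ^+ n & n%:R <= log2 (1 / `|h|)].
Proof.
move=> h0 hN; have hp : 0 < `|h| by rewrite normr_gt0.
have l20 : 0 < ln 2 :> R by apply: lt_le_trans ln2_ge.
have y0 : 0 < `|h|^-1 by rewrite invr_gt0.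
have le_y n : (2 ^ n)%N%:R <= `|h|^-1 <-> n%:R <= log2 (1 / `|h|).
  rewrite /log2 div1r ler_pdivlMr // -ln_exp2 ler_ln ?posrE // ltr0n expn_gt0.
have lo n : `|h| <= 2^-1 ^+ n <-> n%:R <= log2 (1 / `|h|).
  by rewrite -le_y natrX exprVn -[X in X <= _]invrK lef_pV2 ?posrE ?exprn_gt0.
have NL : N%:R <= log2 (1 / `|h|) by apply/lo; exact: ltW.
have L0 : 0 <= log2 (1 / `|h|) by apply: le_trans NL.
have /andP[n1 n2] := truncn_itv L0; set n := Num.truncn _ in n1 n2.
exists n; split => //.
- by rewrite -ltnS -(ltr_nat R) (le_lt_trans NL).
- by rewrite ltNge; apply/negP => /lo; rewrite leNgt n2.
- exact/lo.
Qed.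

Lemma psi_le_scale n (h : R) : (2 ^ 8 <= n)%N -> n%:R <= log2 (1 / `|h|) ->
  psi n <= lil_scale h.
Proof.
move=> hn nL; rewrite /psi /lil_scale; apply: ler_wsqrtr.
have n0 : 0 < n%:R :> R by rewrite ltr0n; apply: leq_trans hn.
have LL := lnln_ge1 hn.
have ln0 : 0 < ln n%:R :> R.
  (* The logarithm of a nonpositive number is 0 by convention, which contradicts
     [1 <= ln (ln n)]. *)
  rewrite ltNge; apply/negP => h0; move: LL; rewrite (ln0 h0); lra.
apply: ler_pM => //; first by apply: le_trans LL.
rewrite ler_ln ?posrE //; first by rewrite ler_ln ?posrE // (lt_le_trans n0).
by apply: lt_le_trans ln0 _; rewrite ler_ln ?posrE // (lt_le_trans n0).
Qed.

End Scale.

(** * Affine coordinates in dyadic cells *)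

Section Rescale.
Context {R : realType}.

(* The point of the dyadic cell [word n x] whose position within it is [z]. *)
Definition rescale n (x z : R) : R := x + 2^-1 ^+ n * (z - iter n shift x).

Lemma rescale_S n (x z : R) :
  rescale n.+1 x z = ((digit x)%:R + rescale n (shift x) z) / 2.
Proof.
rewrite /rescale iterSr exprS; set y := iter n _ _.
by rewrite /shift /digit; case: ltP => _ /=; field.
Qed.

Lemma rescale_itv n (x z : R) : 0 < x <= 1 -> 0 <= z <= 1 -> 0 <= rescale n x z <= 1.
Proof.
move=> + z01; elim: n x => [|n IH] x x01.
  by rewrite /rescale expr0 mul1r /= addrC subrK.
rewrite rescale_S; have /andP[? ?] := IH _ (shift_itv x01).
by case: (digit x) => /=; apply/andP; split; lra.
Qed.

Lemma word_not_all b l (y : R) : ~~ all (pred1 b) (word l y) ->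
  exists2 k, (k < l)%N & digit (iter k shift y) != b.
Proof.
elim: l y => //= l IH y; rewrite negb_and => /orP[h|/IH[k kl dk]]; first by exists 0%N.
by exists k.+1; rewrite ?iterSr.
Qed.

Fixpoint left_end (w : seq bool) : R := if w is i :: w' then (i%:R + left_end w') / 2 else 0.

Lemma left_end_itv w : 0 <= left_end w /\ left_end w + 2^-1 ^+ size w <= 1.
Proof.
elim: w => [|i w [IH1 IH2]] /=; first by rewrite add0r expr0.
by rewrite exprS; case: i => /=; split; lra.
Qed.

Lemma cell_itv w (x : R) : (0 < x <= 1 /\ word (size w) x = w) <->
  left_end w < x <= left_end w + 2^-1 ^+ size w.
Proof.
elim: w x => [|i w IH] x /=; first by rewrite add0r expr0; split => [[]|].
have [l0 l1] := left_end_itv w; rewrite exprS.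
have p0 : 0 < 2^-1 ^+ size w :> R by rewrite exprn_gt0.
split.
  move=> [x01 [dx wx]]; have /IH := conj (shift_itv x01) wx.
  by move: dx; rewrite /shift /digit; case: ltP => h <- /= /andP[? ?]; apply/andP; split; lra.
move=> /andP[h1 h2].
have x01 : 0 < x <= 1 by case: i h1 h2 => /= h1 h2; apply/andP; split; lra.
have dx : digit x = i by rewrite /digit; case: i h1 h2 => /= h1 h2; case: ltP => //; lra.
have : left_end w < shift x <= left_end w + 2^-1 ^+ size w.
  by rewrite /shift dx; case: i {dx} h1 h2 => /= h1 h2; apply/andP; split; lra.
by move=> /IH [_ ->]; rewrite dx.
Qed.

End Rescale.

(** * Difference quotients and the score *)

Section Analysis.
Context {R : realType}.
(** Here [p t w] is the law of the digit following [w], and [H t w] the distribution function of the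
    conditional measure in the cell of [w], rescaled to [[0, 1]]. Only their recursion and uniform
    bounds are assumed, so this part does not see Moebius maps. *)
Variables (p : R -> seq bool -> bool -> R) (H : R -> seq bool -> R -> R).
Variables (dp : seq bool -> bool -> R) (t0 pm L : R).
Hypotheses (t0_gt0 : 0 < t0) (pm_gt0 : 0 < pm) (L_gt0 : 0 < L).
Hypothesis p_sum : forall (t : R) w, `|t| < t0 -> p t w false + p t w true = 1.
Hypothesis p_ge : forall (t : R) w i, `|t| < t0 -> pm <= p t w i.
Hypothesis H_itv : forall (t : R) w (x : R), `|t| < t0 -> 0 <= x <= 1 -> 0 <= H t w x <= 1.
Hypothesis H_0 : forall (t : R) w, `|t| < t0 -> H t w 0 = 0.
Hypothesis H_1 : forall (t : R) w, `|t| < t0 -> H t w 1 = 1.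
Hypothesis H_left : forall (t : R) w (x : R), `|t| < t0 -> 0 <= x <= 2^-1 ->
  H t w x = p t w false * H t (rcons w false) (2 * x).
Hypothesis H_right : forall (t : R) w (x : R), `|t| < t0 -> 2^-1 <= x <= 1 ->
  H t w x = p t w false + p t w true * H t (rcons w true) (2 * x - 1).
Hypothesis p_lip : forall (t : R) w i, `|t| < t0 -> `|p t w i - p 0 w i| <= L * `|t|.
Hypothesis p_der : forall w i, is_derive (0 : R) 1 (fun t => p t w i) (dp w i).

(** [M] bounds the logarithmic derivatives of [p], and solves [M = L + rho * M], the balance of a
    perturbation bound passed once through the recursion. *)
Let M : R := L / pm.
Let rho : R := 1 - pm.

Let n0 : `|0 : R| < t0. Proof. by rewrite normr0. Qed.

Let M_gt0 : 0 < M. Proof. exact: divr_gt0. Qed.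

Let p_le (t : R) w i : `|t| < t0 -> p t w i <= rho.
Proof.
move=> tt; have := p_sum w tt; have := p_ge w false tt; have := p_ge w true tt.
by rewrite /rho; case: i; lra.
Qed.

Let p_ge0 (t : R) w i : `|t| < t0 -> 0 <= p t w i.
Proof. by move=> tt; apply: le_trans (ltW pm_gt0) (p_ge w i tt). Qed.

Let rho_ge : 2^-1 <= rho.
Proof. by have := p_sum [::] n0; have := p_le [::] false n0; have := p_le [::] true n0; lra. Qed.

Let M_ge0 : 0 <= M. Proof. exact: ltW. Qed.

Let rho_lt1 : rho < 1. Proof. by rewrite /rho ltrBlDr ltrDl. Qed.

Let rho_ge0 : 0 <= rho. Proof. by have := rho_ge; lra. Qed.

Let dbl_l (x : R) : 0 <= x <= 2^-1 -> 0 <= 2 * x <= 1.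
Proof. by move=> /andP[? ?]; apply/andP; split; lra. Qed.

Let dbl_r (x : R) : 2^-1 <= x <= 1 -> 0 <= 2 * x - 1 <= 1.
Proof. by move=> /andP[? ?]; apply/andP; split; lra. Qed.

Let half_cases (x : R) : 0 <= x <= 1 -> (0 <= x <= 2^-1) \/ (2^-1 <= x <= 1).
Proof.
move=> /andP[x0 x1]; have [h|h] := lerP x 2^-1; [left|right]; apply/andP; split => //.
exact: ltW.
Qed.

Let le_geom (a b c : R) : 0 <= c -> (forall n, a <= b + c * rho ^+ n) -> a <= b.
Proof.
move=> c0 h; apply/ler_addgt0Pr => e e0.
have [n ne] : exists n, rho ^+ n < e / (c + 1).
  apply: exists_expr_lt; first by rewrite rho_ge0 rho_lt1.
  by rewrite divr_gt0 // ltr_wpDl.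
apply: (le_trans (h n)); rewrite lerD2l.
have c1 : 0 < c + 1 by rewrite ltr_wpDl.
move: ne; rewrite ltr_pdivlMr // => ne.
apply: le_trans (ltW ne); rewrite mulrC ler_wpM2l ?exprn_ge0 //; lra.
Qed.

Lemma H_lip (t : R) w (x : R) : `|t| < t0 -> 0 <= x <= 1 -> `|H t w x - H 0 w x| <= M * `|t|.
Proof.
(* The recursion in [w] never terminates, so the induction is on a number of unfoldings; the
   unresolved part contributes [rho ^+ n] and is removed by [le_geom]. *)
move=> tt; suff main n : forall w (x : R), 0 <= x <= 1 ->
    `|H t w x - H 0 w x| <= M * `|t| + 1 * rho ^+ n.
  by move=> x01; apply: (le_geom ler01) => n; exact: main.
elim: n => [|n IH] {}w {}x x01.
  have := H_itv w tt x01; have := H_itv w n0 x01 => /andP[? ?] /andP[? ?].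
  rewrite expr0 ler_norml; have : 0 <= M * `|t| by rewrite mulr_ge0 // ltW.
  by move=> ?; apply/andP; split; lra.
have step i (a b : R) : 0 <= a <= 1 -> `|a - b| <= M * `|t| + 1 * rho ^+ n ->
    `|p t w i * a - p 0 w i * b| <= M * `|t| + 1 * rho ^+ n.+1.
  move=> /andP[a0 a1] ab.
  have -> : p t w i * a - p 0 w i * b = (p t w i - p 0 w i) * a + p 0 w i * (a - b) by ring.
  apply: (le_trans (ler_normD _ _)); rewrite !normrM (ger0_norm a0) (ger0_norm (p_ge0 w i n0)).
  apply: (@le_trans _ _ (L * `|t| + rho * (M * `|t| + 1 * rho ^+ n))).
    apply: lerD; last by apply: ler_pM; rewrite ?p_ge0 ?p_le.
    by apply: le_trans (p_lip w i tt); rewrite ler_piMr.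
  rewrite exprS; have -> : L = M * pm by rewrite /M divfK // gt_eqF.
  by rewrite /rho le_eqVlt; apply/orP; left; apply/eqP; ring.
have [h|h] := half_cases x01.
  rewrite (H_left w tt h) (H_left w n0 h); apply: step; last by apply: IH; exact: dbl_l.
  by apply: H_itv => //; exact: dbl_l.
have x2 := dbl_r h.
(* Complements put the right half in the form of the left one, with a single branch probability, so
   that the constant does not double. *)
have -> : H t w x - H 0 w x =
    p 0 w true * (1 - H 0 (rcons w true) (2 * x - 1)) - p t w true * (1 - H t (rcons w true) (2 * x - 1)).
  by rewrite (H_right w tt h) (H_right w n0 h); have := p_sum w tt; have := p_sum w n0; lra.
rewrite distrC; apply: step.
  by have /andP[? ?] := H_itv (rcons w true) tt x2; apply/andP; split; lra.
set a := H t _ _; set b := H 0 _ _.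
have -> : 1 - a - (1 - b) = - (a - b) by ring.
by rewrite normrN; exact: IH.
Qed.

(** Unfolding [n] levels and linearizing each product gives the explicit comparison function [g].
    The dropped cross terms are the quadratic error, and the increment of [H] below level [n] is the
    [rho ^+ n] error. *)
Lemma H_approx n w (x : R) : 0 <= x <= 1 -> exists (g : R -> R) (l : R), is_derive (0 : R) 1 g l /\
  forall t : R, `|t| < t0 -> `|(H t w x - H 0 w x) - (g t - g 0)|
    <= rho ^+ n * M * `|t| + n%:R * (L * M) * `|t| ^+ 2.
Proof.
elim: n w x => [|n IH] w x x01.
  exists (fun=> 0), 0; split; first exact: is_derive1_cst.
  by move=> t tt; rewrite expr0 !mul0r mul1r addr0 !subr0; exact: H_lip.
have step (t : R) i (a b c : R) : `|t| < t0 -> `|a - b| <= M * `|t| ->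
    `|a - b - c| <= rho ^+ n * M * `|t| + n%:R * (L * M) * `|t| ^+ 2 ->
    `|p t w i * a - p 0 w i * b - ((p t w i - p 0 w i) * b + p 0 w i * c)| <=
    rho ^+ n.+1 * M * `|t| + n.+1%:R * (L * M) * `|t| ^+ 2.
  move=> tt ab abc.
  have -> : p t w i * a - p 0 w i * b - ((p t w i - p 0 w i) * b + p 0 w i * c) =
    p 0 w i * (a - b - c) + (p t w i - p 0 w i) * (a - b) by ring.
  apply: (le_trans (ler_normD _ _)); rewrite !normrM (ger0_norm (p_ge0 w i n0)).
  have LM : 0 <= n%:R * (L * M) * `|t| ^+ 2.
    by apply: mulr_ge0; [apply: mulr_ge0 => //; apply: mulr_ge0; exact: ltW|exact: sqr_ge0].
  apply: (@le_trans _ _ (rho * (rho ^+ n * M * `|t|) + n%:R * (L * M) * `|t| ^+ 2 + (L * `|t|) * (M * `|t|))).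
    apply: lerD; last by apply: ler_pM => //; exact: p_lip.
    apply: (le_trans (ler_wpM2l (p_ge0 w i n0) abc)); rewrite mulrDr; apply: lerD.
      by rewrite ler_wpM2r ?p_le // mulr_ge0 // mulr_ge0 ?exprn_ge0.
    by rewrite ler_piMl //; apply: le_trans (p_le w i n0) (ltW rho_lt1).
  have gen (r e m k l' u : R) : r * (e * m * u) + k * (l' * m) * u ^+ 2 + l' * u * (m * u) =
    r * e * m * u + (k + 1) * (l' * m) * u ^+ 2 by ring.
  by rewrite gen (exprS rho n) (natr1 n).
have [h|h] := half_cases x01.
  have x2 := dbl_l h; have [g [l [gl gP]]] := IH (rcons w false) _ x2.
  exists (fun t => p t w false * H 0 (rcons w false) (2 * x) + p 0 w false * g t).
  exists (dp w false * H 0 (rcons w false) (2 * x) + p 0 w false * 0 + (0 * g 0 + p 0 w false * l)).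
  have d1 := is_derive1M (p_der w false) (is_derive1_cst (H 0 (rcons w false) (2 * x)) 0).
  have d2 := is_derive1M (is_derive1_cst (p 0 w false) 0) gl.
  split.
    apply: is_derive1_eq (is_derive1D d1 d2); ring.
  move=> t tt; rewrite (H_left w tt h) (H_left w n0 h).
  have := step t false _ _ _ tt (H_lip (rcons w false) tt x2) (gP t tt).
  by congr (`|_| <= _); ring.
have x2 := dbl_r h; have [g [l [gl gP]]] := IH (rcons w true) _ x2.
exists (fun t => p t w false + (p t w true * H 0 (rcons w true) (2 * x - 1) + p 0 w true * g t)).
have d1 := is_derive1M (p_der w true) (is_derive1_cst (H 0 (rcons w true) (2 * x - 1)) 0).
have d2 := is_derive1M (is_derive1_cst (p 0 w true) 0) gl.
eexists; split; first exact: is_derive1D (p_der w false) (is_derive1D d1 d2).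
move=> t tt; rewrite (H_right w tt h) (H_right w n0 h).
have := step t true _ _ _ tt (H_lip (rcons w true) tt x2) (gP t tt).
by congr (`|_| <= _); ring.
Qed.

Definition hd w (x : R) : R := derive1 (fun t : R => H t w x) 0.

Lemma hd_is w (x : R) : 0 <= x <= 1 -> is_derive (0 : R) 1 (fun t => H t w x) (hd w x).
Proof.
move=> x01; suff [l hl] : exists l, is_derive (0 : R) 1 (fun t => H t w x) l.
  by rewrite /hd (derive1_is hl).
apply: derivable_approx => e e0.
have e2 : 0 < e / 2 / M by rewrite !divr_gt0.
have [n ne] : exists n, rho ^+ n < e / 2 / M by apply: exists_expr_lt => //; rewrite rho_ge0 rho_lt1.
have [g [l [gl gP]]] := H_approx n w x01.
exists g, l; split => //.
(* The depth [n] is fixed before the radius in [t]; the summand 1 keeps [c] positive when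
   [n = 0]. *)
pose c := n%:R * (L * M) + 1.
have c0 : 0 < c.
  rewrite ltr_wpDl // mulr_ge0 // mulr_ge0 //; exact: ltW.
exists (Num.min t0 (e / 2 / c)); first by rewrite lt_min t0_gt0 !divr_gt0.
move=> t; rewrite lt_min => /andP[tt te]; rewrite !add0r.
apply: (le_trans (gP t tt)).
have h1 : rho ^+ n * M <= e / 2 by rewrite -ler_pdivlMr // ltW.
have h2 : n%:R * (L * M) * `|t| <= e / 2.
  apply: (@le_trans _ _ (c * `|t|)); first by rewrite ler_wpM2r // /c; lra.
  by rewrite mulrC -ler_pdivlMr // ltW.
rewrite expr2 (mulrA (n%:R * (L * M))) -mulrDl ler_wpM2r //; lra.
Qed.

Lemma hd_left w (x : R) : 0 <= x <= 2^-1 -> hd w x =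
  dp w false * H 0 (rcons w false) (2 * x) + p 0 w false * hd (rcons w false) (2 * x).
Proof.
move=> h; have x2 := dbl_l h.
apply: derive1_is; apply: is_derive1_near t0_gt0 _ (is_derive1M (p_der w false) (hd_is (rcons w false) x2)).
by move=> t tt; rewrite add0r (H_left w tt h).
Qed.

Lemma hd_right w (x : R) : 2^-1 <= x <= 1 -> hd w x =
  dp w false + (dp w true * H 0 (rcons w true) (2 * x - 1) + p 0 w true * hd (rcons w true) (2 * x - 1)).
Proof.
move=> h; have x2 := dbl_r h.
apply: derive1_is; apply: is_derive1_near t0_gt0 _
  (is_derive1D (p_der w false) (is_derive1M (p_der w true) (hd_is (rcons w true) x2))).
by move=> t tt; rewrite add0r (H_right w tt h).
Qed.

Lemma hd_le w (x : R) : 0 <= x <= 1 -> `|hd w x| <= M.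
Proof.
move=> x01; apply: is_derive1_lip t0_gt0 _ (hd_is w x01) => t tt.
by rewrite add0r; exact: H_lip.
Qed.

Lemma dp_le w i : `|dp w i| <= M * p 0 w i.
Proof.
apply: (@le_trans _ _ L).
  by apply: is_derive1_lip t0_gt0 _ (p_der w i) => t tt; rewrite add0r; exact: p_lip.
rewrite -[leLHS](divfK (lt0r_neq0 pm_gt0)) ler_wpM2l ?p_ge //; exact: ltW.
Qed.

Lemma dp_sum w : dp w false + dp w true = 0.
Proof.
apply: is_derive1_unique (is_derive1D (p_der w false) (p_der w true)) _.
apply: is_derive1_near t0_gt0 _ (is_derive1_cst 1 0).
by move=> t tt; rewrite add0r p_sum.
Qed.

Lemma H_mono w (u v : R) : 0 <= u -> u <= v -> v <= 1 -> H 0 w u <= H 0 w v.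
Proof.
move=> u0 uv v1; apply: (le_geom ler01) => n.
elim: n w u v u0 uv v1 => [|n IH] w u v u0 uv v1.
  have /andP[? ?] : 0 <= H 0 w u <= 1.
    by apply: H_itv; rewrite // u0 (le_trans uv).
  have /andP[? ?] : 0 <= H 0 w v <= 1.
    by apply: H_itv; rewrite // v1 (le_trans u0).
  by rewrite expr0; lra.
have r0 : 0 <= rho ^+ n by rewrite exprn_ge0.
have key i (a b : R) : a <= b + 1 * rho ^+ n -> p 0 w i * a <= p 0 w i * b + 1 * rho ^+ n.+1.
  move=> ab; apply: (le_trans (ler_wpM2l (p_ge0 w i n0) ab)).
  rewrite mulrDr lerD2l !mul1r exprS ler_wpM2r //; exact: p_le.
have [uh|uh] := lerP u 2^-1; have [vh|vh] := lerP v 2^-1.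
- have u2 : 0 <= u <= 2^-1 by rewrite u0.
  have v2 : 0 <= v <= 2^-1 by rewrite vh (le_trans u0).
  rewrite (H_left w n0 u2) (H_left w n0 v2).
  by apply: key; apply: IH; lra.
- have u2 : 0 <= u <= 2^-1 by rewrite u0.
  have v2 : 2^-1 <= v <= 1 by rewrite v1 ltW.
  rewrite (H_left w n0 u2) (H_right w n0 v2).
  have /andP[a0 a1] : 0 <= H 0 (rcons w false) (2 * u) <= 1.
    by apply: H_itv => //; apply: dbl_l; rewrite u0.
  have /andP[b0 b1] : 0 <= H 0 (rcons w true) (2 * v - 1) <= 1.
    by apply: H_itv => //; apply: dbl_r; rewrite v1 ltW.
  have h1 := ler_piMr (p_ge0 w false n0) a1.
  have h2 := mulr_ge0 (p_ge0 w true n0) b0.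
  have h3 : 0 <= rho ^+ n.+1 by rewrite exprn_ge0.
  by lra.
- by exfalso; lra.
- have u2 : 2^-1 <= u <= 1 by rewrite (ltW uh) (le_trans uv).
  have v2 : 2^-1 <= v <= 1 by rewrite v1 ltW.
  rewrite (H_right w n0 u2) (H_right w n0 v2).
  by rewrite -addrA lerD2l; apply: key; apply: IH; lra.
Qed.

(** The case [u = 0] of [hd_mod], since [H t w 0 = 0] for all small [t]; [hd_mod_right] is the case
    of the endpoint 1. They come first because a pair straddling the midpoint is compared with the
    midpoint, an endpoint of both subcells. *)
Lemma hd_mod_left w (v : R) r : 0 <= v <= 1 ->
  `|hd w v| <= M * r%:R * H 0 w v + M * rho ^+ r.
Proof.
elim: r w v => [|r IH] w v v01; first by rewrite mulr0 mul0r add0r expr0 mulr1 hd_le.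
have r0 : 0 <= M * rho ^+ r by rewrite mulr_ge0 ?exprn_ge0 ?M_ge0 //.
have [h|h] := half_cases v01.
  have x2 := dbl_l h; rewrite (hd_left w h) (H_left w n0 h).
  set a := H 0 (rcons w false) _.
  have /andP[a0 a1] : 0 <= a <= 1 by exact: H_itv.
  apply: (le_trans (ler_normD _ _)); rewrite !normrM (ger0_norm a0) (ger0_norm (p_ge0 w false n0)).
  have h1 := ler_wpM2r a0 (dp_le w false).
  have h2 := ler_wpM2l (p_ge0 w false n0) (IH (rcons w false) _ x2).
  rewrite -/a in h2.
  have h3 := ler_wpM2r r0 (p_le w false n0).
  apply: (le_trans (lerD h1 h2)); rewrite exprS -(natr1 r).
  move: h3; set e := rho ^+ r; set P := p 0 w false; move=> h3.
  have -> : M * (r%:R + 1) * (P * a) + M * (rho * e) =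
    M * P * a + P * (M * r%:R * a) + rho * (M * e) by ring.
  by rewrite mulrDr; lra.
have x2 := dbl_r h; rewrite (hd_right w h) (H_right w n0 h).
set a := H 0 (rcons w true) _.
have /andP[a0 a1] : 0 <= a <= 1 by exact: H_itv.
apply: (le_trans (ler_normD _ _)); apply: (le_trans (lerD (dp_le w false) (ler_normD _ _))).
rewrite !normrM (ger0_norm a0) (ger0_norm (p_ge0 w true n0)).
have h1 := ler_wpM2r a0 (dp_le w true).
have h2 := ler_wpM2l (p_ge0 w true n0) (IH (rcons w true) _ x2).
rewrite -/a in h2.
have h3 := ler_wpM2r r0 (p_le w true n0).
have h4 : 0 <= M * r%:R * p 0 w false by rewrite mulr_ge0 ?p_ge0 // mulr_ge0.
apply: (le_trans (lerD (lexx _) (lerD h1 h2))); rewrite exprS -(natr1 r).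
move: h3 h4; set e := rho ^+ r; set P := p 0 w true; set P' := p 0 w false; move=> h3 h4.
have -> : M * (r%:R + 1) * (P' + P * a) + M * (rho * e) =
  M * P' + (M * P * a + P * (M * r%:R * a)) + M * r%:R * P' + rho * (M * e) by ring.
rewrite mulrDr; lra.
Qed.

Lemma hd_mod_right w (u : R) r : 0 <= u <= 1 ->
  `|hd w u| <= M * r%:R * (1 - H 0 w u) + M * rho ^+ r.
Proof.
elim: r w u => [|r IH] w u u01; first by rewrite mulr0 mul0r add0r expr0 mulr1 hd_le.
have r0 : 0 <= M * rho ^+ r by rewrite mulr_ge0 ?exprn_ge0 ?M_ge0 //.
have ps := p_sum w n0; have ds := dp_sum w.
have [h|h] := half_cases u01; last first.
  have x2 := dbl_r h; rewrite (hd_right w h) (H_right w n0 h).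
  set a := H 0 (rcons w true) _.
  have /andP[a0 a1] : 0 <= a <= 1 by exact: H_itv.
  have a2 : 0 <= 1 - a by rewrite subr_ge0.
  have -> : dp w false + (dp w true * a + p 0 w true * hd (rcons w true) (2 * u - 1)) =
    - (dp w true * (1 - a)) + p 0 w true * hd (rcons w true) (2 * u - 1).
    by rewrite (_ : dp w false = - dp w true); [ring|lra].
  apply: (le_trans (ler_normD _ _)); rewrite normrN !normrM (ger0_norm a2) (ger0_norm (p_ge0 w true n0)).
  have h1 := ler_wpM2r a2 (dp_le w true).
  have h2 := ler_wpM2l (p_ge0 w true n0) (IH (rcons w true) _ x2).
  rewrite -/a in h2.
  have h3 := ler_wpM2r r0 (p_le w true n0).
  apply: (le_trans (lerD h1 h2)); rewrite exprS -(natr1 r).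
  rewrite (_ : p 0 w false = 1 - p 0 w true); last by lra.
  move: h3; set e := rho ^+ r; set P := p 0 w true; move=> h3.
  have -> : M * (r%:R + 1) * (1 - (1 - P + P * a)) + M * (rho * e) =
    M * P * (1 - a) + P * (M * r%:R * (1 - a)) + rho * (M * e) by ring.
  by rewrite mulrDr; lra.
have x2 := dbl_l h; rewrite (hd_left w h) (H_left w n0 h).
set a := H 0 (rcons w false) _.
have /andP[a0 a1] : 0 <= a <= 1 by exact: H_itv.
have a2 : 0 <= 1 - a by rewrite subr_ge0.
have -> : dp w false * a + p 0 w false * hd (rcons w false) (2 * u) =
    - (dp w true + dp w false * (1 - a)) + p 0 w false * hd (rcons w false) (2 * u).
  by rewrite (_ : dp w true = - dp w false); [ring|lra].
apply: (le_trans (ler_normD _ _)); rewrite normrN.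
apply: (le_trans (lerD (ler_normD _ _) (lexx _))).
rewrite !normrM (ger0_norm a2) (ger0_norm (p_ge0 w false n0)).
have h1 := ler_wpM2r a2 (dp_le w false).
have h2 := ler_wpM2l (p_ge0 w false n0) (IH (rcons w false) _ x2).
rewrite -/a in h2.
have h3 := ler_wpM2r r0 (p_le w false n0).
have h4 : 0 <= M * r%:R * p 0 w true by rewrite mulr_ge0 ?p_ge0 // mulr_ge0.
apply: (le_trans (lerD (lerD (dp_le w true) h1) h2)); rewrite exprS -(natr1 r).
move: h4; rewrite (_ : p 0 w true = 1 - p 0 w false); last by lra.
move: h3; set e := rho ^+ r; set P := p 0 w false; move=> h3 h4.
have -> : M * (r%:R + 1) * (1 - P * a) + M * (rho * e) =
  M * (1 - P) + M * P * (1 - a) + P * (M * r%:R * (1 - a)) + M * r%:R * (1 - P) + rho * (M * e) by ring.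
rewrite mulrDr; lra.
Qed.

(* The derivative is almost Lipschitz in terms of the distribution function,
   with a loss that is logarithmic in the mass: take [rho ^+ r] of the order of
   [H 0 w v - H 0 w u]. *)
Lemma hd_mod w (u v : R) r : 0 <= u -> u <= v -> v <= 1 ->
  `|hd w v - hd w u| <= M * r%:R * (H 0 w v - H 0 w u) + 4 * M * rho ^+ r.
Proof.
elim: r w u v => [|r IH] w u v u0 uv v1.
  rewrite mulr0 mul0r add0r expr0 mulr1; apply: (le_trans (ler_normB _ _)).
  have h1 : `|hd w v| <= M by apply: hd_le; rewrite v1 (le_trans u0).
  have h2 : `|hd w u| <= M by apply: hd_le; rewrite u0 (le_trans uv).
  by have := M_gt0; lra.
have r0 : 0 <= M * rho ^+ r by rewrite mulr_ge0 ?exprn_ge0 ?M_ge0 //.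
have ps := p_sum w n0; have ds := dp_sum w.
have key i (a b ha hb : R) : a <= b -> `|hb - ha| <= M * r%:R * (b - a) + 4 * M * rho ^+ r ->
    `|dp w i * (b - a) + p 0 w i * (hb - ha)| <=
    M * r.+1%:R * (p 0 w i * (b - a)) + 4 * M * rho ^+ r.+1.
  rewrite -subr_ge0 => ab h.
  apply: (le_trans (ler_normD _ _)); rewrite !normrM (ger0_norm ab) (ger0_norm (p_ge0 w i n0)).
  have h1 := ler_wpM2r ab (dp_le w i).
  have h2 := ler_wpM2l (p_ge0 w i n0) h.
  have h3 := ler_wpM2r r0 (p_le w i n0).
  apply: (le_trans (lerD h1 h2)); rewrite exprS -(natr1 r).
  move: h3; set e := rho ^+ r; set P := p 0 w i; set c := b - a; move=> h3.
  have -> : M * (r%:R + 1) * (P * c) + 4 * M * (rho * e) =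
    M * P * c + P * (M * r%:R * c) + 4 * (rho * (M * e)) by ring.
  by rewrite mulrDr; lra.
have [uh|uh] := lerP u 2^-1; have [vh|vh] := lerP v 2^-1.
- have u2 : 0 <= u <= 2^-1 by rewrite u0.
  have v2 : 0 <= v <= 2^-1 by rewrite vh (le_trans u0).
  rewrite (hd_left w u2) (hd_left w v2) (H_left w n0 u2) (H_left w n0 v2).
  have h1 : H 0 (rcons w false) (2 * u) <= H 0 (rcons w false) (2 * v) by apply: H_mono; lra.
  have h2 := IH (rcons w false) (2 * u) (2 * v) ltac:(lra) ltac:(lra) ltac:(lra).
  have := key false _ _ _ _ h1 h2.
  have -> : p 0 w false * H 0 (rcons w false) (2 * v) - p 0 w false * H 0 (rcons w false) (2 * u) =
    p 0 w false * (H 0 (rcons w false) (2 * v) - H 0 (rcons w false) (2 * u)) by ring.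
  by congr (`|_| <= _); ring.
- have u2 : 0 <= u <= 2^-1 by rewrite u0.
  have v2 : 2^-1 <= v <= 1 by rewrite v1 ltW.
  rewrite (hd_left w u2) (hd_right w v2) (H_left w n0 u2) (H_right w n0 v2).
  (* The pair straddles the midpoint. The errors of the two halves carry weights of sum 1, and
     [2^-1 <= rho] turns the resulting [rho ^+ r] into a multiple of [rho ^+ r.+1]. *)
  have hu := hd_mod_right (rcons w false) r (dbl_l u2).
  have hv := hd_mod_left (rcons w true) r (dbl_r v2).
  set a := H 0 (rcons w false) (2 * u) in hu *; set b := H 0 (rcons w true) (2 * v - 1) in hv *.
  set ha := hd (rcons w false) (2 * u) in hu *; set hb := hd (rcons w true) (2 * v - 1) in hv *.
  have /andP[a0 a1] : 0 <= a <= 1 by apply: H_itv => //; exact: dbl_l.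
  have /andP[b0 b1] : 0 <= b <= 1 by apply: H_itv => //; exact: dbl_r.
  have a2 : 0 <= 1 - a by rewrite subr_ge0.
  have -> : dp w false + (dp w true * b + p 0 w true * hb) - (dp w false * a + p 0 w false * ha) =
    dp w false * (1 - a) + dp w true * b + (p 0 w true * hb - p 0 w false * ha) by ring.
  apply: (le_trans (ler_normD _ _)).
  apply: (le_trans (lerD (ler_normD _ _) (ler_normB _ _))).
  rewrite !normrM (ger0_norm a2) (ger0_norm b0) !(ger0_norm (p_ge0 w _ n0)).
  have h1 := ler_wpM2r a2 (dp_le w false).
  have h2 := ler_wpM2r b0 (dp_le w true).
  have h3 := ler_wpM2l (p_ge0 w false n0) hu.
  have h4 := ler_wpM2l (p_ge0 w true n0) hv.
  apply: (le_trans (lerD (lerD h1 h2) (lerD h4 h3))); rewrite exprS -(natr1 r).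
  have h5 := ler_wpM2r r0 rho_ge.
  move: h5 r0; rewrite (_ : p 0 w true = 1 - p 0 w false); last by lra.
  set e := rho ^+ r; set P := p 0 w false; move=> h5 r0.
  have -> : M * (r%:R + 1) * (P + (1 - P) * b - P * a) + 4 * M * (rho * e) =
    M * P * (1 - a) + M * (1 - P) * b + ((1 - P) * (M * r%:R * b) + P * (M * r%:R * (1 - a)))
     + 4 * (rho * (M * e)) by ring.
  rewrite !mulrDr; lra.
- by exfalso; lra.
- have u2 : 2^-1 <= u <= 1 by rewrite (ltW uh) (le_trans uv).
  have v2 : 2^-1 <= v <= 1 by rewrite (ltW vh).
  rewrite (hd_right w u2) (hd_right w v2) (H_right w n0 u2) (H_right w n0 v2).
  have h1 : H 0 (rcons w true) (2 * u - 1) <= H 0 (rcons w true) (2 * v - 1).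
    by apply: H_mono; lra.
  have h2 := IH (rcons w true) (2 * u - 1) (2 * v - 1) ltac:(lra) ltac:(lra) ltac:(lra).
  have := key true _ _ _ _ h1 h2.
  have -> : p 0 w false + p 0 w true * H 0 (rcons w true) (2 * v - 1) -
   (p 0 w false + p 0 w true * H 0 (rcons w true) (2 * u - 1)) =
    p 0 w true * (H 0 (rcons w true) (2 * v - 1) - H 0 (rcons w true) (2 * u - 1)) by ring.
  by congr (`|_| <= _); ring.
Qed.

Fixpoint cond_mass w v : R :=
  if v is i :: v' then p 0 w i * cond_mass (rcons w i) v' else 1.

(* The derivative at [t = 0] of the logarithm of the mass of [v] within [w]. *)
Fixpoint score w v : R :=
  if v is i :: v' then dp w i / p 0 w i + score (rcons w i) v' else 0.

Lemma cond_mass_ge w v : pm ^+ size v <= cond_mass w v.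
Proof.
elim: v w => //= i v IH w; rewrite exprS; apply: ler_pM => //.
- exact: ltW.
- by rewrite exprn_ge0 // ltW.
- exact: p_ge.
Qed.

Lemma cond_mass_gt0 w v : 0 < cond_mass w v.
Proof. by apply: lt_le_trans (cond_mass_ge w v); rewrite exprn_gt0. Qed.

Lemma score_cat w u v : score w (u ++ v) = score w u + score (w ++ u) v.
Proof.
elim: u w => [|i u IH] w /=; first by rewrite cats0 add0r.
by rewrite IH cat_rcons addrA.
Qed.

Lemma dp_div_le w i : `|dp w i / p 0 w i| <= M.
Proof.
have p0 : 0 < p 0 w i by apply: lt_le_trans (p_ge w i n0).
by rewrite normrM normfV (gtr0_norm p0) ler_pdivrMr //; exact: dp_le.
Qed.

Lemma score_le w v : `|score w v| <= M * (size v)%:R.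
Proof.
elim: v w => [|i v IH] w /=; first by rewrite normr0 mulr0.
apply: (le_trans (ler_normD _ _)); rewrite -natr1 mulrDr mulr1 addrC.
by apply: lerD; [exact: IH|exact: dp_div_le].
Qed.

(** Self-similarity: an increment inside a cell is the mass of the cell times a conditional
    increment. The second identity is the product rule, the derivative of the mass being the mass
    times the score. *)
Lemma cell n w (x z : R) : 0 < x <= 1 -> 0 <= z <= 1 ->
  let v := word n x in let u := iter n shift x in
  H 0 w (rescale n x z) - H 0 w x = cond_mass w v * (H 0 (w ++ v) z - H 0 (w ++ v) u) /\
  hd w (rescale n x z) - hd w x = cond_mass w v *
    ((hd (w ++ v) z - hd (w ++ v) u) + score w v * (H 0 (w ++ v) z - H 0 (w ++ v) u)).
Proof.
move=> + z01; elim: n w x => [|n IH] w x x01.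
  have -> : rescale 0 x z = z by rewrite /rescale expr0 /=; ring.
  by rewrite /= cats0 !mul1r mul0r addr0.
have s01 := shift_itv x01; have r01 := rescale_itv n s01 z01.
rewrite iterSr rescale_S /=; set b := digit x.
have [IH1 IH2] := IH (rcons w b) _ s01.
move: IH1 IH2; rewrite cat_rcons; set v := word n _; set u := iter n _ _.
set y := rescale n _ z in r01 *; set A := H 0 (w ++ b :: v) z - _; set A' := hd (w ++ b :: v) z - _.
set q := cond_mass _ v; set S := score _ v => IH1 IH2.
have pb0 : p 0 w b != 0 by rewrite gt_eqF //; apply: lt_le_trans (p_ge w b n0).
suff [-> ->] : H 0 w ((b%:R + y) / 2) - H 0 w x = p 0 w b * (H 0 (rcons w b) y - H 0 (rcons w b) (shift x)) /\
    hd w ((b%:R + y) / 2) - hd w x = dp w b * (H 0 (rcons w b) y - H 0 (rcons w b) (shift x)) +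
      p 0 w b * (hd (rcons w b) y - hd (rcons w b) (shift x)).
  by rewrite IH1 IH2; split; [ring|field].
have /andP[x0 x1] := x01; have /andP[y0 y1] := r01.
rewrite /b /shift /digit; case: ltP => h.
  have e1 : 2^-1 <= (true%:R + y) / 2 <= 1 by apply/andP; split; rewrite /=; lra.
  have e2 : 2^-1 <= x <= 1 by rewrite x1 ltW.
  have e3 : 2 * ((true%:R + y) / 2) - 1 = y by rewrite /=; field.
  rewrite (H_right w n0 e1) (H_right w n0 e2) (hd_right w e1) (hd_right w e2) e3.
  by split; ring.
have e1 : 0 <= (false%:R + y) / 2 <= 2^-1 by apply/andP; split; rewrite /=; lra.
have e2 : 0 <= x <= 2^-1 by rewrite h ltW.
have e3 : 2 * ((false%:R + y) / 2) = y by rewrite /=; field.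
rewrite (H_left w n0 e1) (H_left w n0 e2) (hd_left w e1) (hd_left w e2) e3.
by split; ring.
Qed.

(** A false digit puts [u] in the left half of its cell of length [j], while [z] lies beyond the
    right end of that cell. The interval between them contains the whole right half, which has mass
    at least [pm ^+ j.+1]. *)
Lemma gap_right w (u z : R) j : 0 < u <= 1 -> digit (iter j shift u) = false ->
  u + 2^-1 ^+ j <= z -> z <= 1 -> pm ^+ j.+1 <= H 0 w z - H 0 w u.
Proof.
move=> u01 dj uz z1; have [C _] := cell j w u01 (z := 1) ltac:(rewrite ler01 lexx //).
move: C; set T := iter j shift u in dj *.
have T01 : 0 < T <= 1 by exact: iter_shift_itv.
have /andP[T0 T1] := T01.
have Th : T <= 2^-1 by move: dj; rewrite /digit; case: ltP.
have e0 : 0 <= 2^-1 ^+ j :> R by rewrite exprn_ge0 //; lra.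
have rz : rescale j u 1 <= z.
  rewrite /rescale -/T; apply: le_trans uz; rewrite lerD2l ler_piMr //; lra.
have r0 : 0 <= rescale j u 1 by case/andP: (rescale_itv j u01 (z := 1) ltac:(rewrite ler01 lexx //)).
have mono := H_mono w r0 rz z1.
set V := w ++ _; rewrite H_1 // => C.
have HT : H 0 V T <= rho.
  have t2 : 0 <= T <= 2^-1 by rewrite Th ltW.
  rewrite (H_left V n0 t2); apply: le_trans (p_le V false n0).
  by rewrite ler_piMr ?p_ge0 //; case/andP: (H_itv (rcons V false) n0 (dbl_l t2)).
apply: (@le_trans _ _ (cond_mass w (word j u) * (1 - H 0 V T))); last by rewrite -C lerD2r.
rewrite exprSr; apply: ler_pM.
- by rewrite exprn_ge0 // ltW.
- exact: ltW.
- by rewrite -{1}(size_word j u); exact: cond_mass_ge.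
- by move: HT; rewrite /rho; lra.
Qed.

Lemma gap_left w (u z : R) j : 0 < u <= 1 -> digit (iter j shift u) = true ->
  z <= u - 2^-1 ^+ j -> 0 <= z -> pm ^+ j.+1 <= H 0 w u - H 0 w z.
Proof.
move=> u01 dj uz z0; have [C _] := cell j w u01 (z := 0) ltac:(rewrite ler01 lexx //).
move: C; set T := iter j shift u in dj *.
have T01 : 0 < T <= 1 by exact: iter_shift_itv.
have /andP[T0 T1] := T01.
have Th : 2^-1 < T by move: dj; rewrite /digit; case: ltP.
have e0 : 0 <= 2^-1 ^+ j :> R by rewrite exprn_ge0 //; lra.
have rz : z <= rescale j u 0.
  rewrite /rescale -/T; apply: (le_trans uz); rewrite lerD2l sub0r mulrN lerN2 ler_piMr //; lra.
have r1 : rescale j u 0 <= 1 by case/andP: (rescale_itv j u01 (z := 0) ltac:(rewrite ler01 lexx //)).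
have mono := H_mono w z0 rz r1.
set V := w ++ _; rewrite H_0 // => C.
have HT : pm <= H 0 V T.
  have t2 : 2^-1 <= T <= 1 by rewrite T1 ltW.
  rewrite (H_right V n0 t2); apply: (le_trans (p_ge V false n0)).
  by rewrite lerDl mulr_ge0 ?p_ge0 //; case/andP: (H_itv (rcons V true) n0 (dbl_r t2)).
apply: (@le_trans _ _ (cond_mass w (word j u) * H 0 V T)); last by move: C; rewrite sub0r mulrN; lra.
rewrite exprSr; apply: ler_pM => //.
- by rewrite exprn_ge0 // ltW.
- exact: ltW.
- by rewrite -{1}(size_word j u); exact: cond_mass_ge.
Qed.

Lemma hd_ratio w (a b : R) r : 0 <= a -> a <= b -> b <= 1 -> rho ^+ r <= H 0 w b - H 0 w a ->
  `|hd w b - hd w a| <= M * (r%:R + 4) * (H 0 w b - H 0 w a).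
Proof.
move=> a0 ab b1 hr; apply: (le_trans (hd_mod w r a0 ab b1)).
have h4 : 0 <= 4 * M by rewrite mulr_ge0.
have gen (k n d e : R) : 4 * k * e <= 4 * k * d -> k * n * d + 4 * k * e <= k * (n + 4) * d.
  by move=> ?; lra.
exact: gen (ler_wpM2l h4 hr).
Qed.

(** [run1] keeps [x + h] in the cell of length [m], where [cell] splits off the score of that cell
    exactly. [run2] yields, within [l] further digits, one suited to the sign of [h], so that the
    gap lemmas bound the increment below by [pm ^+ (l + l).+1]. What is left is a quotient of order
    [s * l] from [hd_ratio] and the score of [l] digits. *)
Lemma score_compare (x h : R) (m l s : nat) :
  0 < x <= 1 ->
  (forall b, ~~ all (pred1 b) (word l (iter m shift x))) ->
  (forall b, ~~ all (pred1 b) (word l (iter (m + l).+1 shift x))) ->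
  rho ^+ s <= pm ->
  2^-1 ^+ (m + l).+1 < `|h| -> `|h| <= 2^-1 ^+ (m + l) ->
  [/\ 0 <= x + h <= 1, H 0 [::] (x + h) - H 0 [::] x != 0 &
   `|(hd [::] (x + h) - hd [::] x) / (H 0 [::] (x + h) - H 0 [::] x) -
      score [::] (word (m + l) x)| <= M * (3 * s%:R + 5) * l%:R].
Proof.
move=> x01 run1 run2 sp hlo hhi.
(* For [l = 0] the word is empty and [run1] is contradictory. *)
have l1 : 1 <= l%:R :> R by rewrite ler1n; case: (l) (run1 true).
set u := iter m shift x in run1.
have u01 : 0 < u <= 1 by exact: iter_shift_itv.
have /andP[u0 u1] := u01.
pose z := u + 2 ^+ m * h.
have p2 k : 0 < 2 ^+ k :> R by rewrite exprn_gt0.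
have pe k : 2 ^+ k * 2^-1 ^+ k = 1 :> R by rewrite -exprMn divff // expr1n.
have zh : `|2 ^+ m * h| <= 2^-1 ^+ l.
  rewrite normrM (gtr0_norm (p2 m)); apply: (le_trans (ler_wpM2l (ltW (p2 m)) hhi)).
  by rewrite exprD mulrA pe mul1r.
have zl : 2^-1 ^+ l.+1 < `|2 ^+ m * h|.
  rewrite normrM (gtr0_norm (p2 m)).
  by move: hlo; rewrite -(ltr_pM2l (p2 m)) -addnS exprD mulrA pe mul1r.
have xh : x + h = rescale m x z.
  by rewrite /rescale -/u /z (addrC u) addrK mulrA [_ ^+ m * _ ^+ m]mulrC pe mul1r.
have z01 : 0 <= z <= 1.
  have h1 := word_not_true u01 (run1 true); have h2 := word_not_false u01 (run1 false).
  by move: zh; rewrite ler_norml /z => /andP[? ?]; apply/andP; split; lra.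
have /andP[z0 z1] := z01.
have it k : iter k shift (iter (m + l).+1 shift x) = iter (l.+1 + k) shift u.
  rewrite /u -!iterD; congr (iter _ _ _).
  by clear; lia.
have pmk k : (k < l)%N -> rho ^+ (s * (l + l).+1) <= pm ^+ (l.+1 + k).+1.
  move=> kl; apply: (@le_trans _ _ (pm ^+ (l + l).+1)).
    by rewrite exprM; apply: lerXn2r; rewrite ?nnegrE ?exprn_ge0 // ltW.
  apply: ler_wiXn2l; [exact: ltW|by have := rho_ge0; rewrite /rho; lra|by move: kl; clear; lia].
set V := word m x.
have ratio : `|hd V z - hd V u| <= M * ((s * (l + l).+1)%:R + 4) * `|H 0 V z - H 0 V u| /\
    H 0 V z - H 0 V u != 0.
  have [hp|hn] := lerP 0 h.
    have hp0 : 0 <= 2 ^+ m * h by rewrite mulr_ge0 // ltW.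
    rewrite (ger0_norm hp0) in zl zh.
    have [k kl dk] := word_not_all (run2 true).
    rewrite it in dk.
    have g := @gap_right V u z (l.+1 + k) u01 _ _ z1.
    have {}g : pm ^+ (l.+1 + k).+1 <= H 0 V z - H 0 V u.
      apply: g; first by case: (digit _) dk.
      rewrite /z lerD2l; apply: le_trans (ltW zl).
      by apply: ler_wiXn2l; [lra|lra|rewrite leq_addr].
    have uz : u <= z by rewrite /z lerDl.
    have g0 : 0 < H 0 V z - H 0 V u by apply: lt_le_trans g; rewrite exprn_gt0.
    rewrite (gtr0_norm g0); split; last by rewrite gt_eqF.
    by apply: hd_ratio (ltW u0) uz z1 _; apply: le_trans g; exact: pmk.
  have hp0 : 2 ^+ m * h < 0 by rewrite pmulr_rlt0.
  rewrite (ltr0_norm hp0) in zl zh.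
  have [k kl dk] := word_not_all (run2 false).
  rewrite it in dk.
  have g := @gap_left V u z (l.+1 + k) u01 _ _ z0.
  have {}g : pm ^+ (l.+1 + k).+1 <= H 0 V u - H 0 V z.
    apply: g; first by case: (digit _) dk.
    have : 2^-1 ^+ (l.+1 + k) <= 2^-1 ^+ l.+1 :> R.
      by apply: ler_wiXn2l; [lra|lra|rewrite leq_addr].
    by rewrite /z; lra.
  have uz : z <= u by rewrite /z gerDl ltW.
  have g0 : 0 < H 0 V u - H 0 V z by apply: lt_le_trans g; rewrite exprn_gt0.
  rewrite (distrC (hd V z)) (distrC (H 0 V z)) (gtr0_norm g0); split.
    by apply: hd_ratio z0 uz u1 _; apply: le_trans g; exact: pmk.
  by rewrite -oppr_eq0 opprB gt_eqF.
case: ratio => ratio ne.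
have [C1 C2] := cell m [::] x01 z01; rewrite /= -/V -/u in C1 C2.
rewrite xh C1 C2; set q := cond_mass _ _.
have q0 : q != 0 by rewrite gt_eqF // cond_mass_gt0.
split; first exact: rescale_itv.
  by rewrite mulf_neq0.
rewrite word_add score_cat /= -/V -/u.
have -> : q * (hd V z - hd V u + score [::] V * (H 0 V z - H 0 V u)) / (q * (H 0 V z - H 0 V u)) -
    (score [::] V + score V (word l u)) = (hd V z - hd V u) / (H 0 V z - H 0 V u) - score V (word l u).
  by field; rewrite ne q0.
apply: (le_trans (ler_normB _ _)).
have h1 : `|(hd V z - hd V u) / (H 0 V z - H 0 V u)| <= M * ((s * (l + l).+1)%:R + 4).
  by rewrite normrM normfV ler_pdivrMr // normr_gt0.
have h2 : `|score V (word l u)| <= M * l%:R by have := score_le V (word l u); rewrite size_word.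
apply: (le_trans (lerD h1 h2)); rewrite -mulrDr -mulrA ler_wpM2l //.
rewrite natrM -natr1 natrD; set a := l%:R in l1 *; have : 0 <= s%:R :> R by [].
by set b := s%:R => b0; nra.
Qed.

Lemma cond_mass_cdf w v :
  H 0 w (left_end v + 2^-1 ^+ size v) - H 0 w (left_end v) = cond_mass w v.
Proof.
elim: v w => [|i v IH] w /=; first by rewrite expr0 add0r H_1 // H_0 // subr0.
have [l0 l1] := left_end_itv v (R := R).
have p0 : 0 < 2^-1 ^+ size v :> R by rewrite exprn_gt0.
rewrite -IH exprS; set e := 2^-1 ^+ _ in l1 p0 *; set l := left_end v in l0 l1 *.
case: i => /=.
  have h1 : 2^-1 <= (1 + l) / 2 + 2^-1 * e <= 1 by apply/andP; split; lra.
  have h2 : 2^-1 <= (1 + l) / 2 <= 1 by apply/andP; split; lra.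
  have e1 : 2 * ((1 + l) / 2 + 2^-1 * e) - 1 = l + e by field.
  have e2 : 2 * ((1 + l) / 2) - 1 = l by field.
  by rewrite (H_right w n0 h1) (H_right w n0 h2) e1 e2; ring.
have h1 : 0 <= (0 + l) / 2 + 2^-1 * e <= 2^-1 by apply/andP; split; lra.
have h2 : 0 <= (0 + l) / 2 <= 2^-1 by apply/andP; split; lra.
have e1 : 2 * ((0 + l) / 2 + 2^-1 * e) = l + e by field.
have e2 : 2 * ((0 + l) / 2) = l by field.
by rewrite (H_left w n0 h1) (H_left w n0 h2) e1 e2; ring.
Qed.

Lemma cond_mass_rcons w v i : cond_mass w (rcons v i) = cond_mass w v * p 0 (w ++ v) i.
Proof.
elim: v w => [|j v IH] w /=; first by rewrite cats0 mulr1 mul1r.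
by rewrite IH cat_rcons mulrA.
Qed.

Lemma score_rcons w i : score [::] (rcons w i) - score [::] w = dp w i / p 0 w i.
Proof. by rewrite -cats1 score_cat /= addr0 addrAC subrr add0r. Qed.

Variable mu : probability (measurableTypeR R) R.
Hypothesis mu_cell : forall w,
  mu [set x : R | 0 < x <= 1 /\ word (size w) x = w] = (cond_mass [::] w)%:E.
Variable kap : R.
Hypothesis kap_gt0 : 0 < kap.
Hypothesis dp_ge : forall w, kap <= `|dp w false|.

Let p_gt0 w i : 0 < p 0 w i. Proof. exact: lt_le_trans (p_ge w i n0). Qed.

Let p_neq0 w i : p 0 w i != 0. Proof. by rewrite gt_eqF. Qed.

Lemma score_mart w :
  p 0 w false * (score [::] (rcons w false) - score [::] w) +
  p 0 w true * (score [::] (rcons w true) - score [::] w) = 0.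
Proof. by rewrite !score_rcons ![p 0 w _ * _]mulrC !divfK ?p_neq0 // dp_sum. Qed.

Lemma score_var w : kap ^+ 2 <=
  p 0 w false * (score [::] (rcons w false) - score [::] w) ^+ 2 +
  p 0 w true * (score [::] (rcons w true) - score [::] w) ^+ 2.
Proof.
rewrite !score_rcons.
apply: (@le_trans _ _ (p 0 w false * (dp w false / p 0 w false) ^+ 2)); last first.
  by rewrite lerDl mulr_ge0 ?sqr_ge0 // p_ge0.
have -> : p 0 w false * (dp w false / p 0 w false) ^+ 2 = dp w false ^+ 2 / p 0 w false.
  by field; rewrite p_neq0.
rewrite ler_pdivlMr ?p_gt0 //; apply: (@le_trans _ _ (kap ^+ 2)).
  rewrite ler_piMr ?sqr_ge0 //; apply: le_trans (p_le w false n0) (ltW rho_lt1).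
by rewrite -(real_normK (num_real (dp w false))) lerXn2r ?nnegrE // ltW.
Qed.

Lemma kap_le : kap ^+ 2 <= M ^+ 2.
Proof.
apply: lerXn2r; rewrite ?nnegrE ?(ltW kap_gt0) //.
apply: (le_trans (dp_ge [::])); apply: (le_trans (dp_le [::] false)).
by rewrite ler_piMr //; apply: le_trans (p_le [::] false n0) (ltW rho_lt1).
Qed.

Definition hd_quot (x h : R) : R :=
  (hd [::] (x + h) - hd [::] x) / (H 0 [::] (x + h) - H 0 [::] x).

(* Near a typical point the runs of equal digits are logarithmically short, so
   the difference quotient and the score differ by [o (psi n)]. *)
Lemma hd_quot_score (e : R) : 0 < e -> {ae mu, forall x : R, 0 < x <= 1 ->
  exists N, forall n h, (N <= n)%N -> 2^-1 ^+ n.+1 < `|h| -> `|h| <= 2^-1 ^+ n ->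
   0 <= x + h <= 1 /\ `|hd_quot x h - score [::] (word n x)| <= e * psi n}.
Proof.
move=> e0.
have [a Ha] := runs_ae (fun w i => p_ge0 w i n0) (fun w => p_sum w n0) (q := cond_mass [::]) erefl
  (cond_mass_rcons [::]) mu_cell (fun w i => p_le w i n0) rho_lt1.
have [s sp] : exists s, rho ^+ s < pm by apply: exists_expr_lt => //; rewrite rho_ge0 rho_lt1.
apply: ae_imp Ha => x Hx x01; have [N0 HN0] := Hx x01.
pose K := M * (3 * s%:R + 5).
have K0 : 0 <= K by rewrite mulr_ge0 // addr_ge0 // mulr_ge0.
have [N HN] := run_len_psi a N0 K0 e0.
exists N => n h nN hlo hhi; have [l1 l2] := HN n nN.
set l := run_len a n.+1 in l1 l2.
pose m := (n - l)%N.
have ml : (m + l = n)%N by rewrite subnK // (leq_trans _ l1) // leq_addr.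
have mN : (N0 <= m)%N by move: l1; rewrite /m; clear; lia.
have r1 : forall b, ~~ all (pred1 b) (word l (iter m shift x)).
  by apply: HN0 => //; apply: run_len_mono; rewrite -ml; clear; lia.
have r2 : forall b, ~~ all (pred1 b) (word l (iter (m + l).+1 shift x)).
  by rewrite ml; apply: HN0 => //; move: mN; rewrite -ml; clear; lia.
rewrite -ml in hlo hhi.
have [xh _ B] := score_compare x01 r1 r2 (ltW sp) hlo hhi.
split => //; rewrite ml in B; exact: le_trans B l2.
Qed.

Lemma hd_quot_lil : exists c C : R, [/\ 0 < c, c <= C &
  {ae mu, forall x : R, 0 < x <= 1 ->
    [/\ exists2 d, 0 < d & forall h, h != 0 -> `|h| < d ->
         0 <= x + h <= 1 /\ `|hd_quot x h / lil_scale h| <= C,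
       forall d, 0 < d -> exists h, [/\ h != 0, `|h| < d & c <= hd_quot x h / lil_scale h]
     & forall d, 0 < d -> exists h, [/\ h != 0, `|h| < d & hd_quot x h / lil_scale h <= - c]]}].
Proof.
have pg w i := p_ge0 w i n0; have ps w := p_sum w n0.
have bnd w i : `|score [::] (rcons w i) - score [::] w| <= M.
  by rewrite score_rcons; exact: dp_div_le.
have k2 : 0 < kap ^+ 2 by rewrite exprn_gt0.
have U := lil_upper pg ps (q := cond_mass [::]) erefl (cond_mass_rcons [::]) mu_cell M_gt0
  (D := score [::]) erefl score_mart bnd.
have [c1 [c10 L1]] := lil_lower pg ps (q := cond_mass [::]) erefl (cond_mass_rcons [::]) mu_cell M_gt0
  k2 kap_le (D := score [::]) erefl score_mart bnd score_var.
have [c2 [c20 L2]] : exists c : R, 0 < c /\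
  {ae mu, forall x : R, 0 < x <= 1 -> forall n0, exists2 n, (n0 <= n)%N &
    c * psi n <= - score [::] (word n x)}.
  apply: (lil_lower pg ps (q := cond_mass [::]) erefl (cond_mass_rcons [::]) mu_cell M_gt0
    k2 kap_le (D := fun w => - score [::] w)).
  - by rewrite /= oppr0.
  - by move=> w; rewrite -!opprD !mulrN -opprD score_mart oppr0.
  - by move=> w i; rewrite -opprD normrN.
  - by move=> w; rewrite -!opprD !sqrrN; exact: score_var.
pose c := Num.min c1 c2.
have c0 : 0 < c by rewrite lt_min c10.
have [cc1 cc2] : c <= c1 /\ c <= c2 by rewrite /c !ge_min !lexx orbT.
set Cu := 2 * (2 * M ^+ 2 + 2) in U.
have Cu0 : 0 <= Cu by rewrite mulr_ge0 // addr_ge0 // mulr_ge0 // sqr_ge0.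
have ch : 0 < c / 2 by rewrite divr_gt0.
exists (c / 2), (Cu + c / 2); split => //; first by rewrite lerDr.
apply: ae_imp (ae_and (ae_and U (hd_quot_score ch)) (ae_and L1 L2)).
move=> x [[Ux Ex] [L1x L2x]] x01.
have [N1 {}Ux] := Ux x01; have [N2 {}Ex] := Ex x01.
have half n : [/\ 2^-1 ^+ n != 0 :> R, 2^-1 ^+ n.+1 < `|2^-1 ^+ n : R| & `|2^-1 ^+ n : R| <= 2^-1 ^+ n].
  have h0 : 0 < 2^-1 ^+ n :> R by rewrite exprn_gt0.
  rewrite gt_eqF // (gtr0_norm h0); split => //.
  by rewrite exprS gtr_pMl //; lra.
have psi0 n : (2 ^ 8 <= n)%N -> 0 < psi n :> R.
  move=> hn; apply: lt_le_trans (sqrt_le_psi hn); rewrite sqrtr_gt0 ltr0n.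
  exact: leq_trans hn.
have small (d : R) : 0 < d -> exists N, forall n, (N <= n)%N -> `|2^-1 ^+ n : R| < d.
  move=> d0; have [N hN] : exists N, 2^-1 ^+ N < d by apply: exists_expr_lt => //; apply/andP; split; lra.
  exists N => n Nn; have h0 : 0 <= 2^-1 ^+ n :> R by rewrite exprn_ge0 //; lra.
  by rewrite ger0_norm //; apply: le_lt_trans hN; apply: ler_wiXn2l => //; lra.
split.
- pose N := maxn (2 ^ 8) (maxn N1 N2).
  exists (2^-1 ^+ N); first by rewrite exprn_gt0.
  move=> h h0 hN; have [n [nN hlo hhi nL]] := dyadic_scale h0 hN.
  move: nN; rewrite !geq_max => /andP[n8 /andP[nN1 nN2]].
  have [xh E] := Ex n h nN2 hlo hhi; split => //.
  have P := psi_le_scale n8 nL; have P0 := psi0 n n8.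
  have s0 : 0 < lil_scale h by apply: lt_le_trans P.
  rewrite normrM normfV (gtr0_norm s0) ler_pdivrMr //.
  apply: (@le_trans _ _ ((Cu + c / 2) * psi n)); last first.
    by rewrite ler_wpM2l // addr_ge0 // ltW.
  have -> : hd_quot x h = score [::] (word n x) + (hd_quot x h - score [::] (word n x)) by ring.
  by apply: (le_trans (ler_normD _ _)); rewrite mulrDl lerD // Ux.
- move=> d d0; have [N hN] := small d d0.
  have [n] := L1x x01 (maxn (maxn (2 ^ 8) N) N2).
  rewrite !geq_max => /andP[/andP[n8 nN] nN2] Ln.
  have [h0 hlo hhi] := half n.
  exists (2^-1 ^+ n); split => //; first exact: hN.
  have [_ E] := Ex n _ nN2 hlo hhi; have P0 := psi0 n n8.
  rewrite lil_scale_exp ler_pdivlMr //.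
  have : c * psi n <= c1 * psi n by rewrite ler_wpM2r // ltW.
  by move: E; rewrite ler_norml => /andP[E1 E2]; lra.
- move=> d d0; have [N hN] := small d d0.
  have [n] := L2x x01 (maxn (maxn (2 ^ 8) N) N2).
  rewrite !geq_max => /andP[/andP[n8 nN] nN2] Ln.
  have [h0 hlo hhi] := half n.
  exists (2^-1 ^+ n); split => //; first exact: hN.
  have [_ E] := Ex n _ nN2 hlo hhi; have P0 := psi0 n n8.
  rewrite lil_scale_exp ler_pdivrMr //.
  have : c * psi n <= c2 * psi n by rewrite ler_wpM2r // ltW.
  by move: E; rewrite ler_norml => /andP[E1 E2]; lra.
Qed.

End Analysis.

(** * Conditional measures of de Rham curves *)

Section Moebius.
Context {R : realType}.
Implicit Types b u v y z : R.

Definition in_box b u v : Prop := [/\ 0 < b < 1, b - 1 < u < b^-1 - 1 & - b < v < b / (1 - b)].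

Lemma in_box_mul b u v : in_box b u v ->
  [/\ 0 < b < 1, 0 < 1 + u, b * (1 + u) < 1, 1 - b < 1 + v & (1 - b) * (1 + v) < 1].
Proof.
move=> [/andP[b0 b1] /andP[u0 u1] /andP[v0 v1]].
have b1' : 0 < 1 - b by lra.
split; [by rewrite b0|lra| |lra|].
  have : b * (1 + u) < b * b^-1 by rewrite ltr_pM2l //; lra.
  by rewrite divff // gt_eqF.
by move: v1; rewrite ltr_pdivlMr //; lra.
Qed.

Lemma den_gt0 b y : 0 < b < 1 -> -1 < y -> 0 < 1 + b * y.
Proof.
move=> /andP[b0 b1] y1; have : b * -1 < b * y by rewrite ltr_pM2l.
by lra.
Qed.

(** [branch b y false] equals [mob y b]: the conditional distribution function at the midpoint,
    where [F] takes the value [b]. *)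
Definition branch b y (i : bool) : R := if i then (1 - b) / (1 + b * y) else b * (1 + y) / (1 + b * y).

Lemma branch_sum b y : 0 < b < 1 -> -1 < y -> branch b y false + branch b y true = 1.
Proof.
move=> hb hy; rewrite /branch -mulrDl; have := den_gt0 hb hy => d0.
have -> : b * (1 + y) + (1 - b) = 1 + b * y by ring.
by rewrite divff // gt_eqF.
Qed.

(* If the bottom row of the matrix of a cell is proportional to [(y, 1)], its
   conditional distribution function is [z |-> mob y z] composed with [F]. *)
Definition mob y z : R := (1 + y) * z / (1 + y * z).

Lemma mob_den_gt0 y z : -1 < y -> 0 <= z <= 1 -> 0 < 1 + y * z.
Proof.
move=> y1 /andP[z0 z1]; have [y0|y0] := lerP 0 y.
  by have := mulr_ge0 y0 z0; lra.
have : y <= y * z by rewrite ler_niMr // ltW.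
by lra.
Qed.

Lemma mob_itv y z : -1 < y -> 0 <= z <= 1 -> 0 <= mob y z <= 1.
Proof.
move=> y1 z01; have d0 := mob_den_gt0 y1 z01; have /andP[z0 z1] := z01.
rewrite /mob divr_ge0 ?mulr_ge0 ?(ltW d0) //=; [|lra].
by rewrite ler_pdivrMr // mul1r; lra.
Qed.

(** The row [(y, 1)] times the matrix of the left half is the row with entries [b * (1 + u) * y + u]
    and 1. In [mob_right] the last entry of the product is [b * y + 1], and dividing by it produces
    [G1]. *)
Lemma mob_left b u v y z : in_box b u v -> -1 < y -> 0 <= z <= 1 ->
  mob y (b * (1 + u) * z / (u * z + 1)) = branch b y false * mob (b * (1 + u) * y + u) z.
Proof.
move=> /in_box_mul[hb u0 bu v0 bv] y1 z01.
have d1 := den_gt0 hb y1.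
have d2 : 0 < 1 + u * z by apply: mob_den_gt0 => //; lra.
have d3 : 0 < 1 + (b * (1 + u) * y + u) * z.
  apply: mob_den_gt0 => //.
  have : 0 < (1 + u) * (1 + b * y) by rewrite mulr_gt0.
  by lra.
rewrite /mob /branch; field.
have d4 : 0 < u * z + 1 by rewrite addrC.
by rewrite !gt_eqF.
Qed.

Lemma G1_gt b u v y : in_box b u v -> -1 < y -> -1 < ((1 - b + v) * y + v) / (b * y + 1).
Proof.
move=> /in_box_mul[hb u0 bu v0 bv] y1.
have d1 := den_gt0 hb y1; have /andP[b0 b1] := hb.
have : 0 < (1 + v) * (1 + y) by rewrite mulr_gt0 //; lra.
by rewrite ltr_pdivlMr; lra.
Qed.

Lemma G0_gt b u v y : in_box b u v -> -1 < y -> -1 < b * (1 + u) * y + u.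
Proof.
move=> /in_box_mul[hb u0 bu v0 bv] y1; have := den_gt0 hb y1 => d1.
have : 0 < (1 + u) * (1 + b * y) by rewrite mulr_gt0.
by lra.
Qed.

Lemma mob_right b u v y z : in_box b u v -> -1 < y -> 0 <= z <= 1 ->
  mob y (((1 - b + v) * z + b) / (v * z + 1)) =
  branch b y false + branch b y true * mob (((1 - b + v) * y + v) / (b * y + 1)) z.
Proof.
move=> box y1 z01; have := G1_gt box y1 => g1.
case/in_box_mul: box => hb u0 bu v0 bv.
have d1 := den_gt0 hb y1; have /andP[b0 b1] := hb.
have d2 : 0 < 1 + v * z by apply: mob_den_gt0 => //; lra.
have d3 := mob_den_gt0 g1 z01.
have d4 : 0 < (1 + b * y) + ((1 - b + v) * y + v) * z.
  have : 0 < (1 + ((1 - b + v) * y + v) / (b * y + 1) * z) * (1 + b * y) by rewrite mulr_gt0.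
  have -> : (1 + ((1 - b + v) * y + v) / (b * y + 1) * z) * (1 + b * y) =
    1 + b * y + ((1 - b + v) * y + v) * z; last by [].
  by field; rewrite gt_eqF // addrC.
rewrite /mob /branch; field.
by rewrite !gt_eqF; lra.
Qed.

End Moebius.

Section State.
Context {R : realType}.

Definition Gi (b1 c0 c1 : R -> R) (t y : R) (i : bool) : R := if i then G1 b1 c1 t y else G0 b1 c0 t y.

(** Appending a digit multiplies the matrix of a cell on the right, so the maps act in reading
    order; the whole interval has bottom row [(0, 1)], hence the initial state 0. *)
Definition state (b1 c0 c1 : R -> R) t w : R := foldl (Gi b1 c0 c1 t) 0 w.

Lemma state_rcons (b1 c0 c1 : R -> R) t w i :
  state b1 c0 c1 t (rcons w i) = Gi b1 c0 c1 t (state b1 c0 c1 t w) i.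
Proof. by rewrite /state foldl_rcons. Qed.

Lemma state_gt (b1 c0 c1 : R -> R) t w : in_box (b1 t) (c0 t) (c1 t) -> -1 < state b1 c0 c1 t w.
Proof.
move=> box; elim/last_ind: w => [|w i IH]; first by rewrite /state /=; lra.
rewrite state_rcons /Gi; case: i; first exact: G1_gt box IH.
exact: G0_gt box IH.
Qed.

(* [lo, hi] contains the states for all small [t]; [nd] is the derivative of the
   logarithm of the odds of the two digits, up to the factor [b1 * (1 - b1) * (1 + y)]. *)
Definition regular (b1 c0 c1 : R -> R) : Prop := exists t0 lo hi L kap : R,
  [/\ [/\ 0 < t0, -1 < lo, lo <= 0 <= hi, 0 < L & 0 < kap],
      forall t w, `|t| < t0 -> lo <= state b1 c0 c1 t w <= hi,
      forall t w, `|t| < t0 -> `|state b1 c0 c1 t w - state b1 c0 c1 0 w| <= L * `|t|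
    & forall w, exists2 yd, is_derive (0 : R) 1 (fun t => state b1 c0 c1 t w) yd &
        kap <= `|derive1 b1 0 * (1 + state b1 c0 c1 0 w) + b1 0 * (1 - b1 0) * yd|].

End State.

(** * Verification of the abstract recursion for de Rham curves *)

Section Concrete.
Context {R : realType}.
Variables (b1 c0 c1 : R -> R) (F : R -> R -> R) (e0 : R).
Hypothesis e0_gt0 : 0 < e0.
Hypothesis box : forall t, `|t| < e0 -> in_box (b1 t) (c0 t) (c1 t).
Hypothesis sol : forall t, `|t| < e0 -> deRham_solution (A0 b1 c0 t) (A1 b1 c1 t) (F t).
Hypothesis b1_der : is_derive (0 : R) 1 b1 (derive1 b1 0).
Hypothesis reg : regular b1 c0 c1.

Let PhiE (a b c d z : R) : Phi (mx22 a b c d) z = (a * z + b) / (c * z + d).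
Proof. by rewrite /Phi /mx22 !mxE. Qed.

(** [F t 0] is a fixed point in [[0, 1]] of the Moebius map of the left half. After clearing the
    denominator, the equation is [z] times a combination of [1 - z] and [z] with positive
    coefficients, so only [z = 0] is left. [F_1] is the same with the factor [1 - z]. *)
Lemma F_0 t : `|t| < e0 -> F t 0 = 0.
Proof.
move=> tt; have [_ F01 Fl _] := sol tt.
have /in_box_mul[hb u0 bu v0 bv] := box tt; have /andP[b0 b1'] := hb.
have /andP[z0 z1] := F01 0 ltac:(rewrite lexx ler01 //).
have := Fl 0 ltac:(apply/andP; split; lra).
rewrite mulr0 PhiE; set z := F t 0 in z0 z1 *; rewrite addr0 => E.
have d : 0 < 1 + c0 t * z by apply: mob_den_gt0; [lra|rewrite z0].
have dn : c0 t * z + 1 != 0 by rewrite addrC gt_eqF.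
have E2 : z * (c0 t * z + 1) = b1 t * (1 + c0 t) * z by rewrite -[RHS](divfK dn) -E.
have E3 : z * ((1 - b1 t * (1 + c0 t)) * (1 - z) + (1 + c0 t) * (1 - b1 t) * z) = 0.
  by transitivity (z * (c0 t * z + 1) - b1 t * (1 + c0 t) * z); [ring|rewrite E2 subrr].
apply/eqP; move/eqP: E3; rewrite mulf_eq0 => /orP[//|/eqP E4]; exfalso.
have h1 : 0 <= (1 - b1 t * (1 + c0 t)) * (1 - z) by rewrite mulr_ge0 //; lra.
have h2 : 0 <= (1 + c0 t) * (1 - b1 t) * z by rewrite mulr_ge0 // mulr_ge0 //; lra.
have [zh|zh] := lerP z 2^-1.
  have : 0 < (1 - b1 t * (1 + c0 t)) * (1 - z) by rewrite mulr_gt0 //; lra.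
  by lra.
have : 0 < (1 + c0 t) * (1 - b1 t) * z by rewrite mulr_gt0 // ?mulr_gt0 //; lra.
by lra.
Qed.

Lemma F_1 t : `|t| < e0 -> F t 1 = 1.
Proof.
move=> tt; have [_ F01 _ Fr] := sol tt.
have /in_box_mul[hb u0 bu v0 bv] := box tt; have /andP[b0 b1'] := hb.
have /andP[z0 z1] := F01 1 ltac:(rewrite lexx ler01 //).
have := Fr 1 ltac:(apply/andP; split; lra).
have -> : 2 * 1 - 1 = 1 :> R by ring.
rewrite PhiE; set z := F t 1 in z0 z1 *; move=> E.
have d : 0 < 1 + c1 t * z by apply: mob_den_gt0; [lra|rewrite z0].
have dn : c1 t * z + 1 != 0 by rewrite addrC gt_eqF.
have E2 : z * (c1 t * z + 1) = (1 - b1 t + c1 t) * z + b1 t by rewrite -[RHS](divfK dn) -E.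
have E3 : (1 - z) * (b1 t * (1 - z) + (b1 t + c1 t) * z) = 0.
  by transitivity ((1 - b1 t + c1 t) * z + b1 t - z * (c1 t * z + 1)); [ring|rewrite E2 subrr].
apply/eqP; move/eqP: E3; rewrite mulf_eq0 subr_eq0 eq_sym => /orP[//|/eqP E4]; exfalso.
have h1 : 0 <= b1 t * (1 - z) by rewrite mulr_ge0 //; lra.
have h2 : 0 <= (b1 t + c1 t) * z by rewrite mulr_ge0 //; lra.
have [zh|zh] := lerP z 2^-1.
  have : 0 < b1 t * (1 - z) by rewrite mulr_gt0 //; lra.
  by lra.
have : 0 < (b1 t + c1 t) * z by rewrite mulr_gt0 //; lra.
by lra.
Qed.

Definition prob (t : R) w i := branch (b1 t) (state b1 c0 c1 t w) i.
Definition cdf (t : R) w (x : R) := mob (state b1 c0 c1 t w) (F t x).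

Lemma prob_sum t w : `|t| < e0 -> prob t w false + prob t w true = 1.
Proof.
move=> tt; have [hb _ _] := box tt; apply: branch_sum => //; exact: state_gt (box tt).
Qed.

Lemma cdf_itv t w x : `|t| < e0 -> 0 <= x <= 1 -> 0 <= cdf t w x <= 1.
Proof.
by move=> tt x01; have [_ F01 _ _] := sol tt; apply: mob_itv (F01 _ x01); exact: state_gt (box tt).
Qed.

Lemma cdf_0 t w : `|t| < e0 -> cdf t w 0 = 0.
Proof. by move=> tt; rewrite /cdf /mob F_0 // mulr0 mul0r. Qed.

Lemma cdf_1 t w : `|t| < e0 -> cdf t w 1 = 1.
Proof.
move=> tt; rewrite /cdf /mob F_1 // !mulr1 divff // gt_eqF //.
by have := state_gt w (box tt); lra.
Qed.

Lemma cdf_left t w x : `|t| < e0 -> 0 <= x <= 2^-1 ->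
  cdf t w x = prob t w false * cdf t (rcons w false) (2 * x).
Proof.
move=> tt x2; have [_ F01 Fl _] := sol tt.
have z01 : 0 <= F t (2 * x) <= 1 by apply: F01; case/andP: x2 => ? ?; apply/andP; split; lra.
rewrite /cdf (Fl _ x2) PhiE addr0 (mob_left (box tt)) //; last exact: state_gt (box tt).
by rewrite state_rcons.
Qed.

Lemma cdf_right t w x : `|t| < e0 -> 2^-1 <= x <= 1 ->
  cdf t w x = prob t w false + prob t w true * cdf t (rcons w true) (2 * x - 1).
Proof.
move=> tt x2; have [_ F01 _ Fr] := sol tt.
have z01 : 0 <= F t (2 * x - 1) <= 1 by apply: F01; case/andP: x2 => ? ?; apply/andP; split; lra.
rewrite /cdf (Fr _ x2) PhiE (mob_right (box tt)) //; last exact: state_gt (box tt).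
by rewrite state_rcons.
Qed.

(** Differentiating [(1 - b1) / (1 + b1 * y)] gives minus [b1' * (1 + y) + b1 * (1 - b1) * y'] over
    [(1 + b1 * y) ^+ 2]. The numerator is the quantity that [regular] bounds away from 0. *)
Lemma prob_regular : exists (t0 pm L kap : R) (dp : seq bool -> bool -> R),
  [/\ [/\ 0 < t0, t0 <= e0, 0 < pm, 0 < L & 0 < kap],
      forall t w i, `|t| < t0 -> pm <= prob t w i,
      forall t w i, `|t| < t0 -> `|prob t w i - prob 0 w i| <= L * `|t|,
      forall w i, is_derive (0 : R) 1 (fun t => prob t w i) (dp w i)
    & forall w, kap <= `|dp w false|].
Proof.
have [t0 [lo [hi [L [kap [[t0_gt0 lo1 /andP[lo0 hi0] L0 kap0] st_itv st_lip st_der]]]]]] := reg.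
have n0 : `|0 : R| < e0 by rewrite normr0.
have [/andP[b0 b1lt] _ _] := box n0.
(* On the interval [|t| < t1] chosen below, both [b1 t] and [1 - b1 t] remain at least [m]. *)
pose m := Num.min (b1 0) (1 - b1 0) / 2.
have m0 : 0 < m by rewrite divr_gt0 // lt_min b0 subr_gt0.
have [mb1 mb2] : m <= b1 0 / 2 /\ m <= (1 - b1 0) / 2.
  by rewrite /m !ler_pM2r ?invr_gt0 // !ge_min !lexx orbT.
have [d d0 dP] := derive1_lip b1_der.
set Lb := `|_| + 1 in dP.
have Lb0 : 0 < Lb by rewrite ltr_wpDl.
pose t1 := Num.min (Num.min t0 e0) (Num.min d (m / Lb)).
have t1P t : `|t| < t1 -> [/\ `|t| < t0, `|t| < e0, `|b1 t - b1 0| <= Lb * `|t| & `|b1 t - b1 0| <= m].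
  rewrite !lt_min => /andP[/andP[tt0 te0] /andP[td tm]].
  have := dP t td; rewrite add0r => h; split => //.
  by apply: (le_trans h); rewrite mulrC -ler_pdivlMr // ltW.
pose k := 1 + lo; have k0 : 0 < k by rewrite /k; lra.
have den t w : `|t| < t1 -> k <= 1 + b1 t * state b1 c0 c1 t w <= 1 + hi.
  move=> /t1P[tt0 te0 _ _]; have [/andP[bt0 bt1] _ _] := box te0.
  have /andP[s0 s1] := st_itv t w tt0.
  rewrite /k !lerD2l; apply/andP; split.
    by apply: (le_trans (y := b1 t * lo)); [rewrite ler_niMl // ltW|rewrite ler_wpM2l // ltW].
  by apply: (le_trans (y := b1 t * hi)); [rewrite ler_wpM2l // ltW|rewrite ler_piMl // ltW].
pose pm := m * Num.min 1 k / (1 + hi).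
have hi1 : 0 < 1 + hi by lra.
have km : 0 < Num.min 1 k by rewrite lt_min ltr01.
pose L2 := (Lb * (2 + hi) + 2 * L) / k ^+ 2.
have L20 : 0 < L2.
  by rewrite divr_gt0 ?exprn_gt0 // addr_gt0 ?mulr_gt0 //; lra.
pose yd w := projT1 (cid2 (st_der w)).
have ydP w : is_derive (0 : R) 1 (fun t => state b1 c0 c1 t w) (yd w) /\
   kap <= `|derive1 b1 0 * (1 + state b1 c0 c1 0 w) + b1 0 * (1 - b1 0) * yd w|.
  by rewrite /yd; case: cid2.
pose nd w := (derive1 b1 0 * (1 + state b1 c0 c1 0 w) + b1 0 * (1 - b1 0) * yd w) /
  (1 + b1 0 * state b1 c0 c1 0 w) ^+ 2.
have t10 : 0 < t1 by rewrite !lt_min t0_gt0 e0_gt0 d0 divr_gt0.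
have n1 : `|0 : R| < t1 by rewrite normr0.
exists t1, pm, L2, (kap / (1 + hi) ^+ 2), (fun w i => if i then - nd w else nd w).
have p1_der w : is_derive (0 : R) 1 (fun t => prob t w true) (- nd w).
  have [yw _] := ydP w.
  have dn : 1 + b1 0 * state b1 c0 c1 0 w != 0.
    by rewrite gt_eqF //; case/andP: (den 0 w n1) => h _; exact: lt_le_trans h.
  apply: is_derive1_eq (is_derive1_div (f := fun t => 1 - b1 t) (g := fun t => 1 + b1 t * state b1 c0 c1 t w) dn
    (is_derive1B (is_derive1_cst 1 0) b1_der)
    (is_derive1D (is_derive1_cst 1 0) (is_derive1M b1_der yw))).
  by rewrite /nd; field.
have p1_lip t w : `|t| < t1 -> `|prob t w true - prob 0 w true| <= L2 * `|t|.
  move=> tt; have /andP[dt _] := den t w tt; have /andP[d0' _] := den 0 w n1.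
  have [tt0 te0 hb _] := t1P t tt; have hy := st_lip t w tt0.
  have [/andP[bt0 bt1] _ _] := box te0.
  have [n0' _ _ _] := t1P 0 n1; have /andP[s0 s1] := st_itv 0 w n0'.
  rewrite /prob /branch; set y := state b1 c0 c1 t w in dt hy *.
  set y0 := state b1 c0 c1 0 w in d0' hy s0 s1 *.
  set D := 1 + b1 t * y in dt *; set D0 := 1 + b1 0 * y0 in d0' *.
  have D0_gt0 : 0 < D0 by apply: lt_le_trans d0'.
  have D_gt0 : 0 < D by apply: lt_le_trans dt.
  have -> : (1 - b1 t) / D - (1 - b1 0) / D0 =
     ((b1 0 - b1 t) * (1 + y0) + b1 t * (y0 - y) + b1 t * b1 0 * (y - y0)) / (D * D0).
    by rewrite /D /D0; field; rewrite !gt_eqF.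
  rewrite normrM normfV (gtr0_norm (mulr_gt0 D_gt0 D0_gt0)) ler_pdivrMr ?mulr_gt0 //.
  apply: (@le_trans _ _ (L2 * `|t| * k ^+ 2)); last first.
    apply: ler_wpM2l; first by apply: mulr_ge0 => //; exact: ltW.
    by rewrite expr2; apply: ler_pM => //; exact: ltW.
  have -> : L2 * `|t| * k ^+ 2 = Lb * `|t| * (2 + hi) + L * `|t| + L * `|t|.
    by rewrite /L2; field; rewrite gt_eqF.
  have y01 : 0 <= 1 + y0 by lra.
  apply: (le_trans (ler_normD _ _)); apply: lerD.
    apply: (le_trans (ler_normD _ _)); apply: lerD.
      rewrite normrM (ger0_norm y01) distrC; apply: ler_pM => //; lra.
    rewrite normrM (gtr0_norm bt0) distrC; apply: le_trans hy; rewrite ler_piMl //; exact: ltW.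
  have bb0 : 0 <= b1 t * b1 0 by rewrite mulr_ge0 // ltW.
  rewrite normrM (ger0_norm bb0); apply: le_trans hy; rewrite ler_piMl //.
  by rewrite mulr_ile1 // ltW.
have sumt t w : `|t| < t1 -> prob t w false = 1 - prob t w true.
  by move=> /t1P[_ te0 _ _]; have := prob_sum w te0; lra.
have min1 : Num.min 1 k <= 1 by rewrite ge_min lexx.
have mink : Num.min 1 k <= k by rewrite ge_min lexx orbT.
have pmP (n D : R) : m * Num.min 1 k <= n -> 0 < D -> D <= 1 + hi -> pm <= n / D.
  move=> mn D0 Dhi; rewrite ler_pdivlMr //; apply: le_trans mn.
  rewrite /pm mulrAC ler_pdivrMr // ler_wpM2l //.
  by rewrite mulr_ge0 // ltW.
split.
- split => //.
  + by rewrite /t1 !ge_min lexx orbT.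
  + by rewrite divr_gt0 // mulr_gt0.
  + by rewrite divr_gt0 // exprn_gt0.
- move=> t w i tt; have /andP[dt dt'] := den t w tt; have [tt0 te0 _ hm] := t1P t tt.
  have D0 : 0 < 1 + b1 t * state b1 c0 c1 t w by apply: lt_le_trans dt.
  have /andP[s0 s1] := st_itv t w tt0.
  move: hm; rewrite ler_norml => /andP[hm1 hm2].
  rewrite /prob /branch; case: i; apply: pmP => //.
    apply: (@le_trans _ _ (m * 1)); first by rewrite ler_wpM2l // ltW.
    by lra.
  apply: (@le_trans _ _ (m * k)); first by rewrite ler_wpM2l // ltW.
  apply: ler_pM; [exact: ltW|exact: ltW|lra|by rewrite /k; lra].
- move=> t w [] tt; first exact: p1_lip.
  rewrite !sumt //.
  have -> : 1 - prob t w true - (1 - prob 0 w true) = - (prob t w true - prob 0 w true) by ring.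
  by rewrite normrN; exact: p1_lip.
- move=> w []; first exact: p1_der.
  apply: is_derive1_near t10 _ (is_derive1_eq _ (is_derive1B (is_derive1_cst 1 0) (p1_der w))).
    by move=> t tt; rewrite add0r sumt.
  by rewrite sub0r opprK.
- move=> w; have [_ kw] := ydP w; have /andP[dt dt'] := den 0 w n1.
  have D0 : 0 < 1 + b1 0 * state b1 c0 c1 0 w by apply: lt_le_trans dt.
  rewrite /nd normrM normfV (gtr0_norm (exprn_gt0 2 D0)).
  apply: ler_pM => //; first exact: ltW.
    by rewrite invr_ge0 exprn_ge0 // ltW.
  by rewrite lef_pV2 ?posrE ?exprn_gt0 // lerXn2r ?nnegrE // ltW.
Qed.

End Concrete.

(** * Nondegeneracy and duality *)

Section Nondegenerate.
Context {R : realType}.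
Variables (b1 c0 c1 : R -> R) (e0 : R).
Hypothesis e0_gt0 : 0 < e0.
Hypothesis box : forall t, `|t| < e0 -> in_box (b1 t) (c0 t) (c1 t).
Variables (b' u' v' : R).
Hypothesis b1_der : is_derive (0 : R) 1 b1 b'.
Hypothesis c0_der : is_derive (0 : R) 1 c0 u'.
Hypothesis c1_der : is_derive (0 : R) 1 c1 v'.

Let b : R := b1 0.
Let u : R := c0 0.
Let v : R := c1 0.
Let al : R := alpha b1 c0 c1.
Let be : R := beta b1 c0 c1.

Let n0 : `|0 : R| < e0. Proof. by rewrite normr0. Qed.

Let box0 : [/\ 0 < b < 1, 0 < 1 + u, b * (1 + u) < 1, 1 - b < 1 + v & (1 - b) * (1 + v) < 1].
Proof. exact: in_box_mul (box n0). Qed.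

Let fix0 : R := u / (1 - b * (1 + u)).
Let fix1 : R := v / b.

Lemma alpha_beta : [/\ -1 < al, al <= 0 <= be, al <= fix0 <= be & al <= fix1 <= be].
Proof.
have [/andP[b0 b1lt] u0 bu v0 bv] := box0.
rewrite /al /be /alpha /beta -/b -/u -/v -/fix0 -/fix1.
split; rewrite ?ge_min ?le_max ?lexx ?orbT //.
rewrite !lt_min; apply/and3P; split; first by lra.
  have h : 0 < (1 + u) * (1 - b) by rewrite mulr_gt0 // subr_gt0.
  by rewrite /fix0 ltr_pdivlMr; lra.
by rewrite /fix1 ltr_pdivlMr //; lra.
Qed.

(** Each [G_i] moves [y] towards its fixed point, [fix0] or [fix1], by a convex combination. Hence
    every interval in [(-1, +oo)] that contains [[alpha, beta]] is invariant, and [[alpha, beta]]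
    itself traps the orbit of 0. *)
Lemma G0_convex y : G0 b1 c0 0 y = b * (1 + u) * y + (1 - b * (1 + u)) * fix0.
Proof.
have [_ _ bu _ _] := box0.
by rewrite /G0 -/b -/u /fix0; field; rewrite gt_eqF // subr_gt0.
Qed.

Lemma G1_convex y : -1 < y ->
  G1 b1 c1 0 y = (1 - b) / (1 + b * y) * y + (1 - (1 - b) / (1 + b * y)) * fix1.
Proof.
move=> y1; have [hb _ _ _ _] := box0; have /andP[b0 _] := hb; have d := den_gt0 hb y1.
by rewrite /G1 -/b -/v /fix1; field; rewrite !gt_eqF //; lra.
Qed.

Let convex (r x y lo hi : R) : 0 <= r <= 1 -> lo <= x <= hi -> lo <= y <= hi ->
  lo <= r * x + (1 - r) * y <= hi.
Proof.
move=> /andP[r0 r1] /andP[x0 x1] /andP[y0 y1].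
have h1 := ler_wpM2l r0 x0; have h2 := ler_wpM2l r0 x1.
have r2 : 0 <= 1 - r by lra.
have h3 := ler_wpM2l r2 y0; have h4 := ler_wpM2l r2 y1.
by apply/andP; split; lra.
Qed.

Lemma Gi_itv (lo hi : R) y i : -1 < lo -> lo <= al -> be <= hi -> lo <= y <= hi ->
  lo <= Gi b1 c0 c1 0 y i <= hi.
Proof.
move=> lo1 loa hib y01; have [hb u0 bu v0 bv] := box0; have /andP[b0 b1lt] := hb.
have [_ _ /andP[f0 f0'] /andP[f1 f1']] := alpha_beta.
have /andP[ylo yhi] := y01.
have y1 : -1 < y by lra.
rewrite /Gi; case: i.
  rewrite (G1_convex y1); apply: convex => //; last by apply/andP; split; lra.
  have d := den_gt0 hb y1; rewrite divr_ge0 /= ?(ltW d) //; last by lra.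
  have h : b * -1 < b * y by rewrite ltr_pM2l.
  by rewrite ler_pdivrMr // mul1r; lra.
rewrite G0_convex; apply: convex => //; last by apply/andP; split; lra.
by apply/andP; split; [apply: mulr_ge0; lra|lra].
Qed.

Lemma state0_itv w : al <= state b1 c0 c1 0 w <= be.
Proof.
have [a1 a0 _ _] := alpha_beta.
elim/last_ind: w => [|w i IH]; first by rewrite /state.
by rewrite state_rcons; exact: Gi_itv.
Qed.

Definition dG_t (y : R) (i : bool) : R :=
  if i then (((v' - b') * y + v') * (1 + b * y) - ((1 - b + v) * y + v) * (b' * y)) / (1 + b * y) ^+ 2
  else (b' * (1 + u) + b * u') * y + u'.

Definition dG_y (y : R) (i : bool) : R :=
  if i then (1 - b) * (1 + v) / (1 + b * y) ^+ 2 else b * (1 + u).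

Lemma Gi_der (Y : R -> R) yd i : -1 < Y 0 -> is_derive (0 : R) 1 Y yd ->
  is_derive (0 : R) 1 (fun t => Gi b1 c0 c1 t (Y t) i) (dG_t (Y 0) i + dG_y (Y 0) i * yd).
Proof.
move=> y1 hY; have [hb _ _ _ _] := box0; have d := den_gt0 hb y1.
rewrite /dG_t /dG_y /Gi; case: i.
  have dn : b1 0 * Y 0 + 1 != 0 by rewrite -/b addrC gt_eqF.
  rewrite /G1; apply: is_derive1_eq (is_derive1_div (f := fun t => (1 - b1 t + c1 t) * Y t + c1 t)
    (g := fun t => b1 t * Y t + 1) dn
    (is_derive1D (is_derive1M (is_derive1D (is_derive1B (is_derive1_cst 1 0) b1_der) c1_der) hY) c1_der)
    (is_derive1D (is_derive1M b1_der hY) (is_derive1_cst 1 0))).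
  have dn' : 1 + b * Y 0 != 0 by rewrite gt_eqF.
  by rewrite -/b -/v (addrC (b * Y 0) 1); field.
rewrite /G0; apply: is_derive1_eq (is_derive1D (is_derive1M (is_derive1M b1_der
  (is_derive1D (is_derive1_cst 1 0) c0_der)) hY) c0_der).
by rewrite -/b -/u; ring.
Qed.

Lemma Gi_der_y y i : -1 < y -> is_derive (y : R) 1 (Gi b1 c0 c1 0 ^~ i) (dG_y y i).
Proof.
move=> y1; have [hb _ _ _ _] := box0; have d := den_gt0 hb y1.
rewrite /dG_y /Gi; case: i.
  have dn : b1 0 * y + 1 != 0 by rewrite -/b addrC gt_eqF.
  rewrite /G1; apply: is_derive1_eq (is_derive1_div (f := fun z => (1 - b1 0 + c1 0) * z + c1 0)
    (g := fun z => b1 0 * z + 1) dn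
    (is_derive1D (is_derive1M (is_derive1_cst (1 - b1 0 + c1 0) y) (is_derive1_id y)) (is_derive1_cst (c1 0) y))
    (is_derive1D (is_derive1M (is_derive1_cst (b1 0) y) (is_derive1_id y)) (is_derive1_cst 1 y))).
  have dn' : 1 + b * y != 0 by rewrite gt_eqF.
  by rewrite -/b -/v (addrC (b * y) 1); field.
rewrite /G0; apply: is_derive1_eq (is_derive1D (is_derive1M (is_derive1_cst (b1 0 * (1 + c0 0)) y)
  (is_derive1_id y)) (is_derive1_cst (c0 0) y)).
by rewrite -/b -/u; ring.
Qed.

Lemma derive1_G_t y i : -1 < y -> derive1 (fun t => Gi b1 c0 c1 t y i) 0 = dG_t y i.
Proof.
move=> y1; apply: derive1_is.
apply: is_derive1_eq (Gi_der i (Y := fun=> y) y1 (is_derive1_cst y 0)).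
by rewrite mulr0 addr0.
Qed.

Hypothesis contr : forall y, al <= y <= be -> derive1 (G1 b1 c1 0) y < 1.

Let det : R := (1 - b) * (1 + v).

Let det_gt0 : 0 < det.
Proof. by have [/andP[b0 b1lt] _ _ v0 _] := box0; rewrite mulr_gt0 //; lra. Qed.

Lemma dG_y_itv y i : al <= y <= be -> 0 <= dG_y y i < 1.
Proof.
move=> y01; have [a1 _ _ _] := alpha_beta; have [hb u0 bu _ _] := box0.
have y1 : -1 < y by case/andP: y01 => h _; exact: lt_le_trans h.
have d := den_gt0 hb y1; have /andP[b0 b1lt] := hb.
rewrite /dG_y; case: i.
  rewrite divr_ge0 ?(ltW det_gt0) ?exprn_ge0 ?(ltW d) //=.
  by rewrite -[X in X < 1]/(dG_y y true) -(derive1_is (Gi_der_y true y1)); exact: contr.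
by rewrite bu andbT mulr_ge0 // ltW.
Qed.

(** The slope of [G1] decreases in [y], so it is largest at the left end, where it is less than 1 by
    assumption; by continuity it is so at [al - eta]. The exact difference formula for [G1] then
    gives a Lipschitz constant on the whole half-line. *)
Lemma contraction : exists eta lam : R,
  [/\ 0 < eta <= 1, -1 < al - eta, 0 <= lam < 1 &
    forall y z i, al - eta <= y -> al - eta <= z ->
      `|Gi b1 c0 c1 0 y i - Gi b1 c0 c1 0 z i| <= lam * `|y - z|].
Proof.
have [a1 /andP[a0 be0] _ _] := alpha_beta; have [hb u0 bu v0 bv] := box0.
have /andP[b0 b1lt] := hb.
pose x := 1 + b * al; have x0 : 0 < x by exact: den_gt0.
have g0 : det < x ^+ 2.
  have /andP[_] := @dG_y_itv al true ltac:(rewrite lexx (le_trans a0)//).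
  by rewrite /dG_y -/det -/x ltr_pdivrMr ?exprn_gt0 // mul1r.
(* The first bound keeps [al - eta] above -1; the second makes the loss in [x ^+ 2] at most half of
   the gap [x ^+ 2 - det]. *)
pose eta := Num.min ((1 + al) / 2) ((x ^+ 2 - det) / (4 * x)).
have e_gt0 : 0 < eta by rewrite lt_min !divr_gt0 ?mulr_gt0 //; lra.
have e1 : eta <= (1 + al) / 2 by rewrite ge_min lexx.
have e2 : eta * (4 * x) <= x ^+ 2 - det.
  by rewrite -ler_pdivlMr ?mulr_gt0 // ge_min lexx orbT.
have a1' : -1 < al - eta by lra.
pose x' := 1 + b * (al - eta); have x'0 : 0 < x' by exact: den_gt0.
have be_le : b * eta <= eta by rewrite ler_piMl // ltW.
have g1 : det < x' ^+ 2.
  have -> : x' = x - b * eta by rewrite /x' /x; ring.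
  have h1 : x * (b * eta) <= x * eta by rewrite ler_pM2l.
  have h2 : 0 < x * eta by rewrite mulr_gt0.
  have h3 := sqr_ge0 (b * eta).
  have -> : (x - b * eta) ^+ 2 = x ^+ 2 - 2 * (x * (b * eta)) + (b * eta) ^+ 2 by ring.
  by lra.
pose l1 := det / x' ^+ 2.
have l1_lt1 : l1 < 1 by rewrite ltr_pdivrMr ?exprn_gt0 // mul1r.
exists eta, (Num.max (b * (1 + u)) l1); split => //.
- by rewrite e_gt0 /=; lra.
- by rewrite gt_max bu l1_lt1 andbT le_max mulr_ge0 // ltW.
move=> y z i hy hz.
have y1 : -1 < y by lra.
have z1 : -1 < z by lra.
have dy := den_gt0 hb y1; have dz := den_gt0 hb z1.
have : `|Gi b1 c0 c1 0 y i - Gi b1 c0 c1 0 z i| <= (if i then l1 else b * (1 + u)) * `|y - z|.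
  rewrite /Gi; case: i.
    have -> : G1 b1 c1 0 y - G1 b1 c1 0 z = det / ((1 + b * y) * (1 + b * z)) * (y - z).
      by rewrite /G1 -/b -/v /det; field; rewrite !gt_eqF //; lra.
    rewrite normrM ler_wpM2r //.
    have dd : 0 < (1 + b * y) * (1 + b * z) by rewrite mulr_gt0.
    rewrite gtr0_norm ?divr_gt0 // /l1 ler_pM2l // lef_pV2 ?posrE ?exprn_gt0 //.
    by rewrite expr2; apply: ler_pM; rewrite ?(ltW x'0) // lerD2l ler_pM2l.
  have -> : G0 b1 c0 0 y - G0 b1 c0 0 z = b * (1 + u) * (y - z).
    by rewrite /G0 -/b -/u; ring.
  by rewrite normrM gtr0_norm // mulr_gt0.
move=> h; apply: (le_trans h); rewrite ler_wpM2r //.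
by case: i {h} => /=; rewrite le_max lexx ?orbT.
Qed.

Lemma Gi_lip_t (lo hi : R) : -1 < lo -> lo <= al -> be <= hi ->
  exists2 d, 0 < d & exists2 L, 0 < L & forall t y i, `|t| < d -> lo <= y <= hi ->
    `|Gi b1 c0 c1 t y i - Gi b1 c0 c1 0 y i| <= L * `|t|.
Proof.
move=> lo1 loa hib; have [a1 /andP[a0 be0] _ _] := alpha_beta.
have [d1 d1_gt0 P1] := derive1_lip b1_der; set L1 := `|_| + 1 in P1.
have [d2 d2_gt0 P2] := derive1_lip c0_der; set L2 := `|_| + 1 in P2.
have [d3 d3_gt0 P3] := derive1_lip c1_der; set L3 := `|_| + 1 in P3.
have [d4 d4_gt0 P4] := derive1_lip (is_derive1M b1_der (is_derive1D (is_derive1_cst 1 0) c0_der)).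
set L4 := `|_| + 1 in P4.
have [L10 L20 L30 L40] : [/\ 0 < L1, 0 < L2, 0 < L3 & 0 < L4] by split; rewrite ltr_wpDl.
pose k := 1 + lo; have k0 : 0 < k by rewrite /k; lra.
pose Y := 1 + hi; have Y0 : 0 < Y by rewrite /Y; lra.
exists (Num.min (Num.min e0 d1) (Num.min (Num.min d2 d3) d4)).
  by rewrite !lt_min e0_gt0 d1_gt0 d2_gt0 d3_gt0.
have La0 : 0 < L4 * Y + L2 by rewrite addr_gt0 ?mulr_gt0.
have Lb0 : 0 < ((L1 + L3) * Y + L3 + Y * (L1 * Y)) / k.
  have La1 : 0 < (L1 + L3) * Y by apply: mulr_gt0 => //; exact: addr_gt0.
  have La2 : 0 < Y * (L1 * Y) by apply: mulr_gt0 => //; exact: mulr_gt0.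
  by apply: divr_gt0 => //; lra.
exists ((L4 * Y + L2) + ((L1 + L3) * Y + L3 + Y * (L1 * Y)) / k); first by rewrite addr_gt0.
move=> t y i; rewrite !lt_min => /andP[/andP[te t1] /andP[/andP[t2 t3] t4]] y01.
have {P1} h1 := P1 t t1; have {P2} h2 := P2 t t2; have {P3} h3 := P3 t t3; have {P4} h4 := P4 t t4.
rewrite !add0r in h1 h2 h3 h4.
have Yy x : lo <= x <= hi -> `|x| <= Y.
  by move=> /andP[? ?]; rewrite ler_norml /Y; apply/andP; split; lra.
have t0 : 0 <= `|t| by [].
have y1 : -1 < y by case/andP: y01 => h _; exact: lt_le_trans h.
rewrite mulrDl /Gi; case: i.
  apply: ler_wpDl; first by rewrite mulr_ge0 // ltW.
  have [hbt _ _ _ _] := in_box_mul (box te); have /andP[bt0 bt1] := hbt.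
  have dt : k <= 1 + b1 t * y.
    rewrite /k lerD2l; case/andP: y01 => ylo _.
    apply: (le_trans (y := b1 t * lo)); last by rewrite ler_pM2l.
    by rewrite ler_niMl ?(ltW bt1) //; lra.
  have dt0 : 0 < 1 + b1 t * y by apply: lt_le_trans dt.
  have [hb _ _ _ _] := box0; have d0 := den_gt0 hb y1.
  (* Only the denominator at [t] is cleared; the value at 0 stays as a factor, bounded because
     [[lo, hi]] is invariant. *)
  have -> : G1 b1 c1 t y - G1 b1 c1 0 y =
     (((c1 t - c1 0) - (b1 t - b1 0)) * y + (c1 t - c1 0) - G1 b1 c1 0 y * ((b1 t - b1 0) * y)) / (1 + b1 t * y).
    rewrite /G1; field.
    rewrite -/b !gt_eqF //; lra.
  rewrite normrM normfV (gtr0_norm dt0) ler_pdivrMr //.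
  apply: (@le_trans _ _ (((L1 + L3) * Y + L3 + Y * (L1 * Y)) / k * `|t| * k)); last first.
    by apply: ler_wpM2l => //; rewrite mulr_ge0 // ltW.
  have -> : ((L1 + L3) * Y + L3 + Y * (L1 * Y)) / k * `|t| * k =
     (L3 * `|t| + L1 * `|t|) * Y + L3 * `|t| + Y * (L1 * `|t| * Y) by field; rewrite gt_eqF.
  apply: (le_trans (ler_normB _ _)); apply: lerD.
    apply: (le_trans (ler_normD _ _)); apply: lerD => //.
    rewrite normrM; apply: ler_pM => //; last exact: Yy.
    by apply: (le_trans (ler_normB _ _)); exact: lerD.
  rewrite normrM; apply: ler_pM => //.
    by apply: Yy; exact: (Gi_itv true).
  by rewrite normrM; apply: ler_pM => //; exact: Yy.
apply: ler_wpDr; first by rewrite mulr_ge0 // ltW.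
have -> : G0 b1 c0 t y - G0 b1 c0 0 y =
  (b1 t * (1 + c0 t) - b1 0 * (1 + c0 0)) * y + (c0 t - c0 0) by rewrite /G0; ring.
have -> : (L4 * Y + L2) * `|t| = L4 * `|t| * Y + L2 * `|t| by ring.
apply: (le_trans (ler_normD _ _)); apply: lerD => //.
by rewrite normrM; apply: ler_pM => //; exact: Yy.
Qed.

(* [P] is an invariant of the recursion satisfied by the derivatives of the states. *)
Lemma regular_of_invariant (P : R -> Prop) (kap : R) : 0 < kap -> P 0 ->
  (forall y yd i, al <= y <= be -> P yd -> P (dG_t y i + dG_y y i * yd)) ->
  (forall y yd, al <= y <= be -> P yd -> kap <= `|b' * (1 + y) + b * (1 - b) * yd|) ->
  regular b1 c0 c1.
Proof.
move=> kap0 P0 Pstep Pkap.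
have [a1 /andP[a0 be0] _ _] := alpha_beta.
have [eta [lam [/andP[eta0 eta1] ae1 /andP[lam0 lam1] ctr]]] := contraction.
pose lo := al - eta; pose hi := be + eta.
have loa : lo <= al by rewrite /lo; lra.
have hib : be <= hi by rewrite /hi; lra.
have [d d0 [L1 L10 HL]] := Gi_lip_t ae1 loa hib.
(* [K] solves [K = L1 + lam * K], so the bound reproduces itself when a digit is appended. Taking
   [K * t0 <= eta] keeps the perturbed states in [[lo, hi]], the region where the estimates hold. *)
pose K := L1 / (1 - lam).
have lam1' : 0 < 1 - lam by lra.
have K0 : 0 < K by rewrite divr_gt0.
pose t0 := Num.min d (eta / K).
have lip t w : `|t| < t0 -> `|state b1 c0 c1 t w - state b1 c0 c1 0 w| <= K * `|t|.
  rewrite lt_min => /andP[td te].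
  have Ke : K * `|t| <= eta by rewrite mulrC -ler_pdivlMr // ltW.
  elim/last_ind: w => [|w i IH]; first by rewrite /state /= subrr normr0 mulr_ge0 // ltW.
  rewrite !state_rcons; set yt := state b1 c0 c1 t w in IH *; set y0 := state b1 c0 c1 0 w in IH *.
  have /andP[y0a y0b] : al <= y0 <= be by exact: state0_itv.
  have /andP[ya yb] : lo <= yt <= hi.
    by move: (le_trans IH Ke); rewrite ler_norml /lo /hi => /andP[? ?]; apply/andP; split; lra.
  have -> : Gi b1 c0 c1 t yt i - Gi b1 c0 c1 0 y0 i =
    (Gi b1 c0 c1 t yt i - Gi b1 c0 c1 0 yt i) + (Gi b1 c0 c1 0 yt i - Gi b1 c0 c1 0 y0 i) by ring.
  have h1 : `|Gi b1 c0 c1 t yt i - Gi b1 c0 c1 0 yt i| <= L1 * `|t| by apply: HL; rewrite ?ya.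
  have h2 := ctr yt y0 i ya (le_trans loa y0a).
  have h3 := ler_wpM2l lam0 IH.
  apply: (le_trans (ler_normD _ _)).
  have -> : K * `|t| = L1 * `|t| + lam * (K * `|t|).
    by rewrite /K; field; rewrite gt_eqF.
  by apply: lerD => //; exact: le_trans h2 h3.
exists t0, lo, hi, K, kap; split.
- split => //; first by rewrite lt_min d0 divr_gt0.
  by apply/andP; split; rewrite /lo /hi; lra.
- move=> t w tt; have := lip t w tt; have /andP[y0a y0b] := state0_itv w.
  have Ke : K * `|t| <= eta.
    by move: tt; rewrite lt_min => /andP[_ te]; rewrite mulrC -ler_pdivlMr // ltW.
  by move=> /le_trans /(_ Ke); rewrite ler_norml /lo /hi => /andP[? ?]; apply/andP; split; lra.
- exact: lip.
- move=> w.
  have [yd yd_der Pyd] : exists2 yd, is_derive (0 : R) 1 (fun t => state b1 c0 c1 t w) yd & P yd.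
    elim/last_ind: w => [|w i [yd yd_der Pyd]]; first by exists 0 => //; exact: is_derive1_cst.
    exists (dG_t (state b1 c0 c1 0 w) i + dG_y (state b1 c0 c1 0 w) i * yd).
      have -> : (fun t => state b1 c0 c1 t (rcons w i)) = (fun t => Gi b1 c0 c1 t (state b1 c0 c1 t w) i).
        by apply/funext => t; rewrite state_rcons.
      by apply: Gi_der => //; exact: state_gt (box n0).
    by apply: Pstep => //; exact: state0_itv.
  by exists yd => //; rewrite (derive1_is b1_der); apply: Pkap => //; exact: state0_itv.
Qed.

(** [delta_fun] is the fixed point of the affine map [yd |-> dG_t + dG_y * yd]. As its slope lies in
    [[0, 1)], a number below this fixed point bounds an invariant half-line. *)
Lemma delta_fun_le y i m : al <= y <= be ->
  m <= delta_fun (fun t z => Gi b1 c0 c1 t z i) y -> m * (1 - dG_y y i) <= dG_t y i.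
Proof.
move=> y01; have [a1 _ _ _] := alpha_beta.
have y1 : -1 < y by case/andP: y01 => h _; exact: lt_le_trans h.
have /andP[g0 g1] := dG_y_itv i y01.
rewrite /delta_fun (derive1_G_t i y1) (derive1_is (Gi_der_y i y1)) ler_pdivlMr //; lra.
Qed.

Lemma delta_fun_ge y i m : al <= y <= be ->
  delta_fun (fun t z => Gi b1 c0 c1 t z i) y <= m -> dG_t y i <= m * (1 - dG_y y i).
Proof.
move=> y01; have [a1 _ _ _] := alpha_beta.
have y1 : -1 < y by case/andP: y01 => h _; exact: lt_le_trans h.
have /andP[g0 g1] := dG_y_itv i y01.
rewrite /delta_fun (derive1_G_t i y1) (derive1_is (Gi_der_y i y1)) ler_pdivrMr //; lra.
Qed.

(** The 0 in the minimum accounts for the initial state, which is constant in [t]. Since the minimum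
    is nonpositive, [ND] forces [b' > 0], so the worst state is [al]. *)
Lemma regular_lower d0 d1 : is_min_on `[al, be]%classic (delta_fun (G0 b1 c0)) d0 ->
  is_min_on `[al, be]%classic (delta_fun (G1 b1 c1)) d1 ->
  0 < b' * (al + 1) + b * (1 - b) * Num.min 0 (Num.min d0 d1) -> regular b1 c0 c1.
Proof.
move=> [_ hd0] [_ hd1]; set m := Num.min _ _ => kap0.
have [a1 /andP[a0 be0] _ _] := alpha_beta; have [/andP[b0 b1lt] _ _ _ _] := box0.
have m0 : m <= 0 by rewrite /m ge_min lexx.
have md0 : m <= d0 by rewrite /m !ge_min lexx !orbT.
have md1 : m <= d1 by rewrite /m !ge_min lexx !orbT.
have bb : 0 < b * (1 - b) by rewrite mulr_gt0 // subr_gt0.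
have bm : b * (1 - b) * m <= 0 by rewrite mulr_ge0_le0 // ltW.
have bp : 0 < b' by rewrite -(pmulr_lgt0 _ (_ : 0 < al + 1)); lra.
apply: (regular_of_invariant (P := fun yd => m <= yd) kap0) => //.
  move=> y yd i y01 myd; have /andP[g0 g1] := dG_y_itv i y01.
  have h : m * (1 - dG_y y i) <= dG_t y i.
    apply: delta_fun_le => //; case: i {g0 g1}; [apply: le_trans md1 _; apply: hd1|apply: le_trans md0 _; apply: hd0].
      by rewrite /= in_itv.
    by rewrite /= in_itv.
  by have := ler_wpM2l g0 myd; lra.
move=> y yd /andP[y0 _] myd; apply: le_trans (ler_norm _).
have h1 : b' * (al + 1) <= b' * (1 + y) by rewrite ler_pM2l //; lra.
have h2 : b * (1 - b) * m <= b * (1 - b) * yd by rewrite ler_pM2l.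
exact: lerD.
Qed.

Lemma regular_upper d0 d1 : is_max_on `[al, be]%classic (delta_fun (G0 b1 c0)) d0 ->
  is_max_on `[al, be]%classic (delta_fun (G1 b1 c1)) d1 ->
  b' * (al + 1) + b * (1 - b) * Num.max 0 (Num.max d0 d1) < 0 -> regular b1 c0 c1.
Proof.
move=> [_ hd0] [_ hd1]; set m := Num.max _ _ => kap0.
have [a1 /andP[a0 be0] _ _] := alpha_beta; have [/andP[b0 b1lt] _ _ _ _] := box0.
have m0 : 0 <= m by rewrite /m le_max lexx.
have md0 : d0 <= m by rewrite /m !le_max lexx !orbT.
have md1 : d1 <= m by rewrite /m !le_max lexx !orbT.
have bb : 0 < b * (1 - b) by rewrite mulr_gt0 // subr_gt0.
have bm : 0 <= b * (1 - b) * m by rewrite mulr_ge0 // ltW.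
have bp : b' < 0 by rewrite -(pmulr_llt0 _ (_ : 0 < al + 1)); lra.
apply: (regular_of_invariant (P := fun yd => yd <= m) (kap := - (b' * (al + 1) + b * (1 - b) * m))) => //.
- by rewrite oppr_gt0.
- move=> y yd i y01 myd; have /andP[g0 g1] := dG_y_itv i y01.
  have h : dG_t y i <= m * (1 - dG_y y i).
    apply: delta_fun_ge => //; case: i {g0 g1}; [apply: le_trans _ md1; apply: hd1|apply: le_trans _ md0; apply: hd0].
      by rewrite /= in_itv.
    by rewrite /= in_itv.
  by have := ler_wpM2l g0 myd; lra.
move=> y yd /andP[y0 _] myd; rewrite -normrN; apply: le_trans (ler_norm _); rewrite lerN2.
have h1 : b' * (1 + y) <= b' * (al + 1) by rewrite ler_nM2l //; lra.
have h2 : b * (1 - b) * yd <= b * (1 - b) * m by rewrite ler_pM2l.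
exact: lerD.
Qed.

End Nondegenerate.

(** * The reflection [x -> 1 - x] *)

Section Dual.
Context {R : realType}.

Lemma dual_in_box (b u v : R) : in_box b u v ->
  in_box (1 - b) (- (v / (1 + v))) (- (u / (1 + u))).
Proof.
move=> bx; have [_ /andP[u1 _] _] := bx.
case/in_box_mul: bx => /andP[b0 b1] u0 bu v0 bv.
have v1 : 0 < 1 + v by lra.
have b1' : 0 < 1 - b by lra.
have inv (w : R) : 0 < 1 + w -> - (w / (1 + w)) = (1 + w)^-1 - 1.
  by move=> w0; field; rewrite gt_eqF.
split; first by apply/andP; split; lra.
  apply/andP; split; first by rewrite ltrNr ltr_pdivrMr //; lra.
  by rewrite inv // ltrD2r ltf_pV2.
apply/andP; split; first by rewrite ltrN2 ltr_pdivrMr //; lra.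
have -> : (1 - b) / (1 - (1 - b)) = b^-1 - 1 by rewrite subKr mulrBl mul1r divff // gt_eqF.
by rewrite inv // ltrD2r ltf_pV2 ?posrE //; lra.
Qed.

(** The reflection sends [1 + y] to its inverse, because [1 - mob y (1 - z)] is [mob] at
    [- (y / (1 + y))], and it exchanges the two digits. *)
Lemma Gi_dual (b1 c0 c1 : R -> R) t y i : in_box (b1 t) (c0 t) (c1 t) -> -1 < y ->
  Gi (dual_b1 b1) (dual_c0 c1) (dual_c1 c0) t (- (y / (1 + y))) (~~ i) =
  - (Gi b1 c0 c1 t y i / (1 + Gi b1 c0 c1 t y i)).
Proof.
move=> box y1; have g1 := G1_gt box y1; have g0 := G0_gt box y1.
case/in_box_mul: box => hb u0 bu v0 bv; have d := den_gt0 hb y1; have /andP[b0 b1lt] := hb.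
have v1 : 0 < 1 + c1 t by lra.
have y1' : 0 < 1 + y by lra.
rewrite /Gi /dual_b1 /dual_c0 /dual_c1; case: i => /=.
  rewrite /G0 /G1 in g1 *.
  have e : 1 + ((1 - b1 t + c1 t) * y + c1 t) / (b1 t * y + 1) = (1 + c1 t) * (1 + y) / (b1 t * y + 1).
    by field; rewrite gt_eqF //; lra.
  rewrite e; field; rewrite !gt_eqF //; lra.
rewrite /G0 /G1.
have e : 1 + (b1 t * (1 + c0 t) * y + c0 t) = (1 + c0 t) * (1 + b1 t * y) by ring.
have e2 : (1 - b1 t) * - (y / (1 + y)) + 1 = (1 + b1 t * y) / (1 + y).
  by field; rewrite gt_eqF.
rewrite e e2; field; rewrite !gt_eqF //; lra.
Qed.

Variables (b1 c0 c1 : R -> R) (e0 : R).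
Hypothesis e0_gt0 : 0 < e0.
Hypothesis box : forall t, `|t| < e0 -> in_box (b1 t) (c0 t) (c1 t).

Let db := dual_b1 b1.
Let du := dual_c0 c1.
Let dv := dual_c1 c0.

Let st t w := state db du dv t (map negb w).

Lemma state_dual t w : `|t| < e0 -> -1 < st t w /\
  state b1 c0 c1 t w = - (st t w / (1 + st t w)).
Proof.
move=> tt; have s1 := state_gt w (box tt).
suff e : st t w = - (state b1 c0 c1 t w / (1 + state b1 c0 c1 t w)).
  have s1' : 0 < 1 + state b1 c0 c1 t w by lra.
  have -> : st t w = (1 + state b1 c0 c1 t w)^-1 - 1 by rewrite e; field; rewrite gt_eqF.
  split; first by have := invr_gt0 (1 + state b1 c0 c1 t w); rewrite s1' => h; lra.
  have -> : 1 + ((1 + state b1 c0 c1 t w)^-1 - 1) = (1 + state b1 c0 c1 t w)^-1 by ring.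
  by rewrite invrK; field; rewrite gt_eqF.
rewrite /st; elim/last_ind: w {s1} => [|w i IH]; first by rewrite /state /= mul0r oppr0.
rewrite map_rcons !state_rcons IH Gi_dual //; [exact: box|exact: state_gt (box tt)].
Qed.

Hypothesis b1_der : is_derive (0 : R) 1 b1 (derive1 b1 0).

(** In the coordinate [1 + y], duality is inversion, which preserves compact subsets of [(0, +oo)]
    and Lipschitz bounds there. The quantity bounded by [kap] is multiplied by [- 1 / (1 + y) ^+ 2]
    at the dual state, so it stays away from 0. *)
Lemma regular_dual : regular db du dv -> regular b1 c0 c1.
Proof.
move=> [t0 [lo [hi [L [kap [[t00 lo1 /andP[lo0 hi0] L0 kap0] bnd lip der]]]]]].
have l1 : 0 < 1 + lo by lra.
have h1 : 0 < 1 + hi by lra.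
have e t w : `|t| < e0 -> [/\ -1 < st t w, 0 < 1 + st t w &
   state b1 c0 c1 t w = (1 + st t w)^-1 - 1].
  move=> tt; have [s1 ->] := state_dual w tt; have s1' : 0 < 1 + st t w by lra.
  by split => //; field; rewrite gt_eqF.
have n0 : `|0 : R| < e0 by rewrite normr0.
have b1'_der : derive1 db 0 = - derive1 b1 0.
  apply: derive1_is; apply: is_derive1_eq (is_derive1B (is_derive1_cst 1 0) b1_der).
  by rewrite sub0r.
exists (Num.min t0 e0), ((1 + hi)^-1 - 1), ((1 + lo)^-1 - 1), (L / (1 + lo) ^+ 2), (kap / (1 + hi) ^+ 2).
have tP t : `|t| < Num.min t0 e0 -> `|t| < t0 /\ `|t| < e0 by rewrite lt_min => /andP[].
split.
- split.
  + by rewrite lt_min t00.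
  + by rewrite ltrBrDr addrC subrr invr_gt0.
  + by rewrite subr_le0 subr_ge0 invf_le1 // invf_ge1 //; apply/andP; split; lra.
  + by rewrite divr_gt0 ?exprn_gt0.
  + by rewrite divr_gt0 ?exprn_gt0.
- move=> t w /tP[tt te]; have [s1 s2 ->] := e t w te.
  have /andP[b2 b3] := bnd t (map negb w) tt; rewrite -/(st t w) in b2 b3.
  by rewrite !lerD2r !lef_pV2 ?posrE // !lerD2l b2 b3.
- move=> t w /tP[tt te]; have [s1 s2 ->] := e t w te; have [s1' s2' ->] := e 0 w n0.
  have t00' : `|0 : R| < t0 by rewrite normr0.
  have /andP[b2 _] := bnd t (map negb w) tt; have /andP[b2' _] := bnd 0 (map negb w) t00'.
  have hl := lip t (map negb w) tt; rewrite -/(st t w) -/(st 0 w) in b2 b2' hl.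
  have -> : (1 + st t w)^-1 - 1 - ((1 + st 0 w)^-1 - 1) =
    - (st t w - st 0 w) / ((1 + st t w) * (1 + st 0 w)) by field; rewrite !gt_eqF.
  have dd : 0 < (1 + st t w) * (1 + st 0 w) by rewrite mulr_gt0.
  rewrite mulNr normrN normrM normfV (gtr0_norm dd) mulrAC; apply: ler_pM => //.
    by rewrite invr_ge0 ltW.
  rewrite lef_pV2 ?posrE ?exprn_gt0 // expr2.
  by apply: ler_pM; rewrite ?(ltW l1) // lerD2l.
- move=> w; have [yd yd_der hk] := der (map negb w).
  have [s1 s2 se] := e 0 w n0.
  have dn : 1 + st 0 w != 0 by rewrite gt_eqF.
  have D := is_derive1B (is_derive1V (f := fun t => 1 + st t w) dn (is_derive1D (is_derive1_cst 1 0) yd_der))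
    (is_derive1_cst 1 0).
  exists (- (0 + yd) / (1 + st 0 w) ^+ 2 - 0).
    apply: is_derive1_near e0_gt0 _ D => t tt.
    by rewrite add0r; have [_ _ ->] := e t w tt.
  move: hk; rewrite b1'_der -/(st 0 w) se /db /dual_b1 => hk.
  have -> : derive1 b1 0 * (1 + ((1 + st 0 w)^-1 - 1)) + b1 0 * (1 - b1 0) * (- (0 + yd) / (1 + st 0 w) ^+ 2 - 0) =
    - (- derive1 b1 0 * (1 + st 0 w) + (1 - b1 0) * (1 - (1 - b1 0)) * yd) / (1 + st 0 w) ^+ 2.
    by field.
  rewrite mulNr normrN normrM normfV (gtr0_norm (exprn_gt0 2 s2)).
  have t00' : `|0 : R| < t0 by rewrite normr0.
  have /andP[_ b3] := bnd 0 (map negb w) t00'; rewrite -/(st 0 w) in b3.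
  apply: ler_pM => //; first exact: ltW.
    by rewrite invr_ge0 exprn_ge0 // ltW.
  by rewrite lef_pV2 ?posrE ?exprn_gt0 // lerXn2r ?nnegrE ?(ltW h1) ?(ltW s2) // lerD2l.
Qed.

End Dual.

(** * From sequences to upper and lower limits *)

Section Limsup.
Context {R : realType}.
Local Open Scope ereal_scope.

Lemma lime_sup_le_near (q : R -> \bar R) (C : \bar R) :
  (exists2 d : R, (0 < d)%R & forall h, h != 0%R -> (`|h| < d)%R -> q h <= C) ->
  lime_sup q 0%R <= C.
Proof.
move=> [d d0 H]; rewrite /lime_sup limf_esupE.
apply: (@le_trans _ _ (ereal_sup [set q h | h in [set h | h != 0%R /\ (`|h| < d)%R]])).
  apply: ereal_inf_lbound; exists [set h | h != 0%R /\ (`|h| < d)%R] => //.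
  apply/dnbhs0P; exists d => // t /andP[t0 td] /=; split => //.
  by rewrite -normr_gt0.
by apply: ge_ereal_sup => _ [h [h0 hd] <-]; exact: H.
Qed.

Lemma lime_sup_ge_near (q : R -> \bar R) (c : \bar R) :
  (forall d : R, (0 < d)%R -> exists h, [/\ h != 0%R, (`|h| < d)%R & c <= q h]) ->
  c <= lime_sup q 0%R.
Proof.
move=> H; rewrite /lime_sup limf_esupE; apply: le_ereal_inf_tmp => _ [V /dnbhs0P[d d0 dV] <-].
have [h [h0 hd hc]] := H d d0; apply: (le_trans hc); apply: ereal_sup_ubound.
by exists h => //; apply: dV; rewrite normr_gt0 h0.
Qed.

Lemma lime_inf_ge_near (q : R -> \bar R) (c : \bar R) :
  (exists2 d : R, (0 < d)%R & forall h, h != 0%R -> (`|h| < d)%R -> c <= q h) ->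
  c <= lime_inf q 0%R.
Proof.
move=> [d d0 H]; rewrite /lime_inf leeNr; apply: lime_sup_le_near.
by exists d => // h h0 hd; rewrite leeN2; exact: H.
Qed.

Lemma lime_inf_le_near (q : R -> \bar R) (C : \bar R) :
  (forall d : R, (0 < d)%R -> exists h, [/\ h != 0%R, (`|h| < d)%R & q h <= C]) ->
  lime_inf q 0%R <= C.
Proof.
move=> H; rewrite /lime_inf leeNl; apply: lime_sup_ge_near => d /H[h [h0 hd hc]].
by exists h; split => //; rewrite leeN2.
Qed.

End Limsup.

(** * Masses of cells from the distribution function, and the conclusion *)

Section Distribution.
Context {R : realType}.
Variables (mu : probability (measurableTypeR R) R) (F : R -> R).
Hypothesis mu_F : has_df01 mu F.

Lemma df_itv (a b : R) : 0 <= a -> a <= b -> b <= 1 -> mu `]a, b]%classic = (F b - F a)%:E.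
Proof.
move=> a0 ab b1.
have hb := mu_F (x := b) ltac:(rewrite b1 (le_trans a0)//).
have ha := mu_F (x := a) ltac:(rewrite a0 (le_trans ab)//).
have disj : `[0, a]%classic `&` `]a, b]%classic = set0 :> set R.
  apply/seteqP; split => x //= [].
  by rewrite !in_itv /= => /andP[_ xa] /andP[ax _]; move: ax; rewrite ltNge xa.
have := measureU mu (measurable_itv _) (measurable_itv _) disj.
have -> : `[0, a]%classic `|` `]a, b]%classic = `[0, b]%classic :> set R.
  apply/seteqP; split => x /=; rewrite !in_itv /=.
    case=> /andP[x0 x1]; apply/andP; split => //; first exact: le_trans ab.
    by apply: ltW; exact: le_lt_trans x0.
  by move=> /andP[x0 x1]; have [xa|xa] := lerP x a; [left|right]; rewrite ?x0 ?xa ?x1.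
move=> e; have {}e : (F b)%:E = ((F a)%:E + mu `]a, b]%classic)%E by rewrite -hb -ha; exact: e.
by rewrite EFinB e [X in _ = (X - _)%E]addeC addeK.
Qed.

End Distribution.

Theorem theorem7p7 (R : realType) (I : set R) (b1 c0 c1 : R -> R)
    (F : R -> R -> R) (mu0 : probability (measurableTypeR R) R)
    (hI : open_interval I) (hI0 : I 0)
    (hb1 : smooth_on I b1) (hc0 : smooth_on I c0) (hc1 : smooth_on I c1)
    (hE : forall t, I t -> in_E (b1 t) (c0 t) (c1 t))
    (hF : forall t, I t ->
      deRham_solution (A0 b1 c0 t) (A1 b1 c1 t) (F t))
    (hmu0 : has_df01 mu0 (F 0))
    (hND : ND b1 c0 c1) :
  exists c C : R, [/\ 0 < c, c <= C &
    {ae mu0, forall x : R,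
      let q := fun h : R => (Delta1 F x (x + h) / lil_scale h)%:E in
      [/\ (c%:E <= lime_sup q 0)%E, (lime_sup q 0 <= C%:E)%E,
          ((- C)%:E <= lime_inf q 0)%E
        & (lime_inf q 0 <= (- c)%:E)%E]}].
Proof.
have [e0 e0_gt0 eI] : exists2 e0 : R, 0 < e0 & forall t, `|t| < e0 -> I t.
  have [oI _] := hI; have /nbhs_ballP[e0 /= e0_gt0 H] : nbhs (0 : R) I by exact: open_nbhs_nbhs.
  by exists e0 => // t te; apply: H; rewrite /ball /= sub0r normrN.
have box t : `|t| < e0 -> in_box (b1 t) (c0 t) (c1 t) by move=> /eI /hE[].
have sol t : `|t| < e0 -> deRham_solution (A0 b1 c0 t) (A1 b1 c1 t) (F t) by move=> /eI /hF.
have n0 : `|0 : R| < e0 by rewrite normr0.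
have b1_der := is_derive1_of (hb1 0%N 0 hI0).
have c0_der := is_derive1_of (hc0 0%N 0 hI0).
have c1_der := is_derive1_of (hc1 0%N 0 hI0).
rewrite /derive1n /= in b1_der c0_der c1_der.
have reg : regular b1 c0 c1.
  case: hND => [[contr [d0 [d1 [m0 m1 k]]]]|[contr [d0 [d1 [m0 m1 k]]]]].
    apply: (regular_lower e0_gt0 box b1_der c0_der c1_der _ m0 m1 k).
    by move=> y y01; apply: contr; rewrite /= in_itv.
  (* Second form of [ND]: regularity is proved for the dual curve, which satisfies the same box
     conditions, and transported back. *)
  apply: (regular_dual e0_gt0 box b1_der).
  have dbox t : `|t| < e0 -> in_box (dual_b1 b1 t) (dual_c0 c1 t) (dual_c1 c0 t).
    by move=> /box; exact: dual_in_box.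
  have /in_box_mul[_ u0 _ v0 _] := box 0 n0.
  have [hb _ _] := box 0 n0; have /andP[b0 b1lt] := hb.
  have db_der := is_derive1B (is_derive1_cst 1 0) b1_der.
  have dc0 := is_derive1_div (g := fun t => 1 + c1 t) (lt0r_neq0 (_ : 0 < 1 + c1 0))
    c1_der (is_derive1D (is_derive1_cst 1 0) c1_der).
  have dc1 := is_derive1_div (g := fun t => 1 + c0 t) (lt0r_neq0 u0)
    c0_der (is_derive1D (is_derive1_cst 1 0) c0_der).
  have {}dc0 := is_derive1B (is_derive1_cst 0 0) (dc0 ltac:(lra)).
  have {}dc1 := is_derive1B (is_derive1_cst 0 0) dc1.
  have [l0 dc0'] : exists l, is_derive (0 : R) 1 (dual_c0 c1) l.
    eexists; apply: is_derive1_near e0_gt0 _ dc0 => t _.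
    by rewrite /dual_c0 !add0r.
  have [l1 dc1'] : exists l, is_derive (0 : R) 1 (dual_c1 c0) l.
    eexists; apply: is_derive1_near e0_gt0 _ dc1 => t _.
    by rewrite /dual_c1 !add0r.
  have db' : is_derive (0 : R) 1 (dual_b1 b1) (derive1 (dual_b1 b1) 0).
    by rewrite (derive1_is (f := dual_b1 b1) db_der).
  apply: (regular_upper e0_gt0 dbox db' dc0' dc1' _ m0 m1 k).
  by move=> y y01; apply: contr; rewrite /= in_itv.
have [t0 [pm [L [kap [dp [[t0_gt0 t0e pm0 L0 kap0] p_ge p_lip p_der dp_ge]]]]]] :=
  prob_regular e0_gt0 box b1_der reg.
have te t : `|t| < t0 -> `|t| < e0 by move=> h; exact: lt_le_trans h t0e.
pose p := prob b1 c0 c1; pose H := cdf b1 c0 c1 F.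
have p_sum t w : `|t| < t0 -> p t w false + p t w true = 1 by move/te/(prob_sum box).
have H_itv t w x : `|t| < t0 -> 0 <= x <= 1 -> 0 <= H t w x <= 1 by move/te => h; exact: (cdf_itv box sol).
have H_0 t w : `|t| < t0 -> H t w 0 = 0 by move/te/(cdf_0 box sol).
have H_1 t w : `|t| < t0 -> H t w 1 = 1 by move/te/(cdf_1 box sol).
have H_left t w x : `|t| < t0 -> 0 <= x <= 2^-1 ->
  H t w x = p t w false * H t (rcons w false) (2 * x) by move/te => h; exact: (cdf_left box sol).
have H_right t w x : `|t| < t0 -> 2^-1 <= x <= 1 ->
  H t w x = p t w false + p t w true * H t (rcons w true) (2 * x - 1) by move/te => h; exact: (cdf_right box sol).
(* The empty word has state 0, and [mob 0] is the identity. *)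
have HF t x : H t [::] x = F t x.
  by rewrite /H /cdf /mob /state /= mul0r !addr0 mul1r divr1.
have mu_cell w : mu0 [set x : R | 0 < x <= 1 /\ word (size w) x = w] = (cond_mass p [::] w)%:E.
  have [l0 l1] := left_end_itv (R := R) w.
  have -> : [set x : R | 0 < x <= 1 /\ word (size w) x = w] =
     `]left_end w, left_end w + 2^-1 ^+ size w]%classic.
    by apply/seteqP; split => x /=; rewrite in_itv /= => /cell_itv.
  rewrite (df_itv hmu0) //; last by rewrite lerDl exprn_ge0 //; lra.
  by rewrite -!HF (cond_mass_cdf t0_gt0 H_0 H_1 H_left H_right).
have [c [C [c_gt0 cC main]]] := hd_quot_lil t0_gt0 pm0 L0 p_sum p_ge H_itv H_0 H_1 H_left H_right
  p_lip p_der mu_cell kap0 dp_ge.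
exists c, C; split => //.
have mu_out : mu0 [set x : R | ~~ (0 < x <= 1)] = 0%E.
  have -> : [set x : R | ~~ (0 < x <= 1)] = ~` `]0, 1]%classic.
    by apply/seteqP; split => x /=; rewrite in_itv /= => /negP.
  rewrite probability_setC; last exact: measurable_itv.
  by rewrite (df_itv hmu0) // -!HF H_0 ?H_1 ?normr0 // subr0 subee.
(* [Delta1 F x (x + h)] reverses the sign of both numerator and denominator. *)
have quot x h : Delta1 F x (x + h) = hd_quot H x h.
  rewrite /hd_quot /Delta1 /hd !HF.
  have e y : derive1 (fun t => H t [::] y) 0 = f1 F y.
    by rewrite /f1; congr (derive1 _ 0); apply/funext => t; exact: HF.
  by rewrite !e -(opprB (f1 F (x + h))) -(opprB (F 0 (x + h))) invrN mulrNN.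
have := ae_and (ae_in01 mu_out) main; apply: ae_imp => x [x01 /(_ x01)[[d d0 up] io1 io2]].
pose q h : \bar R := (Delta1 F x (x + h) / lil_scale h)%:E.
have qE h : q h = (hd_quot H x h / lil_scale h)%:E by rewrite /q quot.
rewrite -/q; split.
- by apply: lime_sup_ge_near => e /io1[h [h0 he hc]]; exists h; split => //; rewrite qE lee_fin.
- apply: lime_sup_le_near; exists d => // h h0 hd; have [_ hC] := up h h0 hd.
  by rewrite qE lee_fin; apply: le_trans hC; exact: ler_norm.
- apply: lime_inf_ge_near; exists d => // h h0 hd; have [_ hC] := up h h0 hd.
  by rewrite qE lee_fin lerNl; apply: le_trans hC; rewrite -normrN ler_norm.
- by apply: lime_inf_le_near => e /io2[h [h0 he hc]]; exists h; split => //; rewrite qE lee_fin.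
Qed.
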